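(* For $i=1,2$ let $\mathcal{H}_i$ be a weighted Hardy space in $d_i$ variables with generating function $G_i$ whose radius of convergence is $r_i^2\in(0,\infty]$. Assume that $\mathcal{H}_1$ is weakly related to $\mathcal{H}_2$ via an invertible weighted composition operator $W_{\lambda,\varphi}:\mathcal{H}_2\to\mathcal{H}_1$. Then: (1) If $d_1\ge d_2$, then $\mathcal{H}_1$ and $\mathcal{H}_2$ are isomorphic via an RKHS isomorphism and $d_1=d_2$. (2) If $\mathcal{H}_1$ and $\mathcal{H}_2$ are strongly related, then $\mathcal{H}_1$ and $\mathcal{H}_2$ are isomorphic via an RKHS isomorphism and $d_1=d_2$. (3) If $\mathcal{H}_1$ and $\mathcal{H}_2$ are strongly related, then $G_1$ is entire if and only if $G_2$ is entire. (4) If $\mathcal{H}_1$ and $\mathcal{H}_2$ are strongly related and $r_1<\infty$, then $r_2<\infty$, and $G_1(r_1^2)<\infty$ if and only if $G_2(r_2^2)<\infty$.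
   Context: For $d\in\mathbb{N}$ and $r\in(0,\infty]$ let $r\mathbb{B}_d=\{z\in\mathbb{C}^d:|z|<r\}$ and $\overline{r\mathbb{B}_d}=\{z\in\mathbb{C}^d:|z|\le r\}$ (both equal to $\mathbb{C}^d$ if $r=\infty$); $\langle\cdot,\cdot\rangle_d$ is the standard inner product on $\mathbb{C}^d$. A Hilbert function space (RKHS) on a set $X$ is a Hilbert space $\mathcal H$ of complex functions on $X$ all of whose point evaluations are bounded; $k_x\in\mathcal H$ is the vector with $f(x)=\langle f,k_x\rangle$ for all $f\in\mathcal H$. Generating function: a power series $G(t)=\sum_{n\ge0}a_nt^n$ with $a_0=1$, $a_n>0$ for all $n$, and radius of convergence in $(0,\infty]$. Weighted Hardy space in $d$ variables: a Hilbert function space of holomorphic functions on a ball $r\mathbb{B}_d$, $r\in(0,\infty]$, in which the monomials $z^\alpha$ form a complete orthogonal set of nonzero vectors with $\|z^\alpha\|^2/\alpha!=\|z^\beta\|^2/\beta!$ whenever $|\alpha|=|\beta|$, and $\|\mathbf{1}\|=1$. Equivalently its reproducing kernel is $K(z,w)=G(\langle z,w\rangle_d)$ for a (unique) generating function $G=\sum a_nt^n$ (the generating function of the space), and then $\|z^\alpha\|^{-2}=a_{|\alpha|}\frac{|\alpha|!}{\alpha!}$. Convention: every weighted Hardy space is regarded as a space of functions on its natural maximal domain $X$: if $r^2\in(0,\infty]$ is the radius of convergence of $G$, then $X=\mathbb{C}^d$ if $r=\infty$; $X=r\mathbb{B}_d$ if $r<\infty$ and $G(r^2)=\infty$; $X=\overline{r\mathbb{B}_d}$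 if $r<\infty$ and $G(r^2)<\infty$ (functions then extend continuously to the closed ball). For Hilbert function spaces $\mathcal{H}_i$ on $X_i$, a weighted composition operator $W_{\lambda,\varphi}:\mathcal{H}_2\to\mathcal{H}_1$ is a bounded operator $f\mapsto\lambda\,(f\circ\varphi)$ with $\varphi:X_1\to X_2$ and $\lambda:X_1\to\mathbb{C}$; it is invertible if it is a bounded bijection (its inverse need not be a weighted composition operator). $\mathcal{H}_1$ is weakly related to $\mathcal{H}_2$ if there is an invertible weighted composition operator $\mathcal{H}_2\to\mathcal{H}_1$; they are strongly related if each is weakly related to the other. An RKHS isomorphism from $\mathcal{H}_1$ to $\mathcal{H}_2$ is a bijective bounded linear map $T:\mathcal{H}_1\to\mathcal{H}_2$ with $T(k^1_x)=\overline{\lambda(x)}\,k^2_{\varphi(x)}$ for all $x\in X_1$, where $\lambda:X_1\to\mathbb{C}$ is nowhere vanishing, $\varphi:X_1\to X_2$ is a bijection, and $k^i_x$ is the reproducing kernel vector of $\mathcal{H}_i$ at $x$. *)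

(* Defs.v *)
From HB Require Import structures.
From mathcomp Require Import all_boot all_order all_algebra.
From mathcomp Require Import complex.
From mathcomp Require Import sesquilinear.
From mathcomp Require Import all_classical all_reals all_analysis.

Set Implicit Arguments.
Unset Strict Implicit.
Unset Printing Implicit Defensive.

Import Order.TTheory GRing.Theory Num.Theory.
Import numFieldNormedType.Exports.

Local Open Scope classical_set_scope.
Local Open Scope ring_scope.
Local Open Scope complex_scope.

(* The topology and norm on R[i] are those of any numFieldType. *)
#[warnings="-redundant-canonical-projection"]
HB.instance Definition _ (R : realType) := NormedModule.copy R[i] R[i]^o.

(* A Hilbert function space on X: a complete normed space whose norm comes from
   an inner product (linear in its first argument), whose vectors are identified
   with functions on X through the injective linear map [ev]. *)
Record hilbert_function_space (R : realType) (X : Type) := HilbertFunctionSpace {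
  hfs_space :> completeNormedModType R[i];
  hfs_ip : {dot hfs_space for (@Num.conj R[i])};
  hfs_ip_norm : forall f : hfs_space, `|f| ^+ 2 = hfs_ip f f;
  ev : hfs_space -> X -> R[i];
  ev_linear : forall (c : R[i]) (f g : hfs_space) (x : X),
    ev (c *: f + g) x = c * ev f x + ev g x;
  ev_inj : injective ev;
  ev_bounded : forall x : X, exists M : R,
    forall f : hfs_space, `|ev f x| <= M%:C * `|f|
}.

Section HilbertFunctionSpaces.
Variable R : realType.

(* The vector k_x with f(x) = <f, k_x>; it exists and is unique by the Riesz
   representation theorem, so the default value 0 is never used. *)
Definition rkhs_kernel (X : Type) (H : hilbert_function_space R X) (x : X) : H :=
  xget (0 : H) [set k : H | forall f : H, ev f x = hfs_ip H f k].

Definition bounded_operator (V W : normedModType R[i]) (T : V -> W) : Prop :=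
  exists M : R, forall f : V, `|T f| <= M%:C * `|f|.

Variables X1 X2 : Type.
Variables (H1 : hilbert_function_space R X1) (H2 : hilbert_function_space R X2).

Definition invertible_weighted_composition
    (lambda : X1 -> R[i]) (phi : X1 -> X2) : Prop :=
  exists W : {linear H2 -> H1},
    [/\ forall (f : H2) (x : X1), ev (W f) x = lambda x * ev f (phi x),
        bounded_operator W & bijective W].

Definition weakly_related : Prop :=
  exists (lambda : X1 -> R[i]) (phi : X1 -> X2),
    invertible_weighted_composition lambda phi.

Definition rkhs_isomorphic : Prop :=
  exists (T : {linear H1 -> H2}) (lambda : X1 -> R[i]) (phi : X1 -> X2),
    [/\ bounded_operator T, bijective T, forall x : X1, lambda x != 0,
        bijective phi &
        forall x : X1,
          T (rkhs_kernel H1 x) = (Num.conj (lambda x)) *: rkhs_kernel H2 (phi x)].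

End HilbertFunctionSpaces.

Definition strongly_related (R : realType) (X1 X2 : Type)
    (H1 : hilbert_function_space R X1) (H2 : hilbert_function_space R X2) : Prop :=
  weakly_related H1 H2 /\ weakly_related H2 H1.

Section GeneratingFunctions.
Variable R : realType.
Implicit Types (a : nat -> R) (r : \bar R).

Definition convergence_radius a : \bar R :=
  ereal_sup [set t%:E | t in [set t : R | 0 <= t /\ cvgn (pseries a t)]].

Definition generating_function a : Prop :=
  [/\ a 0%N = 1, forall n : nat, 0 < a n & (0 < convergence_radius a)%E].

Definition entire a : Prop := convergence_radius a = +oo%E.

(* G(t) in [0, +oo], for t >= 0. *)
Definition gf_value a (t : R) : \bar R :=
  (\sum_(0 <= n <oo) (a n * t ^+ n)%:E)%E.

Variable d : nat.
Implicit Types z w : 'rV[R[i]]_d.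

Definition cdot z w : R[i] := \sum_i z 0 i * Num.conj (w 0 i).

Definition euclidean_norm z : R := Num.sqrt (complex.Re (cdot z z)).

Definition centered_open_ball r : set 'rV[R[i]]_d :=
  [set z | ((euclidean_norm z)%:E < r)%E].

Definition centered_closed_ball r : set 'rV[R[i]]_d :=
  [set z | ((euclidean_norm z)%:E <= r)%E].

(* The natural maximal domain; r is the square root of the radius of convergence
   of the power series with coefficients a. *)
Definition maximal_domain a r : set 'rV[R[i]]_d :=
  if r == +oo%E then setT
  else if gf_value a (fine r ^+ 2) == +oo%E then centered_open_ball r
  else centered_closed_ball r.

Definition multi_abs (alpha : {ffun 'I_d -> nat}) : nat := (\sum_i alpha i)%N.

Definition multi_fact (alpha : {ffun 'I_d -> nat}) : nat :=
  (\prod_i (alpha i)`!)%N.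

Definition monomial (alpha : {ffun 'I_d -> nat}) z : R[i] :=
  \prod_i z 0 i ^+ alpha i.

End GeneratingFunctions.

Arguments maximal_domain {R} d a r.

Section WeightedHardySpaces.
Variables (R : realType) (d : nat) (a : nat -> R) (r : \bar R).
Variable H : hilbert_function_space R (maximal_domain d a r).

Definition holomorphic_functions : Prop :=
  forall f : H, exists F : 'rV[R[i]]_d -> R[i],
    [/\ forall x : maximal_domain d a r, F (val x) = ev f x,
        forall z : 'rV[R[i]]_d, centered_open_ball r z -> differentiable F z &
        {within maximal_domain d a r, continuous F}].

(* The last condition says that the power series with coefficients a
   is the generating function of H. *)
Definition weighted_hardy_space : Prop :=
  [/\ generating_function a,
      holomorphic_functions,
      exists mon : {ffun 'I_d -> nat} -> H,
        [/\ forall alpha x, ev (mon alpha) x = monomial alpha (val x),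
            forall alpha, mon alpha != 0,
            forall alpha beta, alpha != beta ->
              hfs_ip H (mon alpha) (mon beta) = 0,
            forall f : H, (forall alpha, hfs_ip H f (mon alpha) = 0) -> f = 0 &
            [/\ forall alpha beta, multi_abs alpha = multi_abs beta ->
                  `|mon alpha| ^+ 2 / (multi_fact alpha)%:R
                  = `|mon beta| ^+ 2 / (multi_fact beta)%:R,
                `|mon [ffun=> 0%N]| = 1 &
                forall alpha, `|mon alpha| ^- 2 = (a (multi_abs alpha))%:C *
                  ((multi_abs alpha)`!%:R / (multi_fact alpha)%:R)]] &
      forall x w : maximal_domain d a r,
        [series (a n)%:C * cdot (val x) (val w) ^+ n]_n @ \oo
          --> (ev (rkhs_kernel H w) x : R[i])].

End WeightedHardySpaces.

(* Main.v *)
Require Import Defs.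
From HB Require Import structures.
From mathcomp Require Import all_boot all_order all_algebra.
From mathcomp Require Import complex.
From mathcomp Require Import sesquilinear.
From mathcomp Require Import all_classical all_reals all_analysis.
From mathcomp Require Import ring lra zify.
Import Order.TTheory GRing.Theory Num.Theory.
Import numFieldNormedType.Exports.
Local Open Scope classical_set_scope.
Local Open Scope ring_scope.
Local Open Scope complex_scope.

(** Let [W] be the operator [f |-> lam (f o Phi)] from the second space to the
    first.  Its adjoint sends the kernel vector at [x] to a multiple of the kernel
    vector at [Phi x], and it is a bounded bijection: boundedness of the inverse
    follows from uniform boundedness ([adjoint_bijective]).  So the adjoint is the
    required isomorphism as soon as [Phi] is a bijection.  Since the range of [W]
    contains the constants and the coordinates, [lam] has no zero and [Phi] is
    injective; what has to be shown is that [Phi] is onto when [d2 <= d1].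

    First, [Phi 0] is an interior point of the second domain ([Phi0_interior]).
    All [lam * p(Phi)], with [p] a polynomial, lie in the first space and have
    power series on complex lines, so a Schwarz lemma is available ([schwarz]),
    and applied to the powers of [<Phi, Phi 0>] it yields the maximum principle.
    Next, if the differential of [Phi] at [x] killed a vector [v], the derivative
    along [v] would be a multiple of the evaluation at [x] on the whole first
    space; the constants and the coordinates exclude this unless [v = 0]
    ([differential_injective]).  Hence [d1 <= d2], and in equal dimensions the
    image of [Phi] contains a neighbourhood of [Phi 0] ([local_surjectivity]).

    Put [g_al = W^-1 z^al].  On the image of [Phi] one has
    [g_al g_be = g_0 g_(al+be)], and by the identity principle
    ([product_identity]) this persists on the whole second domain.  It has two
    consequences at a point [y] of that domain.  If [g_0 y = 0], then all
    [g_al y] vanish, which is impossible as the evaluation at [y] is not zero.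
    So [g_al y = (g_0 y) p^al] for a point [p] of coordinate space, and since the
    evaluation at [y] is bounded, the kernel series converges at [p]: the point
    [p] lies in the first domain because that domain is maximal.  Comparing
    functionals, [y = Phi p] ([Phi_onto]).

    If the spaces are strongly related, the inequality [d1 <= d2] holds both ways
    and [Phi] is onto in both directions.  A Liouville argument, again from the
    Schwarz lemma, shows that [r1 = +oo] forces [r2 = +oo] ([infinite_radius]),
    and a closed ball, being compact, is not mapped onto an open one
    ([finite_value_of_related]). *)

(** * Real-valued norms and inner products *)

Section RealNorm.
Context {R : realType}.

(** The norm of a complex normed module takes its values in [R[i]]; its real
    part carries the same information and lives in an ordered field. *)
Definition nr (V : normedModType R[i]) (f : V) : R := complex.Re `|f|.

Lemma nrE (V : normedModType R[i]) (f : V) : `|f| = (nr V f)%:C.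
Proof. by rewrite /nr RRe_real // normr_real. Qed.
End RealNorm.
Arguments nr {R V} f.

Section RealNormTheory.
Context {R : realType}.
Local Notation C := R[i].

Lemma ReD (x y : C) : complex.Re (x + y) = complex.Re x + complex.Re y.
Proof. by case: x; case: y. Qed.
Lemma ReN (x : C) : complex.Re (- x) = - complex.Re x.
Proof. by case: x. Qed.
Lemma ReZ (a : R) (x : C) : complex.Re (a%:C * x) = a * complex.Re x.
Proof. by case: x => u v /=; rewrite mul0r subr0. Qed.
Lemma ReJ (x : C) : complex.Re (Num.conj x) = complex.Re x.
Proof. by case: x. Qed.

Context {V : normedModType C}.
Implicit Types f g : V.
Lemma nr_ge0 f : 0 <= nr f.
Proof. by rewrite -ler0c -nrE normr_ge0. Qed.
Lemma nrD f g : nr (f + g) <= nr f + nr g.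
Proof. by rewrite -lecR rmorphD /= -!nrE ler_normD. Qed.
Lemma nrN f : nr (- f) = nr f. Proof. by rewrite /nr normrN. Qed.
Lemma nr0 : nr (0 : V) = 0. Proof. by rewrite /nr normr0. Qed.
Lemma nrB f g : nr (f - g) = nr (g - f). Proof. by rewrite /nr distrC. Qed.
Lemma nr_eq0 f : nr f = 0 -> f = 0.
Proof. by move=> h; apply/eqP; rewrite -normr_eq0 nrE h. Qed.
Lemma nrZ (c : C) f : nr (c *: f) = nr c * nr f.
Proof.
by apply: complexI; rewrite rmorphM /= -!nrE normrZ.
Qed.
Lemma nrM (c e : C) : nr (c * e) = nr c * nr e.
Proof. by apply: complexI; rewrite rmorphM /= -!nrE normrM. Qed.
End RealNormTheory.

Section ComplexNorm.
Context {R : realType}.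
Local Notation C := R[i].
Implicit Types c e : C.

Lemma nr_real (a : R) : nr (a%:C : C) = `|a|.
Proof. by rewrite /nr normc_def /= expr0n addr0 sqrtr_sqr. Qed.
Lemma nr_nat n : nr (n%:R : C) = n%:R.
Proof. by rewrite -(rmorph_nat (real_complex R)) nr_real normr_nat. Qed.
Lemma nrJ c : nr (Num.conj c : C) = nr c.
Proof. by rewrite /nr norm_conjC. Qed.
Lemma inv_succ_lt (e : R) : 0 < e ->
  exists N, forall n, (N <= n)%N -> n.+1%:R^-1 < e.
Proof.
move=> e0; exists (Num.truncn e^-1) => n Nn.
rewrite -[ltRHS]invrK ltf_pV2 ?posrE ?invr_gt0 ?ltr0n //.
by apply: lt_le_trans (truncnS_gt _) _; rewrite ler_nat ltnS.
Qed.
Lemma nr_sqr c : (nr (c : C) ^+ 2)%:C = c * Num.conj c.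
Proof. by rewrite rmorphXn /= -nrE normCK. Qed.
Lemma nrX c n : nr (c ^+ n : C) = nr (c : C) ^+ n.
Proof.
elim: n => [|n IH]; last by rewrite !exprS nrM IH.
by rewrite !expr0 -[1]/(1%:C) nr_real normr1.
Qed.
Lemma nrV c : nr (c^-1 : C) = (nr (c : C))^-1.
Proof. by apply: complexI; rewrite fmorphV /= -!nrE normfV. Qed.
Lemma Re_le_nr c : complex.Re c <= nr (c : C).
Proof.
rewrite /nr normc_def /=; apply: le_trans (ler_norm _) _.
by rewrite -sqrtr_sqr ler_sqrt ?lerDl ?sqr_ge0 // addr_ge0 ?sqr_ge0.
Qed.
Lemma ReN_le_nr c : - complex.Re c <= nr (c : C).
Proof. by rewrite -ReN -nrN Re_le_nr. Qed.
Lemma nr_le_ReIm c : nr (c : C) <= `|complex.Re c| + `|complex.Im c|.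
Proof.
rewrite /nr normc_def /= -[leRHS]ger0_norm ?addr_ge0 // -sqrtr_sqr.
rewrite ler_sqrt ?sqr_ge0 // sqrrD !real_normK ?num_real //.
by rewrite lerD2r lerDl mulrn_wge0 // mulr_ge0.
Qed.

Lemma cvg_nrP (V : normedModType C) (u : nat -> V) (l : V) :
  (u @ \oo --> l) <->
  (forall e : R, 0 < e -> exists N, forall n, (N <= n)%N -> nr (u n - l) < e).
Proof.
split => [/cvgrPdist_lt cu e e0|h].
  have /cu [N _ hN] : 0 < e%:C by rewrite ltcR.
  by exists N => n /hN /=; rewrite distrC nrE ltcR.
apply/cvgrPdist_lt => e; rewrite ltcE /= => /andP[/eqP ie /h [N hN]].
exists N => // n /= /hN; rewrite distrC nrE.
by rewrite ltcE /= ie eqxx.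
Qed.

Lemma cauchy_nr (V : completeNormedModType C) (u : nat -> V) :
  (forall e : R, 0 < e -> exists N, forall m n, (N <= m)%N -> (N <= n)%N ->
     nr (u m - u n) < e) -> exists l : V, u @ \oo --> l.
Proof.
move=> h; apply: (iffLR (cvg_ex _)).
apply: cauchy_cvg; apply: cauchy_exP => e.
rewrite ltcE /= => /andP[/eqP ie /h [N hN]].
exists (u N), N => // n /= Nn; rewrite -ball_normE /= nrE.
by rewrite ltcE /= ie eqxx /=; apply: hN.
Qed.

Lemma cvg_unique_nr (V : normedModType C) (u : nat -> V) (l l' : V) :
  u @ \oo --> l -> u @ \oo --> l' -> l = l'.
Proof. by move=> h h'; apply: (cvg_unique _ h h'). Qed.

End ComplexNorm.

Section InnerProduct.
Context {R : realType}.
Local Notation C := R[i].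
Context {V : completeNormedModType C} {ip : {dot V for (@Num.conj C)}}.
Hypothesis ip_norm : forall f : V, `|f| ^+ 2 = ip f f.
Implicit Types f g h : V.

Lemma ipDl f g h : ip (f + g) h = ip f h + ip g h.
Proof. exact: linearDl. Qed.
Lemma ipBl f g h : ip (f - g) h = ip f h - ip g h.
Proof. exact: linearBl. Qed.
Lemma ipDr f g h : ip h (f + g) = ip h f + ip h g.
Proof. exact: linearDr. Qed.
Lemma ipBr f g h : ip h (f - g) = ip h f - ip h g.
Proof. exact: linearBr. Qed.
Lemma ipZl c f g : ip (c *: f) g = c * ip f g.
Proof. exact: linearZl_LR. Qed.
Lemma ipZr c f g : ip f (c *: g) = Num.conj c * ip f g.
Proof. exact: linearZr_LR. Qed.
Lemma ipC f g : ip f g = Num.conj (ip g f).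
Proof. by rewrite hermC expr0 mul1r. Qed.
Lemma ip0r f : ip f 0 = 0. Proof. exact: linear0r. Qed.
Lemma ip_suml (I : Type) (r : seq I) (P : pred I) (F : I -> V) g :
  ip (\sum_(i <- r | P i) F i) g = \sum_(i <- r | P i) ip (F i) g.
Proof. exact: linear_sumlz. Qed.
Lemma ip_sumr (I : Type) (r : seq I) (P : pred I) (F : I -> V) g :
  ip g (\sum_(i <- r | P i) F i) = \sum_(i <- r | P i) ip g (F i).
Proof. exact: linear_sumr. Qed.

Lemma ip_nr f : ip f f = (nr f ^+ 2)%:C.
Proof. by rewrite -ip_norm nrE rmorphXn. Qed.

Lemma nrD_sqr f g :
  nr (f + g) ^+ 2 = nr f ^+ 2 + 2 * complex.Re (ip f g) + nr g ^+ 2.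
Proof.
have E h : nr h ^+ 2 = complex.Re (ip h h) by rewrite ip_nr.
rewrite !E ipDl !ipDr !ReD (ipC g f) ReJ; ring.
Qed.

(** Expand the squared norm of [f] minus its projection on [g]. *)
Lemma cauchy_schwarz f g : nr (ip f g : C) <= nr f * nr g.
Proof.
have [g0|/eqP gn0] := eqVneq (nr g) 0.
  by rewrite (nr_eq0 _ g0) ip0r !nr0 mulr0.
have g0 : 0 < nr g by rewrite lt_neqAle nr_ge0 eq_sym; apply/andP; split => //; apply/eqP.
pose c := - (ip f g / (nr g ^+ 2)%:C).
have H : nr (f + c *: g) ^+ 2 = nr f ^+ 2 - nr (ip f g : C) ^+ 2 / nr g ^+ 2.
  have gJ : Num.conj (nr g ^+ 2)%:C = (nr g ^+ 2)%:C :> C by apply: conjc_real.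
  have cJ : Num.conj c = - (Num.conj (ip f g) / (nr g ^+ 2)%:C).
    by rewrite /c rmorphN /= rmorphM /= fmorphV /= gJ.
  have n0 : (nr g ^+ 2)%:C != 0 :> C.
    by rewrite eq_complex /= eqxx andbT expf_neq0 // gt_eqF.
  apply: complexI; rewrite -ip_nr ipDl !ipDr !ipZl !ipZr ip_nr (ipC g f) ip_nr.
  rewrite rmorphB /= [X in _ = _ - X]rmorphM /= nr_sqr [(_ ^-1)%:C]fmorphV /=.
  rewrite cJ /c; move: (Num.conj _) (_ %:C) (_ %:C) n0 => a b e n0.
  by field.
have : 0 <= nr f ^+ 2 - nr (ip f g : C) ^+ 2 / nr g ^+ 2 by rewrite -H sqr_ge0.
rewrite subr_ge0 ler_pdivrMr ?exprn_gt0 // -exprMn.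
by rewrite ler_pXn2r // nnegrE ?mulr_ge0 ?nr_ge0.
Qed.

End InnerProduct.

(** * Riesz representation, adjoints and bounded inverses *)

Section LaxMilgram.
Context {R : realType}.
Local Notation C := R[i].
Context {V1 V2 : completeNormedModType C} {ip : {dot V2 for (@Num.conj C)}}.
Hypothesis ip_norm : forall f : V2, `|f| ^+ 2 = ip f f.
Variables (S : {linear V1 -> V2}) (l : {scalar V1}) (c M L : R).
Hypotheses (c_gt0 : 0 < c) (S_below : forall u, c * nr u <= nr (S u))
  (S_above : forall u, nr (S u) <= M * nr u)
  (l_above : forall u, nr (l u : C) <= L * nr u).

Let J (u : V1) : R := nr (S u) ^+ 2 - 2 * complex.Re (l u).

Let J_lb u : - (L / c) ^+ 2 <= J u.
Proof.
have h1 : complex.Re (l u) <= L * nr u by exact: le_trans (Re_le_nr _) (l_above u).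
have L0 : 0 <= L * nr u by exact: le_trans (nr_ge0 _) (l_above u).
have h2 : (c * nr u) ^+ 2 <= nr (S u) ^+ 2.
  by rewrite ler_pXn2r // nnegrE ?mulr_ge0 ?nr_ge0 // ltW.
have h3 : 0 <= (c * nr u - L / c) ^+ 2 by exact: sqr_ge0.
have h4 : (c * nr u) * (L / c) = L * nr u by field; rewrite gt_eqF.
rewrite /J; nra.
Qed.

Let has_infJ : has_inf [set J u | u in [set: V1]].
Proof.
split; first by exists (J 0), 0.
by exists (- (L / c) ^+ 2) => _ [u _ <-]; exact: J_lb.
Qed.

Let m := inf [set J u | u in [set: V1]].

Let m_le u : m <= J u.
Proof. by apply: ge_inf; [case: has_infJ | exists u]. Qed.

Let ReSym f g : complex.Re (ip f g) = complex.Re (ip g f).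
Proof. by rewrite (ipC f g) ReJ. Qed.

Let parallelogram u v :
  nr (S (u - v)) ^+ 2 = 2 * J u + 2 * J v - 4 * J (2^-1 *: (u + v)).
Proof.
have Sh : S (2^-1 *: (u + v)) = 2^-1 *: (S u + S v) by rewrite linearZ linearD.
have lh : l (2^-1 *: (u + v)) = (2^-1)%:C * (l u + l v).
  by rewrite linearZ /= linearD fmorphV /= rmorph_nat.
rewrite /J Sh lh linearB nrZ ReZ ReD nrV nr_nat.
rewrite exprMn (nrD_sqr ip_norm) (nrD_sqr ip_norm) nrN.
have -> : complex.Re (ip (S u) (- S v)) = - complex.Re (ip (S u) (S v)).
  by rewrite linearNr ReN.
by field.
Qed.

Let minimizing (n : nat) : exists u, J u < m + n.+1%:R^-1.
Proof.
have e0 : 0 < n.+1%:R^-1 :> R by rewrite invr_gt0 ltr0n.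
by have [_ [u _ <-] h] := inf_adherent e0 has_infJ; exists u.
Qed.

Let quad0 (a b : R) : 0 <= a -> (forall t : R, 0 <= a * t ^+ 2 + 2 * b * t) -> b = 0.
Proof.
move=> a0 h; have a1 : 0 < a + 1 by lra.
have := h (- b / (a + 1)).
have -> : a * (- b / (a + 1)) ^+ 2 + 2 * b * (- b / (a + 1))
   = - (b ^+ 2 * (a + 2)) / (a + 1) ^+ 2.
  by field; rewrite gt_eqF.
rewrite mulNr oppr_ge0 pmulr_lle0 ?invr_gt0 ?exprn_gt0 // => h1.
have : b ^+ 2 <= 0 by rewrite -(pmulr_lle0 _ (_ : 0 < a + 2)) //; lra.
by rewrite le_eqVlt ltNge sqr_ge0 orbF sqrf_eq0 => /eqP.
Qed.

(** Minimise [nr (S u) ^+ 2 - 2 Re (l u)]: by the parallelogram law a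
    minimising sequence is Cauchy, and the first variation at its limit is the
    asserted equation.  [S = id] gives the Riesz representation, and
    [l v = ip (S v) h] the projection of [h] on the range of [S]. *)
Lemma lax_milgram : exists u, forall v, ip (S v) (S u) = l v.
Proof.
have [x hx] : {x : nat -> V1 | forall n, J (x n) < m + n.+1%:R^-1}.
  by exists (fun n => projT1 (cid (minimizing n))) => n; case: cid.
have [u cu] : exists u : V1, x @ \oo --> u.
  apply: cauchy_nr => e e0.
  have ce : 0 < (c * e) ^+ 2 / 4 by rewrite divr_gt0 // exprn_gt0 // mulr_gt0.
  have [N hN] := inv_succ_lt _ ce.
  exists N => i j /hN hi /hN hj.
  have p := parallelogram (x i) (x j).
  have q : nr (S (x i - x j)) ^+ 2 < (c * e) ^+ 2.
    rewrite p; have := m_le (2^-1 *: (x i + x j)).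
    move: (hx i) (hx j) hi hj; rewrite [J]lock; set A := locked J _.
    set B := locked J _; set D := locked J _; set E := (c * e) ^+ 2.
    set p1 := _^-1; set p2 := _^-1; lra.
  have q' : nr (S (x i - x j)) < c * e.
    by move: q; rewrite ltr_pXn2r // nnegrE ?nr_ge0 // mulr_ge0 // ltW.
  by have := le_lt_trans (S_below _) q'; rewrite ltr_pM2l.
exists u => v.
have re0 w : complex.Re (ip (S w) (S u)) - complex.Re (l w) = 0.
  pose b0 := complex.Re (ip (S w) (S u)) - complex.Re (l w).
  suff h : forall t : R, 0 <= nr (S w) ^+ 2 * t ^+ 2 + 2 * b0 * t.
    exact: quad0 (sqr_ge0 _) h.
  rewrite /b0 => t.
  apply/ler_addgt0Pr => e e0.
  pose K := 2 * `|t| * (`|M| * nr (S w)) + 1.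
  have K0 : 0 < K by rewrite ltr_wpDl // !mulr_ge0 // nr_ge0.
  have e2 : 0 < e / 2 by lra.
  have eK : 0 < e / 2 / K by rewrite divr_gt0.
  have [N1 h1] := inv_succ_lt _ e2.
  have [N2 h2] := (iffLR (cvg_nrP _ _ _) cu) _ eK.
  pose n := maxn N1 N2.
  have {}h1 := h1 n (leq_maxl _ _); have {}h2 := h2 n (leq_maxr _ _).
  have := hx n; have := m_le (x n + t%:C *: w).
  have lh : l (x n + t%:C *: w) = l (x n) + t%:C * l w by rewrite linearD linearZ.
  have Sh : S (x n + t%:C *: w) = S (x n) + t%:C *: S w by rewrite linearD linearZ.
  rewrite /J lh Sh (nrD_sqr ip_norm) nrZ nr_real ReD ReZ.
  rewrite (ReSym (S (x n))) ipZl ReZ exprMn real_normK ?num_real //.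
  have -> : ip (S w) (S (x n)) = ip (S w) (S u) + ip (S w) (S (x n - u)).
    by rewrite -ipDr -linearD subrKC.
  rewrite ReD.
  set b := complex.Re (ip (S w) (S u)); set b' := complex.Re (ip (S w) (S (x n - u))).
  have hb : `|t * b'| <= e / 2 / 2.
    have hb' : `|b'| <= nr (S w) * (`|M| * nr (x n - u)).
      apply: le_trans (_ : nr (ip (S w) (S (x n - u)) : C) <= _).
        by rewrite ler_norml Re_le_nr andbT lerNl ReN_le_nr.
      apply: le_trans (cauchy_schwarz ip_norm _ _) _.
      rewrite ler_wpM2l ?nr_ge0 //; apply: le_trans (S_above _) _.
      by rewrite ler_wpM2r ?nr_ge0 // ler_norm.
    rewrite normrM; apply: le_trans (ler_wpM2l (normr_ge0 t) hb') _.
    move: h2; rewrite ltr_pdivlMr // /K => h2.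
    have := nr_ge0 (x n - u); nra.
  have hb2 : t * b' <= e / 2 / 2 by exact: le_trans (ler_norm _) hb.
  move=> A B; move: A B h1; set iv := _^-1; nra.
have key w : complex.Re (ip (S w) (S u) - l w) = 0 by rewrite ReD ReN re0.
apply/eqP; rewrite -subr_eq0 eq_complex key eqxx /=.
have := key ('i%C *: v).
have -> : l ('i%C *: v) = 'i%C * l v by rewrite linearZ.
have -> : S ('i%C *: v) = 'i%C *: S v by rewrite linearZ.
by rewrite ipZl -mulrBr mulrC ReiNIm => /eqP; rewrite oppr_eq0.
Qed.
End LaxMilgram.

Section Adjoint.
Context {R : realType}.
Local Notation C := R[i].

Lemma riesz {V : completeNormedModType C} {ip : {dot V for (@Num.conj C)}}
    (ip_norm : forall f : V, `|f| ^+ 2 = ip f f) (l : V -> C) (L : R) :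
  scalar l -> (forall u, nr (l u : C) <= L * nr u) ->
  exists k, forall f, l f = ip f k.
Proof.
move=> ls lL.
pose l' : {scalar V} := HB.pack l (GRing.isLinear.Build _ _ _ _ _ ls).
have [||||u hu] := @lax_milgram _ V V ip ip_norm idfun l' 1 1 L.
- exact: ltr01.
- by move=> u; rewrite mul1r.
- by move=> u; rewrite mul1r.
- exact: lL.
- by exists u => f; have := hu f => /= ->.
Qed.

Context {V1 V2 : completeNormedModType C}.
Context {ip1 : {dot V1 for (@Num.conj C)}} {ip2 : {dot V2 for (@Num.conj C)}}.
Hypothesis ip1_norm : forall f : V1, `|f| ^+ 2 = ip1 f f.
Hypothesis ip2_norm : forall f : V2, `|f| ^+ 2 = ip2 f f.

Lemma ip_ext {V : completeNormedModType C} {ip : {dot V for (@Num.conj C)}}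
    (ip_norm : forall f : V, `|f| ^+ 2 = ip f f) (u v : V) :
  (forall g, ip g u = ip g v) -> u = v.
Proof.
move=> h; apply/eqP; rewrite -subr_eq0; apply/eqP; apply: nr_eq0.
apply/eqP; rewrite -sqrf_eq0; apply/eqP; apply: complexI.
by rewrite -(ip_nr ip_norm) ipBr h subrr.
Qed.

Lemma adjoint_exists (W : {linear V2 -> V1}) (M : R) :
  (forall g, nr (W g) <= M * nr g) ->
  exists T : {linear V1 -> V2}, forall g f, ip1 (W g) f = ip2 g (T f).
Proof.
move=> WM.
have ex f : exists k, forall g, ip1 (W g) f = ip2 g k.
  apply: (riesz ip2_norm (fun g => ip1 (W g) f) (M * nr f)).
    by move=> a g g'; rewrite linearP ipDl ipZl.
  move=> g; apply: le_trans (cauchy_schwarz ip1_norm _ _) _.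
  by rewrite mulrAC ler_wpM2r ?nr_ge0.
pose T f := projT1 (cid (ex f)).
have TE g f : ip1 (W g) f = ip2 g (T f) by rewrite /T; case: cid.
have Tl : linear T.
  move=> a f f'; apply: (ip_ext ip2_norm) => g.
  by rewrite -TE ipDr ipZr ipDr ipZr !TE.
pose T' : {linear V1 -> V2} := HB.pack T (GRing.isLinear.Build _ _ _ _ _ Tl).
by exists T'.
Qed.

Lemma adjoint_bounded (W : {linear V2 -> V1}) (T : V1 -> V2) (M : R) :
  0 <= M -> (forall g, nr (W g) <= M * nr g) ->
  (forall g f, ip1 (W g) f = ip2 g (T f)) -> forall f, nr (T f) <= M * nr f.
Proof.
move=> M0 WM TE f.
have [->|T0] := eqVneq (nr (T f)) 0; first by rewrite mulr_ge0 ?nr_ge0.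
have Tp : 0 < nr (T f) by rewrite lt_neqAle eq_sym T0 nr_ge0.
rewrite -(ler_pM2l Tp) -expr2.
have -> : nr (T f) ^+ 2 = nr (ip1 (W (T f)) f : C).
  by rewrite TE (ip_nr ip2_norm) nr_real ger0_norm // sqr_ge0.
apply: le_trans (cauchy_schwarz ip1_norm _ _) _.
by rewrite mulrCA mulrA ler_wpM2r ?nr_ge0.
Qed.

(** Gliding hump: from unboundedness one builds a convergent series of
    multiples of the [u n] whose sum pairs unboundedly with them.  At each step
    the sign of the new term is chosen so that it is not cancelled by the
    previous ones. *)
Lemma uniform_boundedness (U : set V1) :
  (forall f, exists M, forall u, U u -> nr (ip1 f u : C) <= M) ->
  exists M, forall u, U u -> nr u <= M.
Proof.
move=> bU; apply: contrapT => nb.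
(* The factor [3 ^+ n] outweighs the tail of the series, of size [3 ^- n / 2]. *)
have ex (n : nat) : exists u, U u /\ 2 * n%:R * 3 ^+ n < nr u.
  apply: contrapT => h; apply: nb; exists (2 * n%:R * 3 ^+ n) => u Uu.
  by rewrite leNgt; apply/negP => hu; apply: h; exists u.
have [u hu] : {u : nat -> V1 | forall n, U (u n) /\ 2 * n%:R * 3 ^+ n < nr (u n)}.
  by exists (fun n => projT1 (cid (ex n))) => n; case: cid.
have u0 n : 0 < nr (u n).
  by case: (hu n) => _; apply: le_lt_trans; rewrite !mulr_ge0 // exprn_ge0.
pose c (n : nat) : C := (3 ^- n / nr (u n))%:C.
have cu n : nr (c n *: u n) = 3 ^- n.
  rewrite nrZ nr_real ger0_norm ?divfK ?gt_eqF //.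
  by rewrite divr_ge0 // ?nr_ge0 // invr_ge0 exprn_ge0.
pose step n f := if 3 ^- n * nr (u n) <= nr (ip1 (f + c n *: u n) (u n) : C)
  then f + c n *: u n else f - c n *: u n.
have step_near n f : nr (step n f - f) = 3 ^- n.
  by rewrite /step; case: ifP => _; rewrite addrAC subrr add0r ?nrN cu.
have step_big n f : 3 ^- n * nr (u n) <= nr (ip1 (step n f) (u n) : C).
  rewrite /step; case: ifP => // /negbT; rewrite -ltNge => h.
  have e : nr (ip1 (c n *: u n) (u n) : C) = 3 ^- n * nr (u n).
    rewrite ipZl (ip_nr ip1_norm) -rmorphM /= nr_real ger0_norm; last first.
      apply: mulr_ge0; last exact: sqr_ge0.
      by apply: divr_ge0; [rewrite invr_ge0 exprn_ge0 | exact: nr_ge0].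
    by move: (gt_eqF (u0 n)) => /negbT; move: (nr (u n)) => a a0; field; rewrite a0 expf_neq0.
  have := nrD (ip1 (f + c n *: u n) (u n)) (- ip1 (f - c n *: u n) (u n)).
  rewrite nrN -ipBl opprB addrC addrA subrK -mulr2n -scaler_nat ipZl nrM e nr_nat.
  lra.
pose f := fix f n := if n is k.+1 then step k (f k) else 0.
have far n k : nr (f (n + k)%N - f n) <= 3 / 2 * 3 ^- n * (1 - 3 ^- k).
  elim: k => [|k IH]; first by rewrite addn0 subrr nr0 expr0 invr1 subrr mulr0.
  rewrite addnS /=.
  have -> : step (n + k)%N (f (n + k)%N) - f n =
    (step (n + k)%N (f (n + k)%N) - f (n + k)%N) + (f (n + k)%N - f n).
    by rewrite addrA subrK.
  apply: le_trans (nrD _ _) _; rewrite step_near; move: IH.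
  rewrite exprD exprS !invfM; set a := 3 ^- n; set b := 3 ^- k.
  have : 0 <= a by rewrite invr_ge0 exprn_ge0.
  have : 0 <= b by rewrite invr_ge0 exprn_ge0.
  nra.
have p3 n : 0 < (3 : R) ^- n by rewrite invr_gt0 exprn_gt0.
have far' n k : (n <= k)%N -> nr (f k - f n) <= 3 / 2 * 3 ^- n.
  move=> /subnKC <-; apply: le_trans (far _ _) _.
  have := p3 n; have := p3 (k - n)%N; nra.
have n3 n : n.+1%:R <= (3 : R) ^+ n.
  elim: n => [|n IH]; first by rewrite expr0.
  have h1 : 1 <= (3 : R) ^+ n by rewrite exprn_ege1 // ler1n.
  rewrite exprS -(natr1 n.+1); lra.
have [g cg] : exists g : V1, f @ \oo --> g.
  apply: cauchy_nr => e e0; have e3 : 0 < e / 3 by lra.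
  have [N hN] := inv_succ_lt _ e3.
  have {}hN : 3 ^- N < e / 3.
    by apply: le_lt_trans (hN N (leqnn _)); rewrite lef_pV2 ?posrE ?exprn_gt0.
  exists N => i j /far' hi /far' hj.
  have := nrD (f i - f N) (- (f j - f N)).
  by rewrite nrN opprB addrA subrK; lra.
have near_g n : nr (g - f n.+1) <= 2^-1 * 3 ^- n.
  apply/ler_addgt0Pr => e e0.
  have [N hN] := (iffLR (cvg_nrP _ _ _) cg) _ e0.
  have := hN (maxn N n.+1) (leq_maxl _ _); have := far' n.+1 (maxn N n.+1) (leq_maxr _ _).
  have := nrD (g - f (maxn N n.+1)) (f (maxn N n.+1) - f n.+1).
  rewrite addrA subrK (nrB g (f (maxn N n.+1))) exprS invfM; lra.
have [M hM] := bU g.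
have [N hN] : exists N : nat, M <= N%:R.
  by exists (Num.truncn M).+1; rewrite ltW // truncnS_gt.
case: (hu N) => UN uN; have := hM _ UN; have := step_big N (f N).
have := nrD (ip1 g (u N)) (- ip1 (g - f N.+1) (u N)).
rewrite nrN ipBl opprB addrC subrK -ipBl /=.
have := cauchy_schwarz ip1_norm (g - f N.+1) (u N).
have := ler_wpM2r (nr_ge0 (u N)) (near_g N).
have : 2 * N%:R < 3 ^- N * nr (u N).
  by rewrite [ltRHS]mulrC ltr_pdivlMr // exprn_gt0.
have : 0 < N%:R + 1 :> R by rewrite ltr_wpDl.
rewrite /=; lra.
Qed.

(** The preimage of the unit ball under the adjoint is weakly bounded since [W]
    is onto, hence bounded: the adjoint is bounded below.  Projecting [h] on its
    range leaves a residue killed by [W], that is zero. *)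
Lemma adjoint_bijective (W : {linear V2 -> V1}) (T : {linear V1 -> V2}) (M : R) :
  (forall g, nr (W g) <= M * nr g) -> bijective W ->
  (forall g f, ip1 (W g) f = ip2 g (T f)) -> bijective T.
Proof.
move=> WM [W' WK W'K] TE.
have M0 : exists2 M', 0 <= M' & forall g, nr (W g) <= M' * nr g.
  exists `|M| => // g; apply: le_trans (WM g) _.
  by rewrite ler_wpM2r ?nr_ge0 // ler_norm.
case: M0 => {WM}{}M M0 WM.
have [B hB] : exists B, forall u, nr (T u) <= 1 -> nr u <= B.
  apply: (@uniform_boundedness [set u | nr (T u) <= 1]) => f.
  exists (nr (W' f)) => u /= Tu; rewrite -(W'K f) TE WK.
  apply: le_trans (cauchy_schwarz ip2_norm _ _) _.
  by rewrite -[leRHS]mulr1 ler_wpM2l ?nr_ge0.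
have Tinj u : T u = 0 -> u = 0.
  move=> Tu; apply: (ip_ext ip1_norm) => g.
  by rewrite ip0r -(W'K g) TE Tu ip0r.
have B0 : 0 < `|B| + 1 by rewrite ltr_wpDl.
have below u : (`|B| + 1)^-1 * nr u <= nr (T u).
  have [/nr_eq0/Tinj ->|T0] := eqVneq (nr (T u)) 0.
    by rewrite linear0 !nr0 mulr0.
  have Tp : 0 < nr (T u) by rewrite lt_neqAle eq_sym T0 nr_ge0.
  have := hB ((nr (T u))^-1%:C *: u).
  rewrite linearZ !nrZ nr_real ger0_norm ?invr_ge0 ?nr_ge0 // mulVf // => /(_ (lexx _)).
  rewrite mulrC ler_pdivrMr // => h.
  rewrite mulrC ler_pdivrMr // mulrC; apply: le_trans h _.
  rewrite ler_wpM2r ?nr_ge0 //; have := ler_norm B; lra.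
have above := adjoint_bounded W T M M0 WM TE.
have surj h : exists u, T u = h.
  pose l v := ip2 (T v) h.
  have ls : scalar l by move=> a v w; rewrite /l linearP ipDl ipZl.
  pose l' : {scalar V1} := HB.pack l (GRing.isLinear.Build _ _ _ _ _ ls).
  have [||||u hu] := @lax_milgram _ V1 V2 ip2 ip2_norm T l' (`|B| + 1)^-1 M (M * nr h).
  - by rewrite invr_gt0.
  - exact: below.
  - exact: above.
  - move=> u; apply: le_trans (cauchy_schwarz ip2_norm _ _) _.
    by rewrite mulrAC ler_wpM2r ?nr_ge0.
  exists u; apply/eqP; rewrite -subr_eq0; apply/eqP.
  have W0 : W (T u - h) = 0.
    apply: (ip_ext ip1_norm) => v; rewrite ip0r.
    by rewrite (ipC v) TE -ipC ipBr hu subrr.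
  by rewrite -(WK (T u - h)) W0 -[0](linear0 W) WK.
have inj : injective T.
  move=> u v uv; apply/eqP; rewrite -subr_eq0; apply/eqP; apply: Tinj.
  by rewrite linearB uv subrr.
exists (fun h => projT1 (cid (surj h))) => [u|h]; last by case: cid.
by apply: inj; case: cid.
Qed.
End Adjoint.

(** * The multinomial theorem *)

Section Multinomial.

Definition multi_indices (d n : nat) : seq {ffun 'I_d -> nat} :=
  [seq al <- [seq [ffun i => (b i : nat)] | b : {ffun 'I_d -> 'I_n.+1}] |
     multi_abs al == n].

Lemma multi_indices_uniq d n : uniq (multi_indices d n).
Proof.
apply: filter_uniq; rewrite map_inj_uniq ?enum_uniq // => b c /ffunP bc.
by apply/ffunP => i; have := bc i; rewrite !ffunE => /val_inj.
Qed.

Lemma mem_multi_indices d n al : (al \in multi_indices d n) = (multi_abs al == n).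
Proof.
rewrite mem_filter; case: eqP => //= aln; apply/mapP.
have le i : (al i < n.+1)%N by rewrite ltnS -aln /multi_abs (bigD1 i) //= leq_addr.
exists [ffun i => Ordinal (le i)]; first by rewrite mem_enum.
by apply/ffunP => i; rewrite !ffunE.
Qed.

Variable K : numFieldType.

(** Below the truncation degree the product of the exponential polynomials of
    the [z i] is the exponential polynomial of their sum. *)
Lemma exp_poly_prod (n : nat) (I : Type) (s : seq I) (z : I -> K) k : (k <= n)%N ->
  (\prod_(i <- s) \poly_(j < n.+1) (z i ^+ j / j`!%:R))`_k
  = (\sum_(i <- s) z i) ^+ k / k`!%:R.
Proof.
elim: s k => [|x s IH] k kn.
  rewrite !big_nil coef1; case: k kn => [|k] _; first by rewrite expr0 divr1.
  by rewrite expr0n mul0r.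
have f0 j : (j`!%:R : K) != 0 by rewrite pnatr_eq0 -lt0n fact_gt0.
rewrite !big_cons coefM addrC exprDn mulr_suml; apply: eq_bigr => -[j jk] _ /=.
have {}jk : (j <= k)%N by [].
rewrite coef_poly ltnS (leq_trans jk kn) IH; last by apply: leq_trans kn; apply: leq_subr.
rewrite -[_ *+ 'C(_, _)]mulr_natr.
have := bin_fact jk => /(congr1 (fun m => m%:R : K)); rewrite !natrM => <-.
by field; rewrite !f0 pnatr_eq0 -lt0n bin_gt0.
Qed.

(** The multinomial theorem, divided by [n`!], read off as the coefficient of
    degree [n] in a product of truncated exponential series. *)
Lemma multinomial_sum d n (z : 'I_d -> K) :
  \sum_(al <- multi_indices d n) \prod_i (z i ^+ al i / (al i)`!%:R)
  = (\sum_i z i) ^+ n / n`!%:R.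
Proof.
rewrite -(exp_poly_prod n) // big_filter big_map big_enum_cond /=.
under [in RHS]eq_bigr do rewrite poly_def.
rewrite bigA_distr_bigA coef_sum big_mkcond /=; apply: eq_bigr => b _.
have -> : \prod_(i < d) ((z i ^+ b i / (b i)`!%:R) *: 'X^(b i))
    = (\prod_(i < d) (z i ^+ b i / (b i)`!%:R)) *: 'X^(\sum_i (b i : nat)) :> {poly K}.
  by rewrite scaler_prod expr_sum.
rewrite coefZ.
have -> : \sum_i (b i : nat) = multi_abs [ffun i => (b i : nat)].
  by apply: eq_bigr => i _; rewrite ffunE.
rewrite coefXn eq_sym; case: eqP => _; last by rewrite mulr0.
by rewrite mulr1; apply: eq_bigr => i _; rewrite ffunE.
Qed.

End Multinomial.

(** * Balls and the maximal domain *)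

Section Domain.
Context {R : realType} (d : nat) (a : nat -> R) (r : \bar R).
Local Notation C := R[i].
Implicit Types w : 'rV[C]_d.

Definition sqn {d} (w : 'rV[C]_d) : R := \sum_i nr (w 0 i : C) ^+ 2.

Lemma sqn_ge0 w : 0 <= sqn w.
Proof. by apply: sumr_ge0 => i _; exact: sqr_ge0. Qed.

Lemma cdotE w : cdot w w = (sqn w)%:C.
Proof. by rewrite /cdot /sqn rmorph_sum; apply: eq_bigr => i _; rewrite -nr_sqr. Qed.

Lemma euclidE w : euclidean_norm w = Num.sqrt (sqn w).
Proof. by rewrite /euclidean_norm cdotE. Qed.

Lemma sqnZ (z : C) w : sqn (z *: w) = nr z ^+ 2 * sqn w.
Proof. by rewrite /sqn mulr_sumr; apply: eq_bigr => i _; rewrite mxE nrM exprMn. Qed.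

Lemma euclid_ge0 w : 0 <= euclidean_norm w.
Proof. by rewrite euclidE sqrtr_ge0. Qed.

Lemma euclid_sqr w : euclidean_norm w ^+ 2 = sqn w.
Proof. by rewrite euclidE sqr_sqrtr // sqn_ge0. Qed.

Lemma euclidZ (z : C) w : euclidean_norm (z *: w) = nr z * euclidean_norm w.
Proof.
by rewrite !euclidE sqnZ sqrtrM ?sqr_ge0 // sqrtr_sqr ger0_norm // nr_ge0.
Qed.

Lemma sqn_eq0 w : sqn w = 0 -> w = 0.
Proof.
move=> /eqP; rewrite psumr_eq0; last by move=> i _; exact: sqr_ge0.
move=> /allP h; apply/rowP => i; rewrite mxE; apply: nr_eq0.
by have := h i (mem_index_enum i); rewrite /= sqrf_eq0 => /eqP.
Qed.

Lemma nr_coord_le w i : nr (w 0 i : C) <= euclidean_norm w.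
Proof.
rewrite -(ger0_norm (nr_ge0 (w 0 i))) -sqrtr_sqr euclidE ler_sqrt ?sqn_ge0 //.
by rewrite /sqn (bigD1 i) //= lerDl sumr_ge0 // => j _; exact: sqr_ge0.
Qed.

Lemma vector_of_norm (t : R) : (0 < d)%N -> 0 <= t ->
  exists w : 'rV[C]_d, euclidean_norm w = t.
Proof.
move=> d0 t0; exists (\row_i ((i == Ordinal d0)%:R * t%:C)).
rewrite euclidE /sqn (bigD1 (Ordinal d0)) //= big1 ?addr0 => [|i i0].
  by rewrite mxE eqxx mul1r nr_real sqrtr_sqr normr_id ger0_norm.
by rewrite mxE (negbTE i0) mul0r nr0 expr0n.
Qed.

Let X := maximal_domain d a r.

Lemma domain_open_ball w : ((euclidean_norm w)%:E < r)%E -> X w.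
Proof.
rewrite /X /maximal_domain => h; case: ifP => // _.
by case: ifP => // _; exact: ltW.
Qed.

Lemma domain_closed_ball w : X w -> ((euclidean_norm w)%:E <= r)%E.
Proof.
rewrite /X /maximal_domain; case: ifP => [/eqP -> _|_]; first exact: leey.
by case: ifP => // _ h; exact: ltW.
Qed.

Lemma domain_scale w (z : C) : nr z <= 1 -> X w -> X (z *: w).
Proof.
move=> z1; have le : ((euclidean_norm (z *: w))%:E <= (euclidean_norm w)%:E)%E.
  by rewrite lee_fin euclidZ ler_piMl // euclid_ge0.
rewrite /X /maximal_domain; case: ifP => // _.
case: ifP => _ h; [exact: le_lt_trans le h | exact: le_trans le h].
Qed.

(** The room beyond an interior point is what makes its homogeneous expansion
    decay geometrically. *)
Lemma open_ball_scale w : ((euclidean_norm w)%:E < r)%E ->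
  exists2 rho : R, 1 < rho & ((euclidean_norm (rho%:C *: w))%:E < r)%E.
Proof.
have E (rho : R) : 1 < rho -> euclidean_norm (rho%:C *: w) = rho * euclidean_norm w.
  by move=> h; rewrite euclidZ nr_real ger0_norm // ltW // (lt_trans ltr01).
case: r => [s||//]; last first.
  by move=> _; exists 2; [rewrite ltr1n | rewrite ltry].
rewrite lte_fin; set e := euclidean_norm w => es.
have e0 : 0 <= e by exact: euclid_ge0.
have [e00|en0] := eqVneq e 0.
  exists 2; first by rewrite ltr1n.
  by rewrite E ?ltr1n // -/e lte_fin e00 mulr0 -e00.
have ep : 0 < e by rewrite lt_neqAle eq_sym en0.
have h : 1 < (s + e) / (2 * e) by rewrite ltr_pdivlMr ?mulr_gt0 //; lra.
exists ((s + e) / (2 * e)) => //; rewrite E // lte_fin -/e.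
have -> : (s + e) / (2 * e) * e = (s + e) / 2 by field.
lra.
Qed.

Hypothesis a_gt0 : forall n, 0 < a n.
Hypothesis ra : convergence_radius a = (r ^+ 2)%E.
Hypothesis r_gt0 : (0 < r)%E.

(** This is where the maximality of the domain enters: bounded partial sums put
    [w] in the closed ball, and on the sphere they are compatible only with a
    finite value of the generating function there. *)
Lemma domain_bounded w (B : R) :
  (forall N, \sum_(n < N) a n * sqn w ^+ n <= B) -> X w.
Proof.
move=> hB; set t := sqn w in hB.
have t0 : 0 <= t by exact: sqn_ge0.
have pos n : 0 <= a n * t ^+ n by rewrite mulr_ge0 ?exprn_ge0 // ltW.
have cv : cvgn (pseries a t).
  apply: nondecreasing_is_cvgn.
    apply/nondecreasing_seqP => n. rewrite /pseries /series /= big_nat_recr //= lerDl; exact: pos.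
  exists B => _ [n _ <-]; rewrite /pseries /series /= big_mkord; exact: hB.
have le : (t%:E <= convergence_radius a)%E.
  by apply: ereal_sup_ubound; exists t.
rewrite ra in le; rewrite /X /maximal_domain.
case: ifP => // rf.
case: r r_gt0 rf le => [s|//|//]; rewrite lte_fin => s0 _.
rewrite -EFin_expe lee_fin => ts.
have es : euclidean_norm w <= s.
  by rewrite -(ler_pXn2r (ltn0Sn 1)) ?nnegrE ?euclid_ge0 ?(ltW s0) // euclid_sqr.
case: ifP => [/eqP gi|_]; last by rewrite /centered_closed_ball /= lee_fin.
rewrite /centered_open_ball /= lte_fin lt_neqAle es andbT.
apply/negP => /eqP ews.
have : (gf_value a (fine s%:E ^+ 2) <= B%:E)%E.
  rewrite /gf_value /= -ews euclid_sqr -/t; apply: lime_le.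
    by apply: is_cvg_nneseries => n _ _; rewrite lee_fin.
  by apply: nearW => n; rewrite sumEFin lee_fin big_mkord.
by rewrite gi.
Qed.

End Domain.
Arguments sqn {R d} w.

(** * Homogeneous expansions in a weighted Hardy space *)

Section FunctionSpace.
Context {R : realType} {X : Type} (H : hilbert_function_space R X).
Local Notation C := R[i].

Lemma ev_scalar x : scalar (fun f : H => ev f x).
Proof. by move=> c f g; rewrite ev_linear. Qed.

Lemma kernelE (x : X) (f : H) : ev f x = hfs_ip H f (rkhs_kernel H x).
Proof.
have [M hM] := ev_bounded H x.
have [|k hk] := riesz (@hfs_ip_norm _ _ H) (fun f : H => ev f x) M (ev_scalar x).
  by move=> u; rewrite -lecR rmorphM /= -!nrE; exact: hM.
suff h : [set k : H | forall f : H, ev f x = hfs_ip H f k] (rkhs_kernel H x) by exact: h.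
by apply: xgetPex; exists k.
Qed.
End FunctionSpace.

Section Hardy.
Context {R : realType} {d : nat} {a : nat -> R} {r : \bar R}.
Context (H : hilbert_function_space R (maximal_domain d a r)).
Local Notation C := R[i].
Local Notation X := (maximal_domain d a r).
Local Notation ip := (hfs_ip H).
Local Notation ip_norm := (@hfs_ip_norm _ _ H).
Implicit Types (w z : 'rV[C]_d) (al be : {ffun 'I_d -> nat}).

Definition pt w (h : X w) : X := SigSub (mem_set h).

(** Extending the kernel by zero outside the domain makes point values total
    functions on coordinate space, free of the subtype. *)
Definition kern w : H :=
  if pselect (X w) is left h then rkhs_kernel H (pt w h) else 0.

Definition value (f : H) w : C := ip f (kern w).

(** [ev] is injective, so the choice is unique whenever it exists. *)
Definition mono al : H :=
  xget 0 [set f : H | forall x : X, ev f x = monomial al (val x)].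

Lemma valueE (f : H) (x : X) : ev f x = value f (val x).
Proof.
rewrite kernelE /value /kern; case: pselect => [h|]; last by case; exact: set_valP.
by congr (ip _ (rkhs_kernel H _)); apply: val_inj.
Qed.

Lemma kern_val (x : X) : kern (val x) = rkhs_kernel H x.
Proof.
rewrite /kern; case: pselect => [h|]; last by case; exact: set_valP.
by congr (rkhs_kernel H _); apply: val_inj.
Qed.


(** The degree [n] part of the kernel vector at [w]; the formula makes sense for
    every [w], inside the domain or not. *)
Definition hom_kern n w : H := \sum_(al <- multi_indices d n)
  (Num.conj (monomial al w) / (nr (mono al) ^+ 2)%:C) *: mono al.

(** The degree [n] part of the monomial expansion of [f], a homogeneous
    polynomial in [w]. *)
Definition hom_part (f : H) n w : C := ip f (hom_kern n w).

Lemma monomialZ al (c : C) w : monomial al (c *: w) = c ^+ multi_abs al * monomial al w.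
Proof.
rewrite /monomial /multi_abs -prodrXr -big_split /=.
by apply: eq_bigr => i _; rewrite mxE exprMn.
Qed.

Lemma conj_real (t : R) : Num.conj (t%:C : C) = t%:C.
Proof. exact: conjc_real. Qed.

Lemma conj_coef (m : C) (t : R) : Num.conj (Num.conj m / t%:C) = m / t%:C.
Proof. by rewrite rmorphM /= conjCK fmorphV /= conj_real. Qed.

Lemma hom_partZ f n (c : C) w : hom_part f n (c *: w) = c ^+ n * hom_part f n w.
Proof.
rewrite /hom_part /hom_kern !ip_sumr mulr_sumr; apply: eq_big_seq => al.
rewrite mem_multi_indices => /eqP aln.
by rewrite monomialZ aln !ipZr !conj_coef -!mulrA.
Qed.

Hypothesis Hw : weighted_hardy_space H.

Lemma coef_gt0 n : 0 < a n. Proof. by case: Hw => -[_ h _] _ _ _; exact: h. Qed.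

Lemma mono_spec : [/\ forall al (x : X), ev (mono al) x = monomial al (val x),
   forall al, mono al != 0,
   forall al be, al != be -> ip (mono al) (mono be) = 0,
   forall f, (forall al, ip f (mono al) = 0) -> f = 0 &
   forall al, nr (mono al) ^- 2 =
     a (multi_abs al) * ((multi_abs al)`!%:R / (multi_fact al)%:R)].
Proof.
case: Hw => _ _ [mon [h1 h2 h3 h4 [_ _ h5]]] _.
have E al : mono al = mon al.
  apply: (@ev_inj _ _ H); apply/funext => x; rewrite h1.
  suff h : [set f : H | forall x : X, ev f x = monomial al (val x)] (mono al) by exact: h.
  by apply: xgetPex; exists (mon al) => ?; exact: h1.
split.
- by move=> al x; rewrite E h1.
- by move=> al; rewrite E.
- by move=> al be ab; rewrite !E h3.
- by move=> f hf; apply: h4 => al; rewrite -E.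
move=> al; apply: complexI; rewrite E fmorphV rmorphXn /= -nrE h5.
by rewrite !rmorphM fmorphV /= !rmorph_nat.
Qed.

Lemma mono_nr_gt0 al : 0 < nr (mono al).
Proof.
case: mono_spec => _ h _ _ _; rewrite lt_neqAle nr_ge0 andbT eq_sym.
by apply/negP => /eqP/nr_eq0/eqP; apply/negP.
Qed.

Lemma value_mono al w : X w -> value (mono al) w = monomial al w.
Proof. by case: mono_spec => h _ _ _ _ Xw; rewrite -[w]/(val (pt w Xw)) -valueE h. Qed.

Lemma ip_hom_kern al n w :
  ip (mono al) (hom_kern n w) = if multi_abs al == n then monomial al w else 0.
Proof.
case: mono_spec => _ _ orth _ _; rewrite /hom_kern ip_sumr.
case: ifP => [/eqP aln|/eqP aln].
  rewrite (big_rem al) ?mem_multi_indices ?aln //= big_seq big1 => [|be].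
    rewrite addr0 ipZr (ip_nr ip_norm) conj_coef divfK //.
    by rewrite eq_complex /= eqxx andbT expf_neq0 // gt_eqF // mono_nr_gt0.
  rewrite (mem_rem_uniq _ (multi_indices_uniq _ _)) inE => /andP[ab _].
  by rewrite ipZr orth ?mulr0 // eq_sym.
rewrite big_seq big1 // => be; rewrite mem_multi_indices => /eqP ben.
by rewrite ipZr orth ?mulr0 //; apply/eqP => ab; apply: aln; rewrite ab.
Qed.

Lemma nr_prod (I : Type) (s : seq I) (F : I -> C) :
  nr (\prod_(i <- s) F i : C) = \prod_(i <- s) nr (F i : C).
Proof.
elim: s => [|x s IH]; last by rewrite !big_cons nrM IH.
by rewrite !big_nil -[1]/(1%:R) nr_nat.
Qed.

(** On the diagonal this is the multinomial theorem. *)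
Lemma ip_hom_kern2 m n w :
  ip (hom_kern m w) (hom_kern n w) = if m == n then (a n * sqn w ^+ n)%:C else 0.
Proof.
rewrite {1}/hom_kern ip_suml.
under eq_big_seq => al.
  rewrite mem_multi_indices => /eqP aln; rewrite ipZl ip_hom_kern aln; over.
case: eqP => [->|_]; last by rewrite big1 // => al _; rewrite mulr0.
have nf : n`!%:R != 0 :> R by rewrite pnatr_eq0 -lt0n fact_gt0.
have -> : a n * sqn w ^+ n = a n * n`!%:R * ((\sum_i nr (w 0 i : C) ^+ 2) ^+ n / n`!%:R).
  by rewrite /sqn; field.
rewrite -multinomial_sum mulr_sumr rmorph_sum /=; apply: eq_big_seq => al.
rewrite mem_multi_indices => /eqP aln.
rewrite mulrAC mulrC [_ * monomial _ _]mulrC -nr_sqr -fmorphV -rmorphM /=; congr (_ %:C).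
case: mono_spec => _ _ _ _ ->; rewrite aln /monomial nr_prod -prodrXl.
under eq_bigr do rewrite nrX -exprM mulnC exprM.
rewrite [in RHS]big_split /= prodfV -natr_prod /multi_fact.
by field; rewrite pnatr_eq0 -lt0n prodn_gt0 // => i; exact: fact_gt0.
Qed.

Lemma ip_sum_hom_kern f N w :
  ip f (\sum_(n < N) hom_kern n w) = \sum_(n < N) hom_part f n w.
Proof. by rewrite ip_sumr. Qed.

Lemma nr_hom_kern n w : nr (hom_kern n w) ^+ 2 = a n * sqn w ^+ n.
Proof. by apply: complexI; rewrite -(ip_nr ip_norm) ip_hom_kern2 eqxx. Qed.

Lemma nr_sum_hom_kern N w :
  nr (\sum_(n < N) hom_kern n w) ^+ 2 = \sum_(n < N) a n * sqn w ^+ n.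
Proof.
apply: complexI; rewrite -(ip_nr ip_norm) ip_suml rmorph_sum /=; apply: eq_bigr => n _.
rewrite ip_sumr (bigD1 n) //= ip_hom_kern2 eqxx big1 ?addr0 // => m mn.
by rewrite ip_hom_kern2 -(inj_eq val_inj) eq_sym /= in mn *; rewrite (negbTE mn).
Qed.


Lemma value_hom_kern n w : X w -> value (hom_kern n w) w = (a n * sqn w ^+ n)%:C.
Proof.
move=> Xw; have <- : ip (hom_kern n w) (hom_kern n w) = (a n * sqn w ^+ n)%:C.
  by rewrite ip_hom_kern2 eqxx.
rewrite /value [in LHS]/hom_kern [X in _ = ip X _]/hom_kern !ip_suml.
apply: eq_big_seq => al; rewrite mem_multi_indices !ipZl => /eqP aln.
by rewrite ip_hom_kern aln eqxx -/(value _ _) value_mono.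
Qed.

Lemma kern_sqr_cvg w : X w ->
  (fun N => (\sum_(n < N) a n * sqn w ^+ n)%:C) @ \oo --> ((nr (kern w) ^+ 2)%:C : C).
Proof.
move=> Xw; case: Hw => _ _ _ /(_ (pt w Xw) (pt w Xw)).
have kE : kern w = rkhs_kernel H (pt w Xw) by rewrite -kern_val.
rewrite kernelE -kE.
rewrite (ip_nr ip_norm) => h; apply: cvg_trans h.
apply: near_eq_cvg; apply: nearW => N.
rewrite /series /= big_mkord rmorph_sum; apply: eq_bigr => n _.
by rewrite cdotE rmorphM rmorphXn.
Qed.

(** [kern w] is the sum of its homogeneous components: the squared distance to
    the partial sums is [nr (kern w) ^+ 2] minus the partial sums of the kernel
    series on the diagonal. *)
Lemma hom_kern_cvg w : X w ->
  forall e : R, 0 < e -> exists N, forall n, (N <= n)%N ->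
    nr (kern w - \sum_(k < n) hom_kern k w) < e.
Proof.
move=> Xw e e0; have e2 : 0 < e ^+ 2 by rewrite exprn_gt0.
have [N hN] := (iffLR (cvg_nrP _ _ _) (kern_sqr_cvg w Xw)) _ e2.
exists N => n /hN h; rewrite -(@ltr_pXn2r _ 2) ?nnegrE ?nr_ge0 ?(ltW e0) //.
apply: le_lt_trans h; rewrite -rmorphB nr_real distrC; apply: le_trans (ler_norm _).
rewrite (nrD_sqr ip_norm) nrN nr_sum_hom_kern.
have -> : ip (kern w) (- \sum_(k < n) hom_kern k w)
    = - (\sum_(k < n) a k * sqn w ^+ k)%:C.
  rewrite -scaleN1r ipZr rmorphN rmorph1 mulN1r; congr (- _).
  rewrite ip_sumr rmorph_sum; apply: eq_bigr => k _.
  by rewrite ipC -/(value _ _) value_hom_kern //; exact: conjc_real.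
rewrite ReN /=; lra.
Qed.

Lemma value_expansion f w : X w ->
  (fun N => \sum_(n < N) hom_part f n w) @ \oo --> (value f w : C).
Proof.
move=> Xw; apply/cvg_nrP => e e0.
have K0 : 0 < nr f + 1 by rewrite ltr_wpDl // nr_ge0.
have [|N hN] := hom_kern_cvg w Xw (e / (nr f + 1)); first by rewrite divr_gt0.
exists N => n /hN; rewrite ltr_pdivlMr // => h; apply: le_lt_trans h.
rewrite -ip_sum_hom_kern /value -ipBr; apply: le_trans (cauchy_schwarz ip_norm _ _) _.
by rewrite nrB mulrC ler_wpM2l ?nr_ge0 // lerDl.
Qed.

Lemma kern_partial_le w N : X w -> \sum_(n < N) a n * sqn w ^+ n <= nr (kern w) ^+ 2.
Proof.
move=> Xw; apply/ler_addgt0Pr => e e0.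
have [N1 hN] := (iffLR (cvg_nrP _ _ _) (kern_sqr_cvg w Xw)) _ e0.
have := hN _ (leq_maxl N1 N); rewrite -rmorphB nr_real => /ltr_distlDr h.
apply: le_trans (ltW h); rewrite -(subnKC (leq_maxr N1 N)) big_split_ord /= lerDl.
by apply: sumr_ge0 => i _; rewrite mulr_ge0 ?exprn_ge0 ?sqn_ge0 // ltW // coef_gt0.
Qed.

Lemma kern_le w B : X w -> 0 <= B ->
  (forall N, \sum_(n < N) a n * sqn w ^+ n <= B ^+ 2) -> nr (kern w) <= B.
Proof.
move=> Xw B0 hB; rewrite -(@ler_pXn2r _ 2) ?nnegrE ?nr_ge0 //.
apply/ler_addgt0Pr => e e0.
have [N1 hN] := (iffLR (cvg_nrP _ _ _) (kern_sqr_cvg w Xw)) _ e0.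
have := hN _ (leqnn N1); rewrite -rmorphB nr_real => /ltr_distlCDr h.
by apply: le_trans (ltW h) _; rewrite lerD2r.
Qed.

Lemma kern_scale_le w (z : C) : X w -> nr z <= 1 -> nr (kern (z *: w)) <= nr (kern w).
Proof.
move=> Xw z1; apply: kern_le; [exact: domain_scale | exact: nr_ge0|].
move=> N; apply: le_trans (kern_partial_le w N Xw); apply: ler_sum => n _.
rewrite ler_wpM2l ?(ltW (coef_gt0 n)) // sqnZ exprMn ler_piMl ?exprn_ge0 ?sqn_ge0 //.
by rewrite -exprM exprn_ile1 // nr_ge0.
Qed.

Lemma value_le f w : nr (value f w : C) <= nr f * nr (kern w).
Proof. exact: (cauchy_schwarz ip_norm). Qed.

End Hardy.

(** * Power series in one complex variable *)

Section PowerSeries.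
Context {R : realType}.
Local Notation C := R[i].
Implicit Types (c e : nat -> C) (z v : C).

Definition psum c z N : C := \sum_(n < N) c n * z ^+ n.
Definition sums c z v : Prop := psum c z @ \oo --> v.
Definition geometric_decay c : Prop := exists K th : R,
  [/\ 0 <= K, 0 < th, th < 1 & forall n, nr (c n) <= K * th ^+ n].

Lemma psumS c z N : psum c z N.+1 = psum c z N + c N * z ^+ N.
Proof. by rewrite /psum big_ord_recr. Qed.

Lemma psum_shift c z N : psum c z N.+1 = c 0 + z * psum (c \o S) z N.
Proof.
rewrite /psum big_ord_recl expr0 mulr1 mulr_sumr; congr (_ + _).
by apply: eq_bigr => i _; rewrite /= exprS mulrCA.
Qed.

Lemma nr_sum (I : Type) (s : seq I) (P : pred I) (F : I -> C) :
  nr (\sum_(i <- s | P i) F i : C) <= \sum_(i <- s | P i) nr (F i : C).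
Proof.
elim/big_rec2 : _ => [|i x y _ h]; first by rewrite nr0.
by apply: le_trans (nrD _ _) _; rewrite lerD2l.
Qed.

Lemma cvg_subseq (s : nat -> nat) (u : nat -> C) (l : C) :
  (forall n, (n <= s n)%N) -> u @ \oo --> l -> (fun n => u (s n)) @ \oo --> l.
Proof.
move=> ns /cvg_nrP h; apply/cvg_nrP => e /h [N hN]; exists N => n Nn.
by apply: hN; apply: leq_trans Nn (ns n).
Qed.

Lemma cvg_uniqueC (u : nat -> C) (l m : C) : u @ \oo --> l -> u @ \oo --> m -> l = m.
Proof. by move=> h h'; apply: cvg_unique_nr h h'. Qed.

Lemma cvg_addC (u v : nat -> C) (l m : C) : u @ \oo --> l -> v @ \oo --> m ->
  (fun n => u n + v n) @ \oo --> l + m.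
Proof. exact: cvgD. Qed.

Lemma cvg_mulC (u v : nat -> C) (l m : C) : u @ \oo --> l -> v @ \oo --> m ->
  (fun n => u n * v n) @ \oo --> l * m.
Proof. exact: cvgM. Qed.

Lemma cvg_invC (u : nat -> C) (l : C) : l != 0 -> u @ \oo --> l ->
  (fun n => (u n)^-1) @ \oo --> l^-1.
Proof. by move=> l0 h; apply: cvgV. Qed.

Lemma cvg_power (u : nat -> C) (l : C) k :
  u @ \oo --> l -> (fun n => u n ^+ k) @ \oo --> l ^+ k.
Proof.
move=> ul; elim: k => [|k IH].
  by under eq_fun do rewrite expr0; rewrite expr0; exact: cvg_cst.
have h : (u \* (fun n => u n ^+ k)) @ \oo --> l * l ^+ k by exact: cvgM ul IH.
by rewrite exprS; under eq_fun do rewrite exprS.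
Qed.

Lemma cvg_squeeze0 (u : nat -> C) (l : C) (b : nat -> R) :
  (forall n, nr (u n - l) <= b n) -> b @ \oo --> (0 : R) -> u @ \oo --> l.
Proof.
move=> h /cvgrPdist_lt hb; apply/cvg_nrP => e e0; have [N _ hN] := hb _ e0.
exists N => n Nn; apply: le_lt_trans (h n) _.
by have := hN n Nn; rewrite /= sub0r normrN; apply: le_lt_trans; exact: ler_norm.
Qed.

Lemma cvg_nr_le (u : nat -> C) (l : C) (B : R) :
  u @ \oo --> l -> (forall n, nr (u n) <= B) -> nr l <= B.
Proof.
move=> /cvg_nrP h hB; apply/ler_addgt0Pr => e /h [N hN].
have := nrD (u N) (- (u N - l)); rewrite nrN opprB addrC subrK.
have := hN N (leqnn N); have := hB N; lra.
Qed.

Lemma cvg_geometric0 (K t : R) : 0 <= t -> t < 1 ->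
  (fun n => K * t ^+ n) @ \oo --> (0 : R).
Proof.
move=> t0 t1; rewrite -[0](mulr0 K); apply: cvgM; first exact: cvg_cst.
by apply: cvg_expr; rewrite ger0_norm.
Qed.

(** Compare with the geometric series and let the upper end of the tail go to
    infinity. *)
Lemma geometric_tail c z v (K t : R) : sums c z v -> 0 <= t -> t < 1 ->
  (forall n, nr (c n * z ^+ n) <= K * t ^+ n) ->
  forall N, nr (v - psum c z N) <= K * t ^+ N / (1 - t).
Proof.
move=> cv t0 t1 h N; have t1' : 0 < 1 - t by rewrite subr_gt0.
have part k : nr (psum c z (N + k) - psum c z N) <= K * t ^+ N * (1 - t ^+ k) / (1 - t).
  elim: k => [|k IH]; first by rewrite addn0 subrr nr0 expr0 subrr mulr0 mul0r.
  rewrite addnS psumS addrAC; apply: le_trans (nrD _ _) _.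
  apply: le_trans (lerD IH (h _)) _; rewrite le_eqVlt; apply/orP; left; apply/eqP.
  by rewrite exprD exprS; field; rewrite gt_eqF.
apply: (@cvg_nr_le (fun k => psum c z (N + k) - psum c z N)).
  apply: cvgB; last exact: cvg_cst.
  exact: (cvg_subseq (addn N) (psum c z) v (leq_addl N) cv).
move=> k; apply: le_trans (part k) _; rewrite ler_pM2r ?invr_gt0 // ler_piMr //.
  by rewrite mulr_ge0 ?exprn_ge0 //; apply: le_trans (nr_ge0 _) (_ : nr (c 0 * z ^+ 0) <= _); rewrite -[K]mulr1 -(expr0 t) h.
by rewrite gerBl exprn_ge0.
Qed.

Lemma sums_shift c z v : z != 0 -> sums c z v -> sums (c \o S) z ((v - c 0) / z).
Proof.
move=> z0 cv; rewrite /sums.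
have -> : psum (c \o S) z = (fun N => (psum c z N.+1 - c 0) / z).
  by apply/funext => N; rewrite psum_shift addrC addKr mulrC mulKf.
apply: cvgM; last exact: cvg_cst.
apply: cvgB; last exact: cvg_cst.
exact: (cvg_subseq S (psum c z) v leqnSn cv).
Qed.

Lemma geometric_decay_shift c : geometric_decay c -> geometric_decay (c \o S).
Proof.
move=> [K [th [K0 t0 t1 h]]]; exists K, th; split=> // n /=.
apply: le_trans (h _) _; rewrite exprS ler_wpM2l // ler_piMl ?exprn_ge0 ?ltW //.
Qed.

Lemma near0_bound c z v (K : R) : (forall n, nr (c n) <= K) -> nr z <= 2^-1 ->
  sums c z v -> nr (v - c 0) <= 2 * K * nr z.
Proof.
move=> h z2 cv; have K0 : 0 <= K by apply: le_trans (nr_ge0 _) (h 0).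
have z1 : nr z < 1 by lra.
have := @geometric_tail _ _ _ K (nr z) cv (nr_ge0 _) z1 _ 1.
rewrite /psum big_ord1 expr0 mulr1 expr1 => /(_ _)/le_trans; apply.
  by move=> n; rewrite nrM nrX ler_wpM2r ?exprn_ge0 ?nr_ge0.
rewrite ler_pdivrMr ?subr_gt0 //; have := nr_ge0 z.
have : 0 <= K * nr z by rewrite mulr_ge0 ?nr_ge0.
nra.
Qed.

Definition small n : C := (n.+2%:R^-1)%:C.

Lemma small_neq0 n : small n != 0.
Proof. by rewrite eq_complex /= eqxx andbT invr_eq0 pnatr_eq0. Qed.

Lemma nr_small n : nr (small n) = n.+2%:R^-1.
Proof. by rewrite nr_real ger0_norm // invr_ge0. Qed.

Lemma nr_small_le n : nr (small n) <= 2^-1.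
Proof. by rewrite nr_small lef_pV2 ?posrE ?ltr0n // ler_nat. Qed.

Lemma cvg_small : small @ \oo --> (0 : C).
Proof.
apply/cvg_nrP => e /inv_succ_lt [N hN]; exists N => n Nn.
rewrite subr0 nr_small; apply: le_lt_trans (hN n Nn).
by rewrite lef_pV2 ?posrE ?ltr0n // ler_nat.
Qed.

Lemma sums_small0 c (v : nat -> C) (K : R) : (forall n, nr (c n) <= K) ->
  (forall m, sums c (small m) (v m)) -> v @ \oo --> c 0.
Proof.
move=> h cv; apply: (@cvg_squeeze0 _ _ (fun m => 2 * K * nr (small m))).
  by move=> m; apply: near0_bound (cv m) => //; exact: nr_small_le.
rewrite -[0](mulr0 (2 * K)); apply: cvgM; first exact: cvg_cst.
apply/cvgrPdist_lt => e e0; have [N hN] := (iffLR (cvg_nrP _ _ _) cvg_small) _ e0.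
exists N => // n /hN; rewrite subr0 sub0r normrN /= ger0_norm //; exact: nr_ge0.
Qed.

(** By induction on [k]: the limit of the sums at 0 is the constant term, and once
    that vanishes division by the variable shifts the coefficients. *)
Lemma leading_coefficient k c (v w : nat -> C) (L : C) (K : R) :
  (forall n, nr (c n) <= K) -> (forall m, sums c (small m) (v m)) ->
  (forall m, v m = small m ^+ k * w m) -> w @ \oo --> L ->
  (forall j, (j < k)%N -> c j = 0) /\ c k = L.
Proof.
elim: k c v => [|k IH] c v cK cv vw wL.
  split => //; apply: cvg_unique_nr (sums_small0 _ _ _ cK cv) _.
  by have -> : v = w by apply/funext => m; rewrite vw expr0 mul1r.
have c0 : c 0 = 0.
  apply: cvg_unique_nr (sums_small0 _ _ _ cK cv) _.
  have -> : v = (fun m => small m * (small m ^+ k * w m)).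
    by apply/funext => m; rewrite vw exprS mulrA.
  have h : (small \* ((fun m => small m ^+ k) \* w)) @ \oo --> (0 : C) * ((0 : C) ^+ k * L).
    by apply: cvgM cvg_small (cvgM (cvg_power _ _ k cvg_small) wL).
  by move: h; rewrite mul0r.
have [||||h1 h2] := IH (c \o S) (fun m => small m ^+ k * w m).
- by move=> n; exact: cK.
- move=> m; have := sums_shift _ _ _ (small_neq0 m) (cv m).
  by rewrite c0 subr0 vw exprS [_ / small m]mulrC !mulrA mulVf ?mul1r ?small_neq0.
- by [].
- exact: wL.
- by split => // -[|j] // jk; exact: h1.
Qed.

Lemma leading_quotient k c (v : nat -> C) (K : R) :
  (forall n, nr (c n) <= K) -> (forall m, sums c (small m) (v m)) ->
  (forall j, (j < k)%N -> c j = 0) -> (fun m => v m / small m ^+ k) @ \oo --> c k.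
Proof.
elim: k c v => [|k IH] c v cK cv cj.
  under eq_fun do rewrite expr0 divr1; exact: sums_small0 cK cv.
have c0 : c 0 = 0 by exact: cj.
have h m : sums (c \o S) (small m) (v m / small m).
  by move: (sums_shift _ _ _ (small_neq0 m) (cv m)); rewrite c0 subr0.
have cK' n : nr ((c \o S) n) <= K by exact: cK.
have cj' j : (j < k)%N -> (c \o S) j = 0 by move=> jk; exact: cj.
have H := IH (c \o S) (fun m => v m / small m) cK' h cj'.
apply: cvg_trans H; apply: near_eq_cvg; apply: nearW => m.
by rewrite exprS invfM mulrA.
Qed.

(** Averaging over [z] and [- z] keeps the even coefficients and the bound;
    iterating this isolates [c 0]. *)
Lemma mean_value_bound c (M : R) : geometric_decay c ->
  (forall z, nr z = 1 -> exists2 v, sums c z v & nr v <= M) -> nr (c 0) <= M.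
Proof.
move=> [K [th [K0 t0 t1 cK]]] cM.
have dyadic m : forall z, nr z = 1 ->
    exists2 v, sums (fun n => c (2 ^ m * n)%N) z v & nr v <= M.
  elim: m => [|m IH] z z1.
    have [v cv vM] := cM z z1; exists v => //.
    by under eq_fun do rewrite mul1n.
  have s1 : nr (sqrtc z) = 1.
    have : nr (sqrtc z) ^+ 2 = 1 by rewrite -nrX sqr_sqrtc.
    by move=> /eqP; rewrite sqrf_eq1 => /orP[/eqP //|/eqP e]; have := nr_ge0 (sqrtc z); rewrite e; lra.
  have [v cv vM] := IH _ s1; have [|v' cv' vM'] := IH (- sqrtc z); first by rewrite nrN.
  exists ((v + v') / 2).
    have E N : psum (fun n => c (2 ^ m.+1 * n)%N) z N =
      (psum (fun n => c (2 ^ m * n)%N) (sqrtc z) (N * 2) +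
       psum (fun n => c (2 ^ m * n)%N) (- sqrtc z) (N * 2)) / 2.
      elim: N => [|N IHN]; first by rewrite /psum !big_ord0 addr0 mul0r.
      rewrite mulSn !add2n psumS IHN !psumS !exprS.
      have -> : z ^+ N = sqrtc z ^+ (N * 2) by rewrite mulnC exprM sqr_sqrtc.
      have -> : (- sqrtc z) ^+ (N * 2) = sqrtc z ^+ (N * 2).
        by rewrite mulnC !exprM sqrrN.
      have -> : (2 ^ m.+1 * N = 2 ^ m * (N * 2))%N by rewrite expnSr mulnAC mulnA.
      by field.
    rewrite /sums (_ : psum _ _ = fun N => (psum (fun n => c (2 ^ m * n)%N) (sqrtc z) (N * 2) +
       psum (fun n => c (2 ^ m * n)%N) (- sqrtc z) (N * 2)) / 2); last exact/funext.
    have s2 n : (n <= n * 2)%N by rewrite leq_pmulr.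
    have A := cvg_subseq (fun N => (N * 2)%N) (psum (fun n => c (2 ^ m * n)%N) (sqrtc z)) v s2 cv.
    have A' := cvg_subseq (fun N => (N * 2)%N) (psum (fun n => c (2 ^ m * n)%N) (- sqrtc z)) v' s2 cv'.
    exact: (cvg_mulC _ _ _ _ (cvg_addC _ _ _ _ A A') (cvg_cst (2^-1 : C))).
  rewrite nrM nrV nr_nat ler_pdivrMr // mulr_natr mulr2n.
  by apply: le_trans (nrD _ _) _; exact: lerD.
apply/ler_addgt0Pr => e e0.
have [m hm] : exists m, K * th ^+ m / (1 - th) < e.
  have := cvg_geometric0 (K / (1 - th)) _ (ltW t0) t1.
  move=> /cvgrPdist_lt/(_ _ e0) [m _ /(_ m (leqnn _))]; rewrite /= sub0r normrN => h.
  by exists m; apply: le_lt_trans h; rewrite mulrAC ler_norm.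
have [v cv vM] := dyadic m 1 (nr_nat 1).
pose t := th ^+ (2 ^ m).
have tm : t <= th ^+ m by apply: ler_wiXn2l; rewrite ?ltW // ltnW // ltn_expl.
have tt : t <= th by rewrite -[leRHS]expr1; apply: ler_wiXn2l; rewrite ?ltW // expn_gt0.
have tp : 0 <= t by rewrite exprn_ge0 // ltW.
have := @geometric_tail _ _ _ K t cv tp (le_lt_trans tt t1) _ 1.
rewrite {1}/psum big_ord1 expr1n mulr1 muln0 expr1.
have hb n : nr (c (2 ^ m * n)%N * 1 ^+ n) <= K * t ^+ n.
  by rewrite expr1n mulr1 /t -exprM.
move=> /(_ hb) hv; have hK : K * t / (1 - t) <= K * th ^+ m / (1 - th).
  have p1 : 0 < 1 - th by lra.
  have p2 : 0 < 1 - t by lra.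
  apply: ler_pM; [exact: mulr_ge0 | by rewrite invr_ge0 ltW | exact: ler_wpM2l |].
  by rewrite lef_pV2 ?posrE //; lra.
by have := nrD v (- (v - c 0)); rewrite nrN opprB addrC subrK; lra.
Qed.

(** Dividing by [z], of modulus one, shifts the coefficients and keeps the
    bound, until [c k] becomes the constant term. *)
Lemma cauchy_estimate k c (M : R) : geometric_decay c ->
  (forall j, (j < k)%N -> c j = 0) ->
  (forall z, nr z = 1 -> exists2 v, sums c z v & nr v <= M) -> nr (c k) <= M.
Proof.
elim: k c => [|k IH] c dc cj cM; first exact: mean_value_bound.
apply: (IH (c \o S)) => [|j jk|z z1].
- exact: geometric_decay_shift.
- exact: cj.
- have [v cv vM] := cM z z1.
  have z0 : z != 0.
    by apply/eqP => z0; move: z1; rewrite z0 nr0 => /esym/eqP; rewrite oner_eq0.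
  exists ((v - c 0) / z); first exact: sums_shift.
  have -> : c 0 = 0 by exact: cj.
  by rewrite subr0 nrM nrV z1 divr1.
Qed.
End PowerSeries.

(** * Products and zeros of power series *)

Section Products.
Context {R : realType}.
Local Notation C := R[i].
Implicit Types (c e : nat -> C) (z v : C).

Definition convol c e n : C := \sum_(i < n.+1) c i * e (n - i)%N.

Lemma triangle_sum (F : nat -> nat -> C) N :
  \sum_(n < N) \sum_(i < n.+1) F i (n - i)%N = \sum_(i < N) \sum_(j < N - i) F i j.
Proof.
elim: N => [|N IH]; first by rewrite !big_ord0.
rewrite big_ord_recr /= IH [in RHS]big_ord_recr /= subSn // subnn big_ord1.
rewrite big_ord_recr /= subnn addrA -big_split /=; congr (_ + _).
by apply: eq_bigr => i _; rewrite subSn ?(ltnW (ltn_ord i)) // big_ord_recr.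
Qed.

(** Bernoulli's inequality for [(t' / t) ^+ n]. *)
Lemma linear_geometric_bound (t t' : R) : 0 < t -> t < t' ->
  exists K, 0 <= K /\ forall n, n.+1%:R * t ^+ n <= K * t' ^+ n.
Proof.
move=> t0 tt; have t'0 : 0 < t' by exact: lt_trans tt.
pose x := t' / t - 1.
have x0 : 0 < x by rewrite /x subr_gt0 ltr_pdivlMr // mul1r.
exists (1 + x^-1); split; first by rewrite addr_ge0 // invr_ge0 ltW.
have tx : t' = t * (1 + x) by rewrite /x addrC subrK mulrCA divff ?mulr1 // gt_eqF.
have bern n : 1 + n%:R * x <= (1 + x) ^+ n.
  elim: n => [|n IH]; first by rewrite expr0 mul0r addr0.
  rewrite exprS -natr1.
  have : 0 <= n%:R * x ^+ 2 by rewrite mulr_ge0 // sqr_ge0.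
  have x1 : 0 <= 1 + x by lra.
  have := ler_wpM2l x1 IH.
  by rewrite expr2; lra.
move=> n; rewrite tx exprMn mulrCA [leLHS]mulrC ler_wpM2l ?exprn_ge0 ?(ltW t0) //.
apply: le_trans (_ : (1 + x^-1) * (1 + n%:R * x) <= _).
  have -> : (1 + x^-1) * (1 + n%:R * x) = 1 + n%:R * x + x^-1 + n%:R.
    by field; rewrite gt_eqF.
  rewrite -natr1.
  have : 0 <= x^-1 by rewrite invr_ge0 ltW.
  have : 0 <= n%:R * x by rewrite mulr_ge0 // ltW.
  lra.
by rewrite ler_wpM2l // addr_ge0 // invr_ge0 ltW.
Qed.

Lemma geometric_decayD c e : geometric_decay c -> geometric_decay e ->
  geometric_decay (fun n => c n - e n).
Proof.
move=> [K [t [K0 t0 t1 cK]]] [K' [t' [K'0 t'0 t'1 eK]]].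
exists (K + K'), (Num.max t t'); split.
- exact: addr_ge0.
- by rewrite lt_max t0.
- by rewrite gt_max t1.
move=> n; apply: le_trans (nrD _ _) _; rewrite nrN mulrDl; apply: lerD.
  apply: le_trans (cK n) _; rewrite ler_wpM2l // lerXn2r ?nnegrE ?le_max ?lexx ?(ltW t0) //.
apply: le_trans (eK n) _.
by rewrite ler_wpM2l // lerXn2r ?nnegrE ?le_max ?lexx ?orbT ?(ltW t0) ?(ltW t'0).
Qed.

Lemma common_decay c e : geometric_decay c -> geometric_decay e ->
  exists K th : R, [/\ 0 <= K, 0 < th, th < 1,
    forall n, nr (c n) <= K * th ^+ n & forall n, nr (e n) <= K * th ^+ n].
Proof.
move=> [K [t [K0 t0 t1 cK]]] [K' [t' [K'0 t'0 t'1 eK]]].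
exists (Num.max K K'), (Num.max t t').
have m0 : 0 < Num.max t t' by rewrite lt_max t0.
split; rewrite ?le_max ?gt_max ?K0 ?t1 // => n.
  apply: le_trans (cK n) _; apply: ler_pM; rewrite ?exprn_ge0 ?le_max ?lexx ?(ltW t0) //.
  by rewrite lerXn2r ?nnegrE ?le_max ?lexx ?(ltW t0).
apply: le_trans (eK n) _; apply: ler_pM; rewrite ?exprn_ge0 ?le_max ?lexx ?orbT ?(ltW t'0) //.
by rewrite lerXn2r ?nnegrE ?le_max ?lexx ?orbT ?(ltW t0) ?(ltW t'0).
Qed.

Lemma geometric_decay_convol c e : geometric_decay c -> geometric_decay e ->
  geometric_decay (convol c e).
Proof.
move=> /common_decay h /h [K [t [K0 t0 t1 cK eK]]].
have tt : t < (1 + t) / 2 by lra.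
have [K' [K'0 hK]] := linear_geometric_bound _ _ t0 tt.
exists (K ^+ 2 * K'), ((1 + t) / 2); split; [|lra|lra|].
  by rewrite mulr_ge0 // sqr_ge0.
move=> n; apply: le_trans (nr_sum _ _ _ _) _.
apply: le_trans (_ : \sum_(i < n.+1) K ^+ 2 * t ^+ n <= _).
  apply: ler_sum => i _; rewrite nrM.
  have -> : K ^+ 2 * t ^+ n = (K * t ^+ i) * (K * t ^+ (n - i)).
    have -> : t ^+ n = t ^+ i * t ^+ (n - i) by rewrite -exprD subnKC // -ltnS.
    by rewrite expr2 mulrACA.
  by apply: ler_pM; [exact: nr_ge0 | exact: nr_ge0 | exact: cK | exact: eK].
move: (K ^+ 2) (sqr_ge0 K) => Q Q0.
by rewrite sumr_const card_ord -[leLHS]mulr_natr -[leLHS]mulrA -[leRHS]mulrA ler_wpM2l // mulrC.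
Qed.

(** The partial sums of the convolution are [c i z^i] times partial sums of the
    second series; replacing these by their limit costs at most [N t^N] up to a
    constant. *)
Lemma sums_convol c e z v w : geometric_decay c -> geometric_decay e -> nr z <= 1 ->
  sums c z v -> sums e z w -> sums (convol c e) z (v * w).
Proof.
move=> dc de z1 cv ew; have [K [t [K0 t0 t1 cK eK]]] := common_decay _ _ dc de.
have bz (f : nat -> C) n : nr (f n) <= K * t ^+ n -> nr (f n * z ^+ n) <= K * t ^+ n.
  move=> h; rewrite nrM nrX; apply: le_trans h; rewrite ler_piMr ?nr_ge0 //.
  by rewrite exprn_ile1 // nr_ge0.
have tail := geometric_tail _ _ _ _ _ ew (ltW t0) t1 (fun n => bz e n (eK n)).
have E N : psum (convol c e) z N = \sum_(i < N) c i * z ^+ i * psum e z (N - i)%N.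
  pose F i j := c i * e j * z ^+ (i + j).
  have -> : psum (convol c e) z N = \sum_(n < N) \sum_(i < n.+1) F i (n - i)%N.
    apply: eq_bigr => n _; rewrite /convol mulr_suml; apply: eq_bigr => i _.
    by rewrite /F subnKC // -ltnS.
  rewrite triangle_sum; apply: eq_bigr => i _; rewrite /psum mulr_sumr.
  by apply: eq_bigr => j _; rewrite /F exprD mulrACA.
have D N : nr (psum (convol c e) z N - psum c z N * w)
    <= K ^+ 2 / (1 - t) * (N.+1%:R * t ^+ N).
  rewrite E {2}/psum mulr_suml -sumrB; apply: le_trans (nr_sum _ _ _ _) _.
  apply: le_trans (_ : \sum_(i < N) K ^+ 2 / (1 - t) * t ^+ N <= _).
    apply: ler_sum => i _; rewrite -mulrBr nrM nrB.
    have -> : K ^+ 2 / (1 - t) * t ^+ N = (K * t ^+ i) * (K * t ^+ (N - i) / (1 - t)).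
      have -> : t ^+ N = t ^+ i * t ^+ (N - i) by rewrite -exprD subnKC // ltnW.
      by rewrite expr2; ring.
    by apply: ler_pM; [exact: nr_ge0 | exact: nr_ge0 | exact: bz | exact: tail].
  rewrite sumr_const card_ord -[leLHS]mulr_natr -[leLHS]mulrA ler_wpM2l //.
    by rewrite divr_ge0 ?sqr_ge0 // subr_ge0 ltW.
  by rewrite mulrC ler_wpM2r ?exprn_ge0 ?(ltW t0) // ler_nat.
have tt : t < (1 + t) / 2 by lra.
have [K' [K'0 hK]] := linear_geometric_bound _ _ t0 tt.
have h0 : (fun N => psum (convol c e) z N - psum c z N * w) @ \oo --> (0 : C).
  apply: (@cvg_squeeze0 _ _ _ (fun N => K ^+ 2 / (1 - t) * K' * ((1 + t) / 2) ^+ N)).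
    move=> N; rewrite subr0; apply: le_trans (D N) _; rewrite -[leRHS]mulrA ler_wpM2l //.
    by rewrite divr_ge0 ?sqr_ge0 // subr_ge0 ltW.
  by apply: cvg_geometric0; lra.
rewrite /sums -[v * w]add0r.
have -> : psum (convol c e) z = (fun N => (psum (convol c e) z N - psum c z N * w) + psum c z N * w).
  by apply/funext => N; rewrite subrK.
exact: (cvg_addC _ _ _ _ h0 (cvg_mulC _ _ _ _ cv (cvg_cst w))).
Qed.

End Products.

Section Zeros.
Context {R : realType}.
Local Notation C := R[i].
Implicit Types (c q g : nat -> C) (s : R).

Definition energy_le c (B : R) : Prop := forall N, \sum_(n < N) nr (c n) ^+ 2 <= B.

(** Coefficients of the quotient by [z - s] of a power series that vanishes at
    [s]. *)
Definition quot c s n : C := - (psum c s%:C n.+1 / (s%:C) ^+ n.+1).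

(** Coefficients of the quotient of the power series by the Blaschke factor
    [(z - s) / (1 - s z)]. *)
Definition blaschke_quot c s n : C :=
  if n is m.+1 then quot c s m.+1 - s%:C * quot c s m else quot c s 0.

Lemma quot0 c s : 0 < s -> c 0 = - (s%:C * quot c s 0).
Proof.
move=> s0; have n0 : s%:C != 0 :> C by rewrite eq_complex /= eqxx andbT gt_eqF.
rewrite /quot /psum big_ord1 expr0 expr1 mulr1; field; exact: n0.
Qed.

Lemma quotS c s n : 0 < s -> c n.+1 = quot c s n - s%:C * quot c s n.+1.
Proof.
move=> s0; have n0 : s%:C != 0 :> C by rewrite eq_complex /= eqxx andbT gt_eqF.
have nn : s%:C ^+ n != 0 :> C by rewrite expf_neq0.
by rewrite /quot (psumS _ _ n.+1) !exprS; field; rewrite n0 nn.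
Qed.

Lemma nr_realM s (z : C) : 0 < s -> nr (s%:C * z) = s * nr z.
Proof. by move=> s0; rewrite nrM nr_real ger0_norm // ltW. Qed.

Lemma nr_sqrE (z : C) : nr z ^+ 2 = complex.Re z ^+ 2 + complex.Im z ^+ 2.
Proof.
by rewrite /nr normc_def /= sqr_sqrtr // addr_ge0 // sqr_ge0.
Qed.

(** The coefficient form of the fact that the Blaschke factor has modulus one on
    the unit circle: summed over consecutive [x], [y] it telescopes. *)
Lemma blaschke_energy (x y : C) s :
  nr (x - s%:C * y) ^+ 2 - nr (y - s%:C * x) ^+ 2 =
  (1 - s ^+ 2) * (nr x ^+ 2 - nr y ^+ 2).
Proof. by rewrite !nr_sqrE; case: x => x1 x2; case: y => y1 y2 /=; ring. Qed.


Lemma quot_bound c s (K t : R) : 0 < s -> s < 1 -> 0 <= K -> 0 < t -> t < 1 ->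
  (forall n, nr (c n) <= K * t ^+ n) -> sums c s%:C 0 ->
  forall n, nr (quot c s n) <= K / (1 - t) * t ^+ n.
Proof.
move=> s0 s1 K0 t0 t1 cK cs n; have ts : t * s < t by rewrite gtr_pMr.
have ts0 : 0 <= t * s by rewrite mulr_ge0 // ltW.
have h k : nr (c k * s%:C ^+ k) <= K * (t * s) ^+ k.
  rewrite nrM nrX nr_real ger0_norm ?(ltW s0) // exprMn mulrA.
  by rewrite ler_wpM2r // exprn_ge0 // ltW.
have := geometric_tail _ _ _ _ _ cs ts0 (lt_trans ts t1) h n.+1.
rewrite sub0r nrN /quot nrN nrM nrV nrX nr_real ger0_norm ?(ltW s0) // => h'.
rewrite ler_pdivrMr ?exprn_gt0 //; apply: le_trans h' _.
have p1 : 0 < 1 - t by rewrite subr_gt0.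
have p2 : 0 < 1 - t * s by rewrite subr_gt0 (lt_trans ts).
have -> : K * (t * s) ^+ n.+1 / (1 - t * s) = (K * t ^+ n * s ^+ n.+1) * (t / (1 - t * s)).
  by rewrite exprMn [t ^+ n.+1]exprS; ring.
have -> : K / (1 - t) * t ^+ n * s ^+ n.+1 = (K * t ^+ n * s ^+ n.+1) * (1 - t)^-1 by ring.
rewrite ler_wpM2l //.
  by apply: mulr_ge0; [apply: mulr_ge0 => // |]; rewrite exprn_ge0 // ltW.
rewrite ler_pdivrMr // mulrC ler_pdivlMr //; nra.
Qed.

Lemma blaschke_decay c s : 0 < s -> s < 1 -> geometric_decay c -> sums c s%:C 0 ->
  geometric_decay (blaschke_quot c s).
Proof.
move=> s0 s1 [K [t [K0 t0 t1 cK]]] cs.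
have := quot_bound _ _ _ _ s0 s1 K0 t0 t1 cK cs; set K' := K / (1 - t) => gK.
have K'0 : 0 <= K' by rewrite divr_ge0 // subr_ge0 ltW.
exists (2 * K' / t), t; split => //.
  by apply: divr_ge0; [exact: mulr_ge0 | exact: ltW].
case=> [|n] /=.
  apply: le_trans (gK 0) _; rewrite expr0 !mulr1 ler_pdivlMr //; nra.
apply: le_trans (nrD _ _) _; rewrite (nrN (s%:C * quot c s n)) nr_realM //.
have -> : 2 * K' / t * t ^+ n.+1 = 2 * (K' * t ^+ n).
  by rewrite [t ^+ n.+1]exprS; field; rewrite gt_eqF.
have h1 : nr (quot c s n.+1) <= K' * t ^+ n.
  apply: le_trans (gK n.+1) _; rewrite ler_wpM2l // exprS ler_piMl ?exprn_ge0 ?(ltW t1) ?(ltW t0) //.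
have h2 : s * nr (quot c s n) <= K' * t ^+ n.
  by apply: le_trans (gK n); rewrite ler_piMl ?nr_ge0 // ltW.
lra.
Qed.

Lemma blaschke_energy_sum c s N : 0 < s ->
  \sum_(n < N.+1) nr (blaschke_quot c s n) ^+ 2 =
  \sum_(n < N.+1) nr (c n) ^+ 2 + (1 - s ^+ 2) * nr (quot c s N) ^+ 2.
Proof.
move=> s0; elim: N => [|N IH].
  rewrite !big_ord1 /= (quot0 c s s0) (nrN (s%:C * quot c s 0)) nr_realM //; ring.
rewrite big_ord_recr IH [in RHS]big_ord_recr /= (quotS c s N s0).
have := blaschke_energy (quot c s N.+1) (quot c s N) s.
move/eqP; rewrite subr_eq => /eqP ->; ring.
Qed.

(** The boundary term of the telescoping sum tends to zero. *)
Lemma energy_blaschke c s B : 0 < s -> s < 1 -> geometric_decay c ->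
  sums c s%:C 0 -> energy_le c B -> energy_le (blaschke_quot c s) B.
Proof.
move=> s0 s1 [K [t [K0 t0 t1 cK]]] cs cB N; apply/ler_addgt0Pr => e e0.
have gK := quot_bound _ _ _ _ s0 s1 K0 t0 t1 cK cs.
have tt0 : 0 <= t ^+ 2 by rewrite sqr_ge0.
have tt1 : t ^+ 2 < 1 by rewrite expr_lt1 // ltW.
have /cvgrPdist_lt/(_ _ e0) [M _ hM] := cvg_geometric0 ((K / (1 - t)) ^+ 2) _ tt0 tt1.
have := hM (maxn M N) (leq_maxl _ _); set m := maxn M N.
rewrite /= sub0r normrN -exprM mulnC exprM -exprMn ger0_norm ?sqr_ge0 // => hm.
apply: le_trans (_ : \sum_(n < m.+1) nr (blaschke_quot c s n) ^+ 2 <= _).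
  have Nm : (N <= m.+1)%N by rewrite leqW // leq_maxr.
  rewrite -(subnKC Nm) big_split_ord /= lerDl.
  by apply: sumr_ge0 => i _; exact: sqr_ge0.
rewrite blaschke_energy_sum //; apply: lerD; first exact: cB.
apply: le_trans (ltW hm); apply: le_trans (_ : nr (quot c s m) ^+ 2 <= _).
  by rewrite ler_piMl ?sqr_ge0 // gerBl sqr_ge0.
by rewrite lerXn2r ?nnegrE ?nr_ge0 ?gK // mulr_ge0 ?exprn_ge0 ?divr_ge0 ?subr_ge0 // ltW.
Qed.

Lemma psum_quot c s z N : 0 < s ->
  psum c z N.+1 = (z - s%:C) * psum (quot c s) z N - s%:C * (quot c s N * z ^+ N).
Proof.
move=> s0; elim: N => [|N IH].
  rewrite /psum big_ord1 big_ord0 expr0 !mulr1 mulr0 add0r; exact: quot0.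
by rewrite psumS IH psumS (quotS c s N s0) exprS; ring.
Qed.

Lemma psum_blaschke c s z N :
  psum (blaschke_quot c s) z N.+1 =
  psum (quot c s) z N.+1 - s%:C * z * psum (quot c s) z N.
Proof.
elim: N => [|N IH]; first by rewrite /psum !big_ord1 big_ord0 mulr0 subr0.
rewrite psumS IH (psumS (quot c s) z N.+1) (psumS (quot c s) z N) /= exprS; ring.
Qed.

Lemma blaschke_zero c s s' : 0 < s -> s < 1 -> 0 < s' -> s' < 1 -> s' != s ->
  geometric_decay c -> sums c s%:C 0 -> sums c s'%:C 0 ->
  sums (blaschke_quot c s) s'%:C 0.
Proof.
move=> s0 s1 s'0 s'1 ss [K [t [K0 t0 t1 cK]]] cs cs'.
have gK := quot_bound _ _ _ _ s0 s1 K0 t0 t1 cK cs.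
have ns : s'%:C - s%:C != 0 :> C by rewrite subr_eq0 eq_complex /= eqxx andbT.
have g0 : (fun N => quot c s N * s'%:C ^+ N) @ \oo --> (0 : C).
  apply: (@cvg_squeeze0 _ _ _ (fun N => K / (1 - t) * t ^+ N)).
    move=> N; rewrite subr0 nrM nrX nr_real ger0_norm ?(ltW s'0) //.
    apply: le_trans (gK N); rewrite ler_piMr ?nr_ge0 // exprn_ile1 ?ltW //.
  by apply: cvg_geometric0; rewrite // ltW.
have cs1 := cvg_subseq S (psum c s'%:C) 0 leqnSn cs'.
have G : psum (quot c s) s'%:C @ \oo --> (0 : C).
  have -> : psum (quot c s) s'%:C = (fun N => (psum c s'%:C N.+1
      + s%:C * (quot c s N * s'%:C ^+ N)) * (s'%:C - s%:C)^-1).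
    by apply/funext => N; rewrite (psum_quot c s) // subrK mulrC mulKf.
  have := cvg_mulC _ _ _ _ (cvg_addC _ _ _ _ cs1 (cvg_mulC _ _ _ _ (cvg_cst (s%:C : C)) g0))
    (cvg_cst ((s'%:C - s%:C)^-1 : C)).
  by rewrite mulr0 addr0 mul0r; apply.
have Gs := cvg_subseq S (psum (quot c s) s'%:C) 0 leqnSn G.
have := cvg_addC _ _ _ _ Gs (cvg_mulC _ _ _ _ (cvg_cst (- (s%:C * s'%:C) : C)) G).
rewrite mulr0 addr0 => /(_ _) h; rewrite /sums.
apply/cvg_nrP => e e0; have [N hN] := (iffLR (cvg_nrP _ _ _) h) _ e0.
exists N.+1 => -[//|n] Nn; have := hN n Nn.
by rewrite psum_blaschke !mulNr.
Qed.

Lemma first_coefficient_bound m c (z : nat -> R) s B : geometric_decay c -> energy_le c B ->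
  s < 1 -> (forall i, 0 < z i <= s) -> injective z ->
  (forall i, sums c (z i)%:C 0) -> nr (c 0) <= s ^+ m * (1 + B).
Proof.
move=> + + s1; elim: m c z => [|m IH] c z dc cB zs zi cz.
  rewrite expr0 mul1r; have := cB 1; rewrite big_ord1.
  have := nr_ge0 (c 0); nra.
case/andP: (zs 0) => z0 z0s; have z01 := le_lt_trans z0s s1.
have -> : nr (c 0) = z 0 * nr (blaschke_quot c (z 0) 0).
  by rewrite /= {1}(quot0 c (z 0) z0) (nrN (_ * quot c (z 0) 0)) nr_realM.
have h : nr (blaschke_quot c (z 0) 0) <= s ^+ m * (1 + B).
  apply: (IH _ (z \o S)).
  - exact: blaschke_decay.
  - exact: energy_blaschke.
  - by move=> i; exact: zs.
  - by move=> i j /zi [].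
  - move=> i /=; case/andP: (zs i.+1) => zi0 zis.
    apply: blaschke_zero => //; first exact: le_lt_trans s1.
    by apply/eqP => /zi.
rewrite exprS -mulrA; apply: ler_pM => //; [exact: ltW | exact: nr_ge0].
Qed.

Lemma decay_energy c : geometric_decay c -> exists2 B, 0 <= B & energy_le c B.
Proof.
move=> [K [t [K0 t0 t1 cK]]]; have t1' : 0 < 1 - t by rewrite subr_gt0.
exists (K ^+ 2 / (1 - t)) => [|N]; first by rewrite divr_ge0 ?sqr_ge0 // ltW.
apply: le_trans (_ : K ^+ 2 * ((1 - t ^+ N) / (1 - t)) <= _); last first.
  rewrite ler_wpM2l ?sqr_ge0 // ler_piMl ?invr_ge0 ?(ltW t1') //.
  by rewrite gerBl exprn_ge0 // ltW.
elim: N => [|N IH]; first by rewrite big_ord0 expr0 subrr mul0r mulr0.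
rewrite big_ord_recr /=.
have -> : K ^+ 2 * ((1 - t ^+ N.+1) / (1 - t))
    = K ^+ 2 * ((1 - t ^+ N) / (1 - t)) + K ^+ 2 * t ^+ N.
  by rewrite [t ^+ N.+1]exprS; field; rewrite gt_eqF.
apply: lerD => //; apply: le_trans (_ : (K * t ^+ N) ^+ 2 <= _).
  by rewrite lerXn2r ?nnegrE ?nr_ge0 // mulr_ge0 // exprn_ge0 // ltW.
have tN : t ^+ N <= 1 by rewrite exprn_ile1 // ltW.
have tN0 : 0 <= t ^+ N by rewrite exprn_ge0 // ltW.
by rewrite exprMn ler_wpM2l ?sqr_ge0 // expr2 ler_piMl.
Qed.

(** Dividing out a zero [z i <= s < 1] by a Blaschke factor does not increase the
    sum of the squared moduli of the coefficients and gains a factor [s] on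
    [c 0]; with infinitely many zeros [c 0 = 0], and one proceeds with [c \o S]. *)
Lemma coefficients_eq0 c (z : nat -> R) s : geometric_decay c ->
  s < 1 -> (forall i, 0 < z i <= s) -> injective z ->
  (forall i, sums c (z i)%:C 0) -> forall n, c n = 0.
Proof.
move=> + s1 zs zi.
have first (e : nat -> C) : geometric_decay e -> (forall i, sums e (z i)%:C 0) -> e 0 = 0.
  move=> de ez; have [B B0 eB] := decay_energy e de.
  have s0 : 0 <= s by case/andP: (zs 0) => z0 z0s; apply: ltW; exact: lt_le_trans z0s.
  apply: nr_eq0; apply: le_anti; rewrite nr_ge0 andbT.
  apply/ler_addgt0Pr => eps eps0; rewrite add0r.
  have /cvgrPdist_lt/(_ _ eps0) [M _ hM] := cvg_geometric0 (1 + B) _ s0 s1.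
  have := hM M (leqnn M); rewrite /= sub0r normrN => hm; apply: ltW; apply: le_lt_trans hm.
  apply: le_trans (ler_norm _); rewrite mulrC.
  exact: (first_coefficient_bound M e z s B).
move=> dc cz n; elim: n c dc cz => [|n IH] c dc cz; first exact: first.
apply: (IH (c \o S)); first exact: geometric_decay_shift.
move=> i; case/andP: (zs i) => zi0 _.
have zn : (z i)%:C != 0 :> C by rewrite eq_complex /= eqxx andbT gt_eqF.
by move: (sums_shift _ _ _ zn (cz i)); rewrite (first c dc cz) subr0 mul0r.
Qed.

End Zeros.

(** * Polynomial functions *)

Section PolynomialFunctions.
Context {R : realType} {d : nat}.
Local Notation C := R[i].
Implicit Types (p q : 'rV[C]_d -> C).

Definition polyfun p : Prop := exists s : seq (C * {ffun 'I_d -> nat}),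
  forall w, p w = \sum_(t <- s) t.1 * monomial t.2 w.

Definition zero_index : {ffun 'I_d -> nat} := [ffun => 0%N].
Definition unit_index (i : 'I_d) : {ffun 'I_d -> nat} := [ffun j => (j == i : nat)].
Definition add_index (al be : {ffun 'I_d -> nat}) : {ffun 'I_d -> nat} :=
  [ffun i => (al i + be i)%N].

Lemma monomial_zero w : monomial zero_index w = 1 :> C.
Proof. by rewrite /monomial big1 // => i _; rewrite ffunE expr0. Qed.

Lemma monomial_unit i (w : 'rV[C]_d) : monomial (unit_index i) w = w 0 i.
Proof.
rewrite /monomial (bigD1 i) //= ffunE eqxx expr1 big1 ?mulr1 // => j ji.
by rewrite ffunE (negbTE ji) expr0.
Qed.

Lemma monomialM al be (w : 'rV[C]_d) :
  monomial (add_index al be) w = monomial al w * monomial be w.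
Proof.
by rewrite /monomial -big_split /=; apply: eq_bigr => i _; rewrite ffunE exprD.
Qed.

Lemma polyfun_ext p q : polyfun p -> p =1 q -> polyfun q.
Proof. by move=> [s ps] pq; exists s => w; rewrite -pq. Qed.


Lemma polyfun_cst (c : C) : polyfun (fun=> c).
Proof. by exists [:: (c, zero_index)] => w; rewrite big_seq1 monomial_zero mulr1. Qed.

Lemma polyfun_coord i : polyfun (fun w => w 0 i).
Proof. by exists [:: (1, unit_index i)] => w; rewrite big_seq1 monomial_unit mul1r. Qed.

Lemma polyfunD p q : polyfun p -> polyfun q -> polyfun (fun w => p w + q w).
Proof. by move=> [s ps] [t qt]; exists (s ++ t) => w; rewrite big_cat ps qt. Qed.

Lemma polyfunM p q : polyfun p -> polyfun q -> polyfun (fun w => p w * q w).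
Proof.
move=> [s ps] [t qt].
exists [seq (x.1 * y.1, add_index x.2 y.2) | x <- s, y <- t] => w.
rewrite big_allpairs_dep /= ps qt mulr_suml; apply: eq_bigr => x _.
by rewrite mulr_sumr; apply: eq_bigr => y _; rewrite /= monomialM mulrACA.
Qed.

Lemma polyfunB p q : polyfun p -> polyfun q -> polyfun (fun w => p w - q w).
Proof.
move=> hp hq; apply: polyfun_ext (polyfunD _ _ hp (polyfunM _ _ (polyfun_cst (-1)) hq)) _.
by move=> w; rewrite mulN1r.
Qed.

Lemma polyfunX p n : polyfun p -> polyfun (fun w => p w ^+ n).
Proof.
move=> hp; elim: n => [|n IH].
  by apply: polyfun_ext (polyfun_cst 1) _ => w; rewrite expr0.
by apply: polyfun_ext (polyfunM _ _ hp IH) _ => w; rewrite exprS.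
Qed.

Lemma polyfun_sum (I : Type) (r : seq I) (F : I -> 'rV[C]_d -> C) :
  (forall i, polyfun (F i)) -> polyfun (fun w => \sum_(i <- r) F i w).
Proof.
move=> hF; elim: r => [|i r IH].
  by apply: polyfun_ext (polyfun_cst 0) _ => w; rewrite big_nil.
by apply: polyfun_ext (polyfunD _ _ (hF i) IH) _ => w; rewrite big_cons.
Qed.

Lemma polyfun_line p (w v : 'rV[C]_d) : polyfun p ->
  exists q : {poly C}, forall z, p (w + z *: v) = q.[z].
Proof.
move=> [s ps].
exists (\sum_(t <- s) t.1 *: \prod_i ((w 0 i)%:P + v 0 i *: 'X) ^+ t.2 i) => z.
rewrite ps horner_sum; apply: eq_bigr => t _; rewrite hornerZ horner_prod.
congr (_ * _); apply: eq_bigr => i _.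
by rewrite !hornerE !mxE mulrC.
Qed.

(** On each line through [w] the function is a one-variable polynomial with
    infinitely many zeros. *)
Lemma polyfun_eq0 p (w : 'rV[C]_d) (e : R) : 0 < e -> polyfun p ->
  (forall u : 'rV[C]_d, (forall i, nr (u 0 i - w 0 i : C) < e) -> p u = 0) -> forall u, p u = 0.
Proof.
move=> e0 hp h u; have [q hq] := polyfun_line _ w (u - w) hp.
suff q0 : q = 0.
  by have := hq 1; rewrite scale1r addrC subrK q0 horner0.
pose K := \sum_i nr ((u - w) 0 i : C) + 1.
have K0 : 0 < K by rewrite ltr_wpDl // sumr_ge0 // => i _; exact: nr_ge0.
have Ki i : nr ((u - w) 0 i : C) < K.
  rewrite /K (bigD1 i) //= -addrA ltrDl ltr_wpDl // sumr_ge0 // => j _; exact: nr_ge0.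
have [N hN] := inv_succ_lt _ (divr_gt0 e0 K0).
apply/eqP; apply: contraT => qn0.
pose rs := [seq (n.+1%:R^-1 : C) | n <- iota N (size q)].
have ar : all (root q) rs.
  apply/allP => x /mapP [n]; rewrite mem_iota => /andP[Nn _] ->.
  rewrite /root -hq; apply/eqP; apply: h => i.
  have -> : (w + n.+1%:R^-1 *: (u - w)) 0 i - w 0 i = n.+1%:R^-1 * (u - w) 0 i.
    by rewrite mxE addrC addKr mxE.
  rewrite nrM nrV nr_nat -(divfK (lt0r_neq0 K0) e).
  by apply: ltr_pM; rewrite ?nr_ge0 ?invr_ge0 //; exact: hN.
have ur : uniq rs.
  rewrite map_inj_uniq ?iota_uniq // => m n /invr_inj /eqP.
  by rewrite eqr_nat => /eqP [].
by have := max_poly_roots qn0 ar ur; rewrite size_map size_iota ltnn.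
Qed.

End PolynomialFunctions.

Section HardyPolynomials.
Context {R : realType} {d : nat} {a : nat -> R} {r : \bar R}.
Context (H : hilbert_function_space R (maximal_domain d a r)).
Local Notation C := R[i].
Local Notation X := (maximal_domain d a r).
Hypothesis Hw : weighted_hardy_space H.

Lemma polyfun_value (p : 'rV[C]_d -> C) : polyfun p ->
  exists f : H, forall w, X w -> value H f w = p w.
Proof.
move=> [s ps]; exists (\sum_(t <- s) t.1 *: mono H t.2) => w Xw.
rewrite /value ip_suml ps; apply: eq_bigr => t _.
by rewrite ipZl -/(value H _ _) value_mono.
Qed.

Lemma polyfun_hom_part f n : polyfun (hom_part H f n).
Proof.
exists [seq ((nr (mono H al) ^+ 2)%:C^-1 * hfs_ip H f (mono H al), al) | al <- multi_indices d n] => w.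
rewrite /hom_part /hom_kern ip_sumr big_map; apply: eq_bigr => al _.
by rewrite ipZr conj_coef /=; ring.
Qed.

Hypothesis (r_gt0 : (0 < r)%E).

Lemma sums_slice f w (z : C) : X w -> nr z <= 1 ->
  sums (fun n => hom_part H f n w) z (value H f (z *: w)).
Proof.
move=> Xw z1; have := value_expansion H Hw f (z *: w) (domain_scale _ _ _ _ _ z1 Xw).
rewrite /sums /psum; under [in X in X -> _]eq_fun do
  under eq_bigr do rewrite hom_partZ mulrC.
exact.
Qed.

Lemma hom_kern_le n w : X w -> nr (hom_kern H n w) <= nr (kern H w).
Proof.
move=> Xw; rewrite -(@ler_pXn2r _ 2) ?nnegrE ?nr_ge0 // (nr_hom_kern H Hw).
apply: le_trans (kern_partial_le H Hw w n.+1 Xw); rewrite big_ord_recr /= lerDr.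
by apply: sumr_ge0 => i _; rewrite mulr_ge0 ?exprn_ge0 ?sqn_ge0 // ltW // (coef_gt0 H Hw).
Qed.

(** The homogeneous parts are bounded at [rho *: w] for some [rho > 1]. *)
Lemma slice_decay f w : ((euclidean_norm w)%:E < r)%E ->
  geometric_decay (fun n => hom_part H f n w).
Proof.
move=> /open_ball_scale [rho rho1 rw]; have rho0 : 0 < rho by apply: lt_trans rho1.
set K := nr f * nr (kern H (rho%:C *: w)).
have Xr := domain_open_ball _ a _ _ rw.
exists K, rho^-1; split.
- by rewrite mulr_ge0 // nr_ge0.
- by rewrite invr_gt0.
- by rewrite invf_lt1.
move=> n; have -> : w = (rho^-1)%:C *: (rho%:C *: w).
  by rewrite scalerA -rmorphM /= mulVf ?gt_eqF // scale1r.
rewrite hom_partZ nrM nrX nr_real ger0_norm ?invr_ge0 ?(ltW rho0) // mulrC.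
rewrite ler_wpM2r ?exprn_ge0 ?invr_ge0 ?(ltW rho0) //.
apply: le_trans (cauchy_schwarz (@hfs_ip_norm _ _ H) _ _) _.
by rewrite ler_wpM2l ?nr_ge0 // hom_kern_le.
Qed.
End HardyPolynomials.

(** * Schwarz lemma, maximum principle and Liouville theorem for the symbol *)

Section Relation.
Context {R : realType} {d1 d2 : nat} {a1 a2 : nat -> R} {r1 r2 : \bar R}.
Context {H1 : hilbert_function_space R (maximal_domain d1 a1 r1)}.
Context {H2 : hilbert_function_space R (maximal_domain d2 a2 r2)}.
Local Notation C := R[i].
Local Notation X1 := (maximal_domain d1 a1 r1).
Local Notation X2 := (maximal_domain d2 a2 r2).
Local Notation ball1 w := ((euclidean_norm w)%:E < r1)%E.

(** A weighted composition operator with its weight and symbol extended to total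
    functions of the coordinates. *)
Definition intertwines (lam : 'rV[C]_d1 -> C) (Phi : 'rV[C]_d1 -> 'rV[C]_d2)
    (W : {linear H2 -> H1}) : Prop :=
  [/\ forall w, X1 w -> X2 (Phi w),
      forall f w, X1 w -> value H1 (W f) w = lam w * value H2 f (Phi w),
      exists M, forall g, nr (W g) <= M * nr g & bijective W].

Lemma intertwines_exists (lambda : X1 -> C) (phi : X1 -> X2) :
  invertible_weighted_composition H1 H2 lambda phi ->
  exists lam Phi W, [/\ intertwines lam Phi W, forall x, lam (val x) = lambda x &
    forall x, Phi (val x) = val (phi x)].
Proof.
move=> [W [WE [M WM] Wb]].
pose lam (w : 'rV[C]_d1) := if pselect (X1 w) is left h then lambda (pt w h) else 0.
pose Phi (w : 'rV[C]_d1) := if pselect (X1 w) is left h then val (phi (pt w h)) else 0.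
have lamE x : lam (val x) = lambda x.
  rewrite /lam; case: pselect => [h|]; last by case; exact: set_valP.
  by congr lambda; apply: val_inj.
have PhiE x : Phi (val x) = val (phi x).
  rewrite /Phi; case: pselect => [h|]; last by case; exact: set_valP.
  by congr (val (phi _)); apply: val_inj.
exists lam, Phi, W; split => //; split => //.
- by move=> w Xw; rewrite -[w]/(val (pt w Xw)) PhiE; exact: set_valP.
- move=> f w Xw; rewrite -[w]/(val (pt w Xw)) PhiE lamE -!valueE; exact: WE.
- by exists M => g; rewrite -lecR rmorphM /= -!nrE; exact: WM.
Qed.

Context {lam : 'rV[C]_d1 -> C} {Phi : 'rV[C]_d1 -> 'rV[C]_d2} {W : {linear H2 -> H1}}.
Hypotheses (Hw1 : weighted_hardy_space H1) (Hw2 : weighted_hardy_space H2).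
Hypothesis hW : intertwines lam Phi W.
Hypotheses (r1_gt0 : (0 < r1)%E) (r2_gt0 : (0 < r2)%E).

Let XPhi w : X1 w -> X2 (Phi w). Proof. by case: hW => h _ _ _; exact: h. Qed.
Let WE f w : X1 w -> value H1 (W f) w = lam w * value H2 f (Phi w).
Proof. by case: hW => _ h _ _; exact: h. Qed.

Lemma W_onto (f : H1) : exists g : H2, f = W g.
Proof. by case: hW => _ _ _ [W' _ W'K]; exists (W' f); rewrite W'K. Qed.

(** A zero of [lam] would be a common zero of the range of [W], which contains
    the constants. *)
Lemma lam_neq0 w : X1 w -> lam w != 0.
Proof.
move=> Xw; have [f hf] := polyfun_value H1 Hw1 _ (polyfun_cst 1).
have [g fg] := W_onto f; apply/eqP => l0; have := hf w Xw.
by rewrite fg WE // l0 mul0r => /esym/eqP; rewrite oner_eq0.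
Qed.

(** If two points have the same image, evaluations at them are proportional on
    the range of [W]; the constants fix the factor and the coordinates separate
    the points. *)
Lemma Phi_inj w w' : X1 w -> X1 w' -> Phi w = Phi w' -> w = w'.
Proof.
move=> Xw Xw' e.
have key f : lam w' * value H1 f w = lam w * value H1 f w'.
  by have [g ->] := W_onto f; rewrite !WE // e mulrCA.
have [f hf] := polyfun_value H1 Hw1 _ (polyfun_cst 1).
have l : lam w' = lam w by have := key f; rewrite !hf // !mulr1.
apply/rowP => i; have [g hg] := polyfun_value H1 Hw1 _ (polyfun_coord i).
by have := key g; rewrite !hg // l => /(mulfI (lam_neq0 w Xw)).
Qed.

Lemma polyfun_comp p : polyfun p ->
  exists f : H1, forall w, X1 w -> value H1 f w = lam w * p (Phi w).
Proof.
move=> /(polyfun_value H2 Hw2) [g hg]; exists (W g) => w Xw.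
by rewrite WE // hg //; exact: XPhi.
Qed.

Lemma lamE : exists f : H1, forall w, X1 w -> value H1 f w = lam w.
Proof.
have [f hf] := polyfun_comp _ (polyfun_cst 1).
by exists f => w Xw; rewrite hf // mulr1.
Qed.

Lemma zero_ball : ball1 (0 : 'rV[C]_d1).
Proof.
rewrite euclidE /sqn big1 ?sqrtr0 // => i _; by rewrite mxE nr0 expr0n.
Qed.

Lemma ball_domain w : ball1 w -> X1 w.
Proof. exact: domain_open_ball. Qed.

Lemma value0 f w : X1 w -> value H1 f 0 = hom_part H1 f 0 w.
Proof.
move=> Xw; have z1 : nr (0 : C) <= 1 by rewrite nr0.
have := sums_slice H1 Hw1 f w 0 Xw z1; rewrite scale0r => h.
apply: cvg_unique_nr h _; apply/cvg_nrP => e e0; exists 1%N => -[//|n] _.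
rewrite /psum big_ord_recl expr0 mulr1 big1 ?addr0 ?subrr ?nr0 // => i _.
by rewrite expr0n mulr0.
Qed.

Lemma ball_scale (w : 'rV[C]_d1) (z : C) : nr z <= 1 -> ball1 w -> ball1 (z *: w).
Proof.
move=> z1; apply: le_lt_trans; rewrite lee_fin euclidZ ler_piMl //; exact: euclid_ge0.
Qed.

Lemma decay_bounded (c : nat -> C) : geometric_decay c -> exists K, forall n, nr (c n) <= K.
Proof.
move=> [K [t [K0 t0 t1 h]]]; exists K => n; apply: le_trans (h n) _.
by rewrite ler_piMr // exprn_ile1 // ltW.
Qed.

Lemma small_le1 n : nr (small n : C) <= 1.
Proof. by apply: le_trans (nr_small_le n) _; lra. Qed.

Lemma value_small f w : ball1 w ->
  (fun m => value H1 f (small m *: w)) @ \oo --> value H1 f 0.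
Proof.
move=> bw; have Xw := ball_domain _ bw.
have [K hK] := decay_bounded _ (slice_decay H1 Hw1 f w bw).
rewrite (value0 f w Xw); apply: (sums_small0 _ _ K hK) => m.
exact: sums_slice (small_le1 m).
Qed.

Lemma lam_small w : ball1 w -> (fun m => lam (small m *: w)) @ \oo --> lam 0.
Proof.
move=> bw; have [f hf] := lamE; have := value_small f w bw.
rewrite hf; last exact: ball_domain zero_ball.
under eq_fun => m do rewrite (hf _ (ball_domain _ (ball_scale _ _ (small_le1 m) bw))).
exact.
Qed.

Section Coordinate.
Variable p : 'rV[C]_d2 -> C.
Hypothesis pp : polyfun p.
Let D w := p (Phi w) - p (Phi 0).

(** Along a complex line through [0], a nonconstant polynomial in [Phi] has a
    leading term, read off from the power series of [lam * D]. *)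
Lemma leading_term x : ball1 x -> p (Phi x) != p (Phi 0) ->
  exists k b, [/\ (0 < k)%N, b != 0 & forall z, ball1 (z *: x) ->
    (fun m => D (small m *: (z *: x)) / small m ^+ k) @ \oo --> z ^+ k * b].
Proof.
move=> bx px; have Xx := ball_domain _ bx.
have [f hf] := polyfun_comp _ (polyfunB _ _ pp (polyfun_cst (p (Phi 0)))).
have fx : value H1 f x != 0 by rewrite hf // mulf_neq0 ?lam_neq0 // subr_eq0.
pose c n := hom_part H1 f n x.
have ex : exists k, c k != 0.
  apply: contrapT => nc; move/eqP: fx; apply.
  have n1 : nr (1 : C) <= 1 by rewrite (nr_nat 1).
  have := sums_slice H1 Hw1 f x 1 Xx n1; rewrite scale1r => h.
  apply: cvg_unique_nr h _.
  have -> : psum (fun n => hom_part H1 f n x) 1 = cst (0 : C).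
    apply/funext => N; rewrite /psum big1 // => n _; rewrite expr1n mulr1.
    by apply: contrapT => cn; apply: nc; exists n; apply/eqP.
  exact: cvg_cst.
case: (ex_minnP ex) => k ck kmin.
have l0 := lam_neq0 0 (ball_domain _ zero_ball).
have k0 : (0 < k)%N.
  rewrite lt0n; apply: contraNneq ck => ->.
  by rewrite /c -value0 // hf ?subrr ?mulr0 //; exact: ball_domain zero_ball.
exists k, (c k / lam 0); split => //; first by rewrite mulf_neq0 ?invr_neq0.
move=> z bz; have Xz := ball_domain _ bz.
have [K hK] := decay_bounded _ (slice_decay H1 Hw1 f _ bz).
have := @leading_quotient _ k _ (fun m => value H1 f (small m *: (z *: x))) K hK.
move=> /(_ (fun m => sums_slice H1 Hw1 f _ _ Xz (small_le1 m))) => h.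
have low j : (j < k)%N -> hom_part H1 f j (z *: x) = 0.
  move=> jk; rewrite hom_partZ -/(c j); have [->|cj] := eqVneq (c j) 0; first by rewrite mulr0.
  by have := kmin j cj; rewrite leqNgt jk.
have {}h := h low.
have li : (fun m => (lam (small m *: (z *: x)))^-1) @ \oo --> (lam 0)^-1.
  exact: (cvg_invC _ _ l0 (lam_small _ bz)).
have := cvg_mulC _ _ _ _ h li; rewrite hom_partZ -/(c k) mulrA.
apply: cvg_trans; apply: near_eq_cvg; apply: nearW => m /=.
have Xm := ball_domain _ (ball_scale _ _ (small_le1 m) bz).
have lm := lam_neq0 _ Xm; rewrite hf // -/(D _).
by rewrite mulrAC [lam _ * _]mulrC mulfK.
Qed.

(** A Schwarz lemma: the functions [lam * D ^+ n] all lie in the space, have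
    leading coefficient [lam 0 * b ^+ n] and are at most [B ^+ n] times the
    values of [lam], so the Cauchy estimate and a passage to the limit bound
    [b]. *)
Lemma schwarz x k b (B : R) : ball1 x ->
  (fun m => D (small m *: x) / small m ^+ k) @ \oo --> b ->
  (forall w, X1 w -> nr (D w) <= B) -> nr b <= B.
Proof.
move=> bx Db DB; have Xx := ball_domain _ bx.
have l0 := lam_neq0 0 (ball_domain _ zero_ball).
have [f0 hf0] := lamE; set L := nr f0 * nr (kern H1 x).
have B0 : 0 <= B by apply: le_trans (nr_ge0 _) (DB x Xx).
have step n : nr (lam 0) * nr b ^+ n <= L * B ^+ n.
  have [f hf] := polyfun_comp _ (polyfunX _ n (polyfunB _ _ pp (polyfun_cst (p (Phi 0))))).
  have dc := slice_decay H1 Hw1 f _ bx; have [K hK] := decay_bounded _ dc.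
  have sm m := sums_slice H1 Hw1 f _ _ Xx (small_le1 m).
  have := @leading_coefficient _ (k * n)%N _ _
    (fun m => lam (small m *: x) * (D (small m *: x) / small m ^+ k) ^+ n) (lam 0 * b ^+ n) K hK sm.
  case.
  - move=> m; have Xm := ball_domain _ (ball_scale _ _ (small_le1 m) bx).
    rewrite hf // -/(D _) expr_div_n -exprM [RHS]mulrCA [X in _ = _ * X]mulrC divfK //.
    by rewrite expf_neq0 ?small_neq0.
  - exact: (cvg_mulC _ _ _ _ (lam_small x bx) (cvg_power _ _ n Db)).
  move=> low ck; rewrite -nrX -nrM -ck.
  apply: cauchy_estimate dc low _ => z z1; have z1' : nr z <= 1 by rewrite z1.
  exists (value H1 f (z *: x)); first exact: sums_slice.
  have Xz := domain_scale _ _ _ _ _ z1' Xx.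
  rewrite hf // nrM nrX; apply: ler_pM; rewrite ?exprn_ge0 ?nr_ge0 //.
    rewrite -hf0 //; apply: le_trans (value_le H1 _ _) _.
    by rewrite ler_wpM2l ?nr_ge0 // (kern_scale_le H1 Hw1).
  by rewrite lerXn2r ?nnegrE ?nr_ge0 ?DB.
rewrite leNgt; apply/negP => Bb; have b0 : 0 < nr b by exact: le_lt_trans Bb.
have q0 : 0 <= B / nr b by rewrite divr_ge0 // ltW.
have q1 : B / nr b < 1 by rewrite ltr_pdivrMr // mul1r.
have lp : 0 < nr (lam 0).
  by rewrite lt_neqAle nr_ge0 andbT eq_sym; apply/eqP => /nr_eq0/eqP; apply/negP.
have /cvgrPdist_lt/(_ _ lp) [M _ hM] := cvg_geometric0 L _ q0 q1.
have := hM M (leqnn M); rewrite /= sub0r normrN ltNge => /negP; apply.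
apply: le_trans (ler_norm _); rewrite expr_div_n mulrA ler_pdivlMr ?exprn_gt0 //.
Qed.

End Coordinate.


Lemma sum_pow_cvg (u : nat -> C) n : u @ \oo --> (1 : C) ->
  (fun m => \sum_(i < n) u m ^+ i) @ \oo --> (n%:R : C).
Proof.
move=> u1; elim: n => [|n IH].
  by under eq_fun do rewrite big_ord0; exact: cvg_cst.
under eq_fun do rewrite big_ord_recr /=; rewrite -natr1 -{2}(expr1n C n).
exact: (cvg_addC _ _ _ _ IH (cvg_power _ _ n u1)).
Qed.

Hypothesis d1_gt0 : (0 < d1)%N.

Lemma ball_neq0 : exists2 x : 'rV[C]_d1, ball1 x & x != 0.
Proof.
have [t [t0 tr]] : exists t : R, 0 < t /\ (t%:E < r1)%E.
  case: r1 r1_gt0 => [s||//]; last by exists 1; split=> //; rewrite ltry.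
  by rewrite lte_fin => s0; exists (s / 2); rewrite lte_fin; split; lra.
have [x xt] := vector_of_norm _ _ d1_gt0 (ltW t0); exists x; first by rewrite xt.
apply/eqP => x0; move: xt; rewrite x0 euclidE /sqn big1 ?sqrtr0 => [t00|i _].
  by rewrite t00 ltxx in t0.
by rewrite mxE nr0 expr0n.
Qed.

(** Maximum principle: if [Phi 0] lay on the boundary sphere, then
    [u = <Phi, Phi 0> / |Phi 0|^2] would satisfy [|u| <= 1 = u 0]; the leading
    coefficients [n b] of [u ^+ n - 1] stay bounded by the Schwarz lemma, so
    [u = 1] and [Phi] is constant. *)
Lemma Phi0_interior : ((euclidean_norm (Phi 0) : R)%:E < r2)%E.
Proof.
have X0 := ball_domain _ zero_ball.
have := domain_closed_ball _ _ _ _ (XPhi _ X0); rewrite le_eqVlt => /orP[/eqP e0|//].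
set y0 := Phi 0 in e0 *; set s := sqn y0.
have s0 : 0 < s.
  by rewrite /s -euclid_sqr exprn_gt0 // -lte_fin e0.
have max w : X1 w -> sqn (Phi w) <= s.
  move=> Xw; have := domain_closed_ball _ _ _ _ (XPhi _ Xw); rewrite -e0 lee_fin => h.
  by rewrite /s -!euclid_sqr lerXn2r ?nnegrE ?euclid_ge0.
pose inn (y : 'rV[C]_d2) : C := \sum_i Num.conj (y0 0 i) * y 0 i.
have dist y : sqn (y - y0) = sqn y + s - 2 * complex.Re (inn y).
  have Resum (F : 'I_d2 -> C) : complex.Re (\sum_i F i) = \sum_i complex.Re (F i).
    by elim/big_rec2: _ => [//|k y1 y2 _ <-]; rewrite ReD.
  rewrite /inn Resum /s /sqn mulr_sumr -big_split -sumrB /=; apply: eq_bigr => i _.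
  by rewrite !mxE !nr_sqrE; case: (y 0 i) => ? ?; case: (y0 0 i) => ? ? /=; ring.
have inn_le y : sqn y <= s -> nr (inn y) <= s.
  move=> ys; have [->|i0] := eqVneq (inn y) 0; first by rewrite nr0 ltW.
  have ni : 0 < nr (inn y).
    by rewrite lt_neqAle nr_ge0 andbT eq_sym; apply/eqP => /nr_eq0/eqP; apply/negP.
  (* Rotating [y] makes its pairing with [y0] positive. *)
  pose c : C := Num.conj (inn y) / (nr (inn y))%:C.
  have c1 : nr c = 1 by rewrite nrM nrV nrJ nr_real ger0_norm ?nr_ge0 // divff // gt_eqF.
  have ci : inn (c *: y) = (nr (inn y))%:C.
    rewrite /inn; under eq_bigr do rewrite mxE mulrCA; rewrite -mulr_sumr -/(inn y).
    rewrite /c mulrAC [_ * inn y]mulrC -nr_sqr rmorphXn /= expr2 mulfK //.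
    by rewrite eq_complex /= eqxx andbT gt_eqF.
  have := sqn_ge0 _ (c *: y - y0); rewrite dist sqnZ c1 expr1n mul1r ci /=; lra.
pose u y := (s^-1)%:C * inn y.
have pu : polyfun u.
  apply: polyfunM; first exact: polyfun_cst.
  by apply: polyfun_sum => i; apply: polyfunM; [exact: polyfun_cst | exact: polyfun_coord].
have u0 : u y0 = 1.
  have iy0 : inn y0 = s%:C.
    by rewrite /inn /s -cdotE /cdot; apply: eq_bigr => i _; rewrite mulrC.
  by rewrite /u iy0 -rmorphM /= mulVf ?gt_eqF.
have u1 y : X1 y -> nr (u (Phi y)) <= 1.
  move=> Xy; rewrite /u nrM nr_real ger0_norm ?invr_ge0 ?(ltW s0) // mulrC.
  by rewrite ler_pdivrMr // mul1r inn_le // max.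
have ucst x : ball1 x -> u (Phi x) = 1.
  move=> bx; apply: contrapT => /eqP; rewrite -u0 => nu.
  have [k [b [k0 b0 lead]]] := leading_term u pu x bx nu.
  have {lead} := lead 1; rewrite scale1r expr1n mul1r => /(_ bx); rewrite -/y0 u0 => lead.
  have us : (fun m => u (Phi (small m *: x))) @ \oo --> (1 : C).
    have := cvg_addC _ _ _ _ (cvg_mulC _ _ _ _ lead (cvg_power _ _ k cvg_small)) (cvg_cst (1 : C)).
    rewrite expr0n (gtn_eqF k0) mulr0 add0r => /(_ _); apply: cvg_trans.
    apply: near_eq_cvg; apply: nearW => m /=.
    by rewrite divfK ?subrK // expf_neq0 // small_neq0.
  have nb n : n%:R * nr b <= 2.
    rewrite mulrC -[n%:R](nr_nat (R := R)) -nrM.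
    apply: (schwarz (fun y => u y ^+ n) (polyfunX _ n pu) x k _ 2 bx).
      have := cvg_mulC _ _ _ _ lead (sum_pow_cvg _ n us); apply: cvg_trans.
      apply: near_eq_cvg; apply: nearW => m /=.
      by rewrite -/y0 u0 expr1n subrX1 mulrAC.
    move=> w Xw; apply: le_trans (nrD _ _) _; rewrite nrN !nrX -/y0 u0 (nr_nat 1) expr1n.
    rewrite -[2]/(1 + 1) lerD2r exprn_ile1 ?nr_ge0 // u1 //.
  have bp : 0 < nr b.
    by rewrite lt_neqAle nr_ge0 andbT eq_sym; apply/eqP => /nr_eq0/eqP; apply/negP.
  have := nb (Num.truncn (2 / nr b)).+1; rewrite leNgt -ltr_pdivrMr //.
  by rewrite truncnS_gt.
exfalso; have [x bx x0] := ball_neq0; move/eqP: x0; apply.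
apply: Phi_inj; [exact: ball_domain | exact: X0|].
apply/eqP; rewrite -subr_eq0; apply/eqP/sqn_eq0/le_anti; rewrite sqn_ge0 andbT.
rewrite dist; have := max x (ball_domain _ bx).
have : s * complex.Re (u (Phi x)) = complex.Re (inn (Phi x)).
  by rewrite /u ReZ mulVKf // gt_eqF.
rewrite ucst //=; lra.
Qed.

(** Liouville: if [Phi] were bounded on the whole space, the Schwarz lemma on
    balls of radius [rho] would bound [rho ^+ k * b] independently of [rho]. *)
Lemma infinite_radius : r1 = +oo%E -> r2 = +oo%E.
Proof.
move=> r1oo; apply: contrapT => r2oo.
have bw (w : 'rV[C]_d1) : ball1 w by rewrite r1oo ltry.
have [s r2s] : exists s, r2 = s%:E.
  by case: r2 r2_gt0 r2oo => [s _ _|//|//]; exists s.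
have [x bx x0] := ball_neq0.
have [i hi] : exists i, Phi x 0 i != Phi 0 0 i.
  apply: contrapT => ni; move/eqP: x0; apply.
  apply: Phi_inj; [exact: ball_domain | exact: ball_domain |].
  by apply/rowP => i; apply: contrapT => hi; apply: ni; exists i; apply/eqP.
have coord w : X1 w -> nr (Phi w 0 i) <= s.
  move=> Xw; apply: le_trans (nr_coord_le _ _ i) _; rewrite -lee_fin -r2s.
  exact: domain_closed_ball (XPhi _ Xw).
have [k [b [k0 b0 lead]]] := leading_term _ (polyfun_coord i) x bx hi.
have bp : 0 < nr b.
  by rewrite lt_neqAle nr_ge0 andbT eq_sym; apply/eqP => /nr_eq0/eqP; apply/negP.
have s0 : 0 <= s by apply: le_trans (coord x (ball_domain _ bx)); exact: nr_ge0.
pose rho := 2 * s / nr b + 1.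
have rho1 : 1 <= rho by rewrite lerDr divr_ge0 ?mulr_ge0 ?nr_ge0.
have := schwarz _ (polyfun_coord i) (rho%:C *: x) k _ (2 * s) (bw _) (lead _ (bw _)).
have bd w : X1 w -> nr (Phi w 0 i - Phi 0 0 i) <= 2 * s.
  move=> Xw; apply: le_trans (nrD _ _) _; rewrite nrN.
  have := coord w Xw; have := coord 0 (ball_domain _ zero_ball); lra.
move=> /(_ bd); rewrite nrM nrX nr_real ger0_norm ?(le_trans ler01) // => h.
have : rho * nr b <= 2 * s.
  apply: le_trans h; rewrite ler_pM2r //.
  by rewrite -[leLHS]expr1; apply: ler_weXn2l.
rewrite /rho mulrDl divfK ?gt_eqF // mul1r; lra.
Qed.

End Relation.

(** * Compactness in complex coordinate space *)

Section ComplexTopology.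
Context {R : realType}.
Local Notation C := R[i].

Lemma nbhs_nr (V : normedModType C) (x : V) (P : set V) :
  nbhs x P <-> exists2 e : R, 0 < e & forall y, nr (y - x) < e -> P y.
Proof.
split => [/nbhs_ballP [e e0 eP]|[e e0 eP]].
  move: e0; rewrite /= ltcE /= => /andP[/eqP ie e0]; exists (complex.Re e) => // y yx.
  apply: eP; rewrite -ball_normE /= nrE nrB ltcE /= ie eqxx /=; exact: yx.
apply/nbhs_ballP; exists e%:C; first by rewrite /= ltcR.
move=> y; rewrite -ball_normE /= nrE nrB ltcR; exact: eP.
Qed.

Lemma nr_continuous (V : normedModType C) : continuous (@nr R V).
Proof.
move=> x; apply/cvgrPdist_lt => e e0; apply/nbhs_nr; exists e => // y yx.
apply: le_lt_trans yx; rewrite ler_norml.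
have := nrD (y - x) x; have := nrD (x - y) y; rewrite !subrK (nrB x y); lra.
Qed.

Lemma affine_cvg (c b : C) : (fun h : C => h * c + b) @ nbhs (0 : C) --> b.
Proof.
have c1 : 0 < nr c + 1 by rewrite ltr_wpDl ?nr_ge0.
move=> P /nbhs_nr [e e0 eP]; apply/nbhs_nr; exists (e / (nr c + 1)).
  by rewrite divr_gt0.
move=> h; rewrite subr0 ltr_pdivlMr // => hh; apply: eP.
by rewrite addrK nrM; apply: le_lt_trans hh; rewrite ler_wpM2l ?nr_ge0 // lerDl.
Qed.

Lemma compact_box (M : R) :
  compact [set z : C | `|complex.Re z| <= M /\ `|complex.Im z| <= M].
Proof.
pose f (x : R * R) : C := Complex x.1 x.2.
have -> : [set z : C | `|complex.Re z| <= M /\ `|complex.Im z| <= M]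
    = f @` (`[-M, M] `*` `[-M, M]).
  apply/seteqP; split => [[x y] /= [xM yM]|_ [[x y] /= [xM yM] <-]].
    by exists (x, y) => //=; rewrite !in_itv /= -!ler_norml.
  by move: xM yM; rewrite !in_itv /= -!ler_norml.
apply: continuous_compact; last by apply: compact_setX; exact: segment_compact.
apply: continuous_subspaceT => -[x y] P /nbhs_nr [e e0 eP].
have e2 : 0 < e / 2 by lra.
exists (ball x (e / 2), ball y (e / 2)); first by split; exact: nbhsx_ballx.
move=> [x' y'] /= [bx by']; apply: eP.
apply: le_lt_trans (nr_le_ReIm _) _ => /=.
by move: bx by'; rewrite -ball_normE /= distrC [`|y - y'|]distrC; lra.
Qed.

Context {d : nat}.
Implicit Types w x : 'rV[C]_d.

Lemma nbhs_coord x (P : set 'rV[C]_d) :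
  nbhs x P <-> exists2 e : R, 0 < e & forall y : 'rV[C]_d, (forall i, nr (y 0 i - x 0 i : C) < e) -> P y.
Proof.
split => [/nbhs_ballP [e e0 eP]|[e e0 eP]].
  move: (e0); rewrite /= ltcE /= => /andP[/eqP ie e0']; exists (complex.Re e) => // y yx.
  apply: eP; split => // i j; rewrite ord1 -ball_normE /= nrE nrB ltcE /= ie eqxx /=; exact: yx.
apply/nbhs_ballP; exists e%:C; first by rewrite /= ltcR.
move=> y [_ b]; apply: eP => i.
by have := b 0 i; rewrite -ball_normE /= nrE nrB ltcR.
Qed.

Lemma coord_cont i : continuous (fun w : 'rV[C]_d => w 0 i).
Proof. exact: coord_continuous. Qed.

Lemma sqn_cvg (T : Type) (F : set_system T) {FF : Filter F} (f : T -> 'rV[C]_d) x :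
  (forall i, (fun t => f t 0 i) @ F --> x 0 i) -> (fun t => sqn (f t)) @ F --> sqn x.
Proof.
move=> h; rewrite /sqn; elim: (index_enum _) => [|i s IH].
  by under eq_fun do rewrite big_nil; rewrite big_nil; exact: cvg_cst.
under eq_fun do rewrite big_cons; rewrite big_cons.
apply: cvgD => //; under eq_fun do rewrite expr2; rewrite expr2.
have k : (fun t => nr (f t 0 i : C)) @ F --> nr (x 0 i : C).
  by apply: continuous_cvg; [exact: nr_continuous | exact: h].
by apply: cvgM.
Qed.

Lemma euclid_cvg (T : Type) (F : set_system T) {FF : Filter F} (f : T -> 'rV[C]_d) x :
  (forall i, (fun t => f t 0 i) @ F --> x 0 i) ->
  (fun t => euclidean_norm (f t)) @ F --> (euclidean_norm x : R).
Proof.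
move=> h; under eq_fun do rewrite euclidE; rewrite euclidE.
apply: continuous_cvg; [exact: sqrt_continuous | exact: sqn_cvg].
Qed.

Lemma euclid_continuous : continuous (fun w : 'rV[C]_d => euclidean_norm w : R).
Proof. by move=> w; apply: (@euclid_cvg _ (nbhs w) (nbhs_filter w) id w) => i; exact: coord_cont. Qed.

(** A closed subset of a product of squares. *)
Lemma compact_closed_ball (s : R) : compact [set w : 'rV[C]_d | euclidean_norm w <= s].
Proof.
apply: (@subclosed_compact _ _ [set v : 'rV[C]_d | forall i,
  [set z : C | `|complex.Re z| <= s /\ `|complex.Im z| <= s] (v ord0 i)]).
- rewrite (_ : mkset _ = (fun w : 'rV[C]_d => euclidean_norm w : R) @^-1` [set t | t <= s]) //.
  by apply: preimage_closed; [move=> w _; exact: euclid_continuous | exact: closed_le].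
- by apply: (@rV_compact _ d (fun=> [set z : C | `|complex.Re z| <= s /\ `|complex.Im z| <= s])) => i; exact: compact_box.
- move=> w /= ws i; have h := le_trans (nr_coord_le _ w i) ws.
  have := Re_le_nr (w 0 i); have := ReN_le_nr (w 0 i).
  have := Re_le_nr (- 'i%C * w 0 i); have := ReN_le_nr (- 'i%C * w 0 i).
  have ii : nr ('i%C : C) = 1 by rewrite /nr normc_def /= expr0n expr1n add0r sqrtr1.
  rewrite nrM nrN ii mul1r mulNr ReN mulrC ReiNIm opprK.
  by move=> *; split; rewrite ler_norml; apply/andP; split; lra.
Qed.

Lemma compact_sphere (s : R) : compact [set w : 'rV[C]_d | euclidean_norm w = s].
Proof.
apply: (@subclosed_compact _ _ [set w : 'rV[C]_d | euclidean_norm w <= s]).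
- rewrite (_ : mkset _ = (fun w : 'rV[C]_d => euclidean_norm w : R) @^-1` [set t | t = s]) //.
  by apply: preimage_closed; [move=> w _; exact: euclid_continuous | exact: closed_eq].
- exact: compact_closed_ball.
- by move=> w /= ->.
Qed.

End ComplexTopology.

(** * The differential of the symbol and local surjectivity *)

Section LocalSurjectivity.
Context {R : realType} {d1 d2 : nat} {a1 a2 : nat -> R} {r1 r2 : \bar R}.
Context {H1 : hilbert_function_space R (maximal_domain d1 a1 r1)}.
Context {H2 : hilbert_function_space R (maximal_domain d2 a2 r2)}.
Local Notation C := R[i].
Local Notation X1 := (maximal_domain d1 a1 r1).
Local Notation X2 := (maximal_domain d2 a2 r2).
Local Notation ball1 w := ((euclidean_norm w)%:E < r1)%E.
Local Notation ball2 w := ((euclidean_norm w)%:E < r2)%E.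

Lemma holomorphic_extension {d a r} (H : hilbert_function_space R (maximal_domain d a r)) :
  weighted_hardy_space H -> forall f : H, exists F : 'rV[C]_d -> C,
    [/\ forall w, maximal_domain d a r w -> F w = value H f w,
        forall w, ((euclidean_norm w)%:E < r)%E -> differentiable F w &
        {within maximal_domain d a r, continuous F}].
Proof.
case=> _ hol _ _ f; have [F [FE Fd Fc]] := hol f; exists F; split => // w Xw.
by rewrite -[w]/(val (pt w Xw)) FE valueE.
Qed.

Lemma open_ball_near {d} (r : \bar R) (x : 'rV[C]_d) : ((euclidean_norm x)%:E < r)%E ->
  \forall w \near x, ((euclidean_norm w)%:E < r)%E.
Proof.
case: r => [s||//] h; last by apply: (@nearW _ (nbhs x) _ (nbhs_filter x)) => w; rewrite ltry.
rewrite lte_fin in h; have := euclid_continuous x.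
move=> /cvgrPdist_lt /(_ (s - euclidean_norm x)); rewrite subr_gt0 => /(_ h).
apply: (@filterS _ (nbhs x) (nbhs_filter x)) => w; rewrite lte_fin.
have := ler_norm (euclidean_norm w - euclidean_norm x : R); rewrite distrC; lra.
Qed.

Context {lam : 'rV[C]_d1 -> C} {Phi : 'rV[C]_d1 -> 'rV[C]_d2} {W : {linear H2 -> H1}}.
Hypotheses (Hw1 : weighted_hardy_space H1) (Hw2 : weighted_hardy_space H2).
Hypothesis hW : intertwines lam Phi W.
Hypotheses (r1_gt0 : (0 < r1)%E) (r2_gt0 : (0 < r2)%E).

Let lamn0 := lam_neq0 Hw1 hW.

(** The coordinates of [Phi] are the quotients of the images of the coordinate
    functions by the image of the constant 1, hence as regular as the functions
    of the space. *)
Lemma Phi_extension : exists P : 'rV[C]_d1 -> 'rV[C]_d2,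
  [/\ forall w, X1 w -> P w = Phi w,
      forall w, ball1 w -> differentiable P w &
      forall i w, X1 w -> (fun t => P t 0 i) @ within X1 (nbhs w) --> P w 0 i].
Proof.
have [f0 hf0] := lamE Hw2 hW; have [F0 [F0E F0d F0c]] := holomorphic_extension H1 Hw1 f0.
have exG i : exists G : 'rV[C]_d1 -> C,
    [/\ forall w, X1 w -> G w = lam w * Phi w 0 i,
        forall w, ball1 w -> differentiable G w & {within X1, continuous G}].
  have [f hf] := polyfun_comp Hw2 hW _ (polyfun_coord i).
  have [G [GE Gd Gc]] := holomorphic_extension H1 Hw1 f.
  by exists G; split => // w Xw; rewrite GE // hf.
pose G i := projT1 (cid (exG i)).
have GP i : [/\ forall w, X1 w -> G i w = lam w * Phi w 0 i,
    forall w, ball1 w -> differentiable (G i) w & {within X1, continuous (G i)}].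
  by rewrite /G; case: cid.
have GE i w : X1 w -> G i w = lam w * Phi w 0 i by case: (GP i) => h _ _; exact: h.
have Gd i w : ball1 w -> differentiable (G i) w by case: (GP i) => _ h _; exact: h.
have Gc i : {within X1, continuous (G i)} by case: (GP i).
have F0n w : X1 w -> F0 w != 0 by move=> Xw; rewrite F0E // hf0 //; exact: lamn0.
pose P : 'rV[C]_d1 -> 'rV[C]_d2 :=
  \sum_(i < d2) (fun t => ((G i * (fun s => (F0 s)^-1)) t) *: (delta_mx 0 i : 'rV[C]_d2)).
have Pc w i : P w 0 i = G i w / F0 w.
  rewrite /P fct_sumE summxE (bigD1 i) //= big1 ?addr0 => [|j ji].
    by rewrite !mxE !eqxx mulr1.
  by rewrite !mxE eq_sym (negbTE ji) andbF mulr0.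
exists P; split.
- move=> w Xw; apply/rowP => i.
  by rewrite Pc GE // F0E // hf0 // mulrAC mulfV ?mul1r //; exact: lamn0.
- move=> w bw; apply: differentiable_sum => i; apply: differentiableZl.
  apply: differentiableM; first exact: Gd.
  by apply: differentiableV; [exact: F0d | exact: F0n (ball_domain _ bw)].
- move=> i w Xw; rewrite Pc; under eq_fun do rewrite Pc.
  have h1 := iffLR (subspace_continuousP _ _) (Gc i) w Xw.
  have h0 := iffLR (subspace_continuousP _ _) F0c w Xw.
  apply: cvgM; first exact: h1.
  by apply: cvgV; [exact: F0n | exact: h0].
Qed.

Section Differential.
Variables (P : 'rV[C]_d1 -> 'rV[C]_d2) (x : 'rV[C]_d1).
Hypothesis PE : forall w, X1 w -> P w = Phi w.
Hypothesis Pd : forall w, ball1 w -> differentiable P w.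
Hypotheses (bx : ball1 x) (b2 : ball2 (P x)).

(** If the differential kills [v], then by the chain rule the derivative along
    [v] is a multiple of the evaluation at [x] on the range of [W], that is on
    the whole space; on the constants and the coordinates this forces [v = 0]. *)
Lemma differential_injective v : 'd P x v = 0 -> v = 0.
Proof.
move=> dPv; have Xx : X1 x by exact: ball_domain bx.
have nearX : \forall w \near x, X1 w.
  by apply: (@filterS _ (nbhs x) (nbhs_filter x)) (open_ball_near _ _ bx) => w; exact: ball_domain.
have [f0 hf0] := lamE Hw2 hW; have [F0 [F0E F0d _]] := holomorphic_extension H1 Hw1 f0.
pose kap := 'd F0 x v / lam x.
have key (f : H1) (F : 'rV[C]_d1 -> C) : (forall w, X1 w -> F w = value H1 f w) ->
    'D_v F x = kap * value H1 f x.
  move=> FE; have [g fg] := W_onto hW f.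
  have [Gg [GE Gd _]] := holomorphic_extension H2 Hw2 g.
  have X2P w : X1 w -> X2 (P w) by move=> Xw; rewrite PE //; case: hW => h _ _ _; exact: h.
  have FG w : X1 w -> F w = (F0 * (Gg \o P)) w.
    move=> Xw; rewrite FE // fg; case: hW => _ -> // _ _.
    by rewrite [RHS]/(F0 w * Gg (P w)) F0E // hf0 // GE ?PE // -PE //; exact: X2P.
  rewrite (near_eq_derive (g := F0 * (Gg \o P))); last by apply: (@filterS _ (nbhs x) (nbhs_filter x)) nearX.
  have dGP : differentiable (Gg \o P) x.
    by apply: differentiable_comp; [exact: Pd | exact: Gd].
  rewrite deriveE; last by apply: differentiableM => //; exact: F0d.
  have e : 'd (Gg \o P) x v = 0.
    have dc := diff_comp (Pd _ bx) (Gd _ b2).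
    by rewrite (congr1 (fun h => h v) dc) /= dPv linear0.
  have D : 'd (F0 * (Gg \o P)) x v
      = F0 x * 'd (Gg \o P) x v + (Gg \o P) x * 'd F0 x v.
    exact: (congr1 (fun h => h v) (diffM (F0d _ bx) dGP)).
  have FGx : value H1 f x = lam x * Gg (P x).
    by rewrite -(FE _ Xx) (FG _ Xx) -(hf0 _ Xx) -(F0E _ Xx).
  rewrite FGx; apply: (etrans D); move: e (lamn0 _ Xx); rewrite /kap.
  generalize ('d (Gg \o P) x v); generalize ('d F0 x v) => dv ? -> l0.
  rewrite mulr0 add0r mulrA divfK //; exact: mulrC.
have [f1 hf1] := polyfun_value H1 Hw1 _ (polyfun_cst 1).
have k0 : kap = 0.
  have := key f1 (cst 1) (fun w Xw => esym (hf1 w Xw)).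
  by rewrite derive_cst hf1 // mulr1.
apply/rowP => i; have [fi hfi] := polyfun_value H1 Hw1 _ (polyfun_coord i).
have := key fi (fun w => w 0 i) (fun w Xw => esym (hfi w Xw)).
rewrite k0 mul0r deriveE; last exact: differentiable_coord.
have @li : {linear 'rV[C]_d1 -> C}.
  by exists (fun N : 'rV[C]_d1 => N 0 i); do 2![eexists]; do ?[constructor];
     rewrite ?mxE// => ? *; rewrite ?mxE//; move=> ?; rewrite !mxE.
rewrite (_ : (fun _ => _) = li) // diff_lin; last exact: coord_continuous.
by rewrite mxE => h; exact: h.
Qed.

Lemma dimension_le : (d1 <= d2)%N.
Proof.
pose A := lin1_mx ('d P x).
have fA : row_free A.
  rewrite -kermx_eq0; apply/rowV0P => v /sub_kermxP vA.
  by apply: differential_injective; rewrite -mul_rV_lin1.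
by move: fA; rewrite /row_free => /eqP <-; exact: rank_leq_col.
Qed.

Lemma differential_surjective : d1 = d2 -> forall y, exists v, 'd P x v = y.
Proof.
move=> dd y; pose A := lin1_mx ('d P x).
have fA : row_free A.
  rewrite -kermx_eq0; apply/rowV0P => v /sub_kermxP vA.
  by apply: differential_injective; rewrite -mul_rV_lin1.
have fu : row_full A by rewrite /row_full (eqP fA) dd.
have /row_fullP [B BA] := fu; exists (y *m B).
by rewrite -mul_rV_lin1 -/A -mulmxA BA mulmx1.
Qed.

End Differential.

Hypothesis d1_gt0 : (0 < d1)%N.

Lemma dimension_le_of_intertwining : (d1 <= d2)%N.
Proof.
have [P [PE Pd _]] := Phi_extension; have b0 : ball1 (0 : 'rV[C]_d1) by exact: zero_ball.
have X0 : X1 0 by exact: ball_domain b0.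
apply: (dimension_le P 0 PE Pd b0).
by rewrite PE //; exact: (Phi0_interior Hw1 Hw2 hW).
Qed.

Hypothesis d2d1 : (d2 <= d1)%N.

Lemma dimensions_eq : d1 = d2.
Proof. by apply/eqP; rewrite eqn_leq d2d1 dimension_le_of_intertwining. Qed.

(** The image of [Phi] contains a neighbourhood of [Phi 0]: for [y] near
    [Phi 0] the distance from [y] to [Phi w] has a minimiser over a small closed
    ball; it is not on the sphere, where [Phi] stays away from [Phi 0] by
    injectivity, and at an interior minimiser the distance is zero, since the
    differential is onto. *)
Lemma local_surjectivity : exists2 e : R, 0 < e &
  forall y : 'rV[C]_d2, (forall i, nr (y 0 i - Phi 0 0 i : C) < e) ->
    exists2 w, X1 w & Phi w = y.
Proof.
have dd := dimensions_eq.
have [P [PE Pd _]] := Phi_extension; have b0 : ball1 (0 : 'rV[C]_d1) by exact: zero_ball.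
have X0 : X1 0 by exact: ball_domain b0.
have P0 : P 0 = Phi 0 by exact: PE.
have b20 : ball2 (P 0) by rewrite P0; exact: (Phi0_interior Hw1 Hw2 hW).
have Pc w : ball1 w -> {for w, continuous P}.
  by move=> bw; exact: differentiable_continuous (Pd w bw).
have [e e0 eP] : exists2 e : R, 0 < e & forall w : 'rV[C]_d1, euclidean_norm w <= e ->
    ball1 w /\ ball2 (P w).
  have n1 := open_ball_near _ _ b0.
  have n2 := Pc 0 b0 _ (open_ball_near _ _ b20).
  have /nbhs_coord [e e0 eP] := @filterI _ (nbhs (0 : 'rV[C]_d1)) (nbhs_filter _) _ _ n1 n2.
  exists (e / 2); first by lra.
  move=> w we; apply: eP => i; rewrite mxE subr0.
  by have := nr_coord_le _ w i; lra.
pose f y w : R := nr (P w - y).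
have fc y (A : set 'rV[C]_d1) : (forall w, A w -> euclidean_norm w <= e) ->
    {within A, continuous (f y)}.
  move=> Ae; apply/subspace_continuousP => w Aw; apply: cvg_within_filter.
  have [bw _] := eP w (Ae w Aw).
  have h : (fun w => P w - y) @ w --> (P w - y).
    have nF := nbhs_filter w; apply: (@cvgB _ _ _ (nbhs w) nF P (cst y)).
      exact: (Pc w bw).
    exact: (@cvg_cst _ _ _ (nbhs w) nF).
  by apply: (@continuous_cvg _ _ _ (nbhs w) (nbhs_filter w) _ _ _ _ h); exact: nr_continuous.
have [m m0 mP] : exists2 m : R, 0 < m & forall w, euclidean_norm w = e -> m <= f (P 0) w.
  pose S := [set w : 'rV[C]_d1 | euclidean_norm w = e].
  have [S0|/set0P/negP/negPn/eqP S0] := pselect (S !=set0); last first.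
    by exists 1 => // w we; have : S w by []; rewrite S0.
  have Se w : S w -> euclidean_norm w <= e by move=> ->.
  have [w wS wmin] := compact_EVT_min S0 (compact_sphere e) (fc (P 0) S Se).
  exists (f (P 0) w); last by move=> w' w'S; apply: wmin; exact: mem_set.
  have we : euclidean_norm w = e by exact: set_mem wS.
  rewrite lt_neqAle nr_ge0 andbT eq_sym; apply/eqP => /nr_eq0/eqP.
  have Xw : X1 w by apply: ball_domain; case: (eP w) => //; rewrite we.
  rewrite subr_eq0 PE // P0 => /eqP /(Phi_inj Hw1 hW _ _ Xw X0) w0.
  by move: e0; rewrite -we w0 euclidE /sqn big1 ?sqrtr0 ?ltxx // => i _; rewrite mxE nr0 expr0n.
have /nbhs_coord [e' e'0 e'P] : nbhs (P 0) [set y | nr (y - P 0) < m / 2].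
  by apply/nbhs_nr; exists (m / 2) => //; lra.
exists e' => // y /=; rewrite -P0 => /e'P /= yP.
pose B := [set w : 'rV[C]_d1 | euclidean_norm w <= e].
have B00 : B 0.
  by rewrite /B /= euclidE /sqn big1 ?sqrtr0 ?(ltW e0) // => i _; rewrite mxE nr0 expr0n.
have B0 : B !=set0 by exists 0.
have [w wB wmin] := compact_EVT_min B0 (compact_closed_ball e) (fc y B (fun _ h => h)).
have {}wB : B w by exact: set_mem.
have [bw b2w] := eP w wB; have Xw : X1 w by exact: ball_domain.
exists w => //; rewrite -PE //; apply/eqP; rewrite -subr_eq0; apply/eqP/nr_eq0.
apply: contrapT => /eqP n0.
have n0' : 0 < nr (P w - y) by rewrite lt_neqAle nr_ge0 andbT eq_sym.
have we : euclidean_norm w < e.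
  rewrite lt_neqAle wB andbT; apply/eqP => /mP; rewrite /f.
  have := wmin 0 (mem_set B00); rewrite /f => h1.
  have := nrD (P w - y) (y - P 0); rewrite addrA subrK (nrB (P 0)) in h1 *; lra.
have [v dv] := differential_surjective P w PE Pd bw b2w dd (y - P w).
(* Moving from [w] in the direction [v] decreases the distance to first order. *)
have vD : 'D_v P w = y - P w by rewrite deriveE //; exact: Pd.
have der : (fun h : C => h^-1 *: (P (h *: v + w) - P w)) @ 0^' --> (y - P w).
  by rewrite -vD; exact: diff_derivable (Pd w bw).
have [t [t0 t1 tw tP]] : exists t : R, [/\ 0 < t, t <= 1,
    euclidean_norm (t%:C *: v + w) <= e &
    nr ((t%:C)^-1 *: (P (t%:C *: v + w) - P w) - (y - P w)) < nr (P w - y)].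
  have A1 : \forall h \near (0 : C), nr (h : C) < 1.
    by apply/nbhs_nr; exists 1 => // h; rewrite subr0.
  have A2 : \forall h \near (0 : C), euclidean_norm (h *: v + w) < e.
    have nF := nbhs_filter (0 : C).
    have c : (fun h : C => euclidean_norm (h *: v + w)) @ nbhs (0 : C) --> (euclidean_norm w : R).
      apply: (@euclid_cvg R d1 C (nbhs (0 : C)) nF (fun h : C => h *: v + w) w) => i.
      have -> : (fun h : C => (h *: v + w) 0 i) = (fun h : C => h * v 0 i + w 0 i).
        by apply/funext => h; rewrite !mxE.
      exact: affine_cvg.
    have := iffLR (@cvgrPdist_lt _ _ _ (nbhs (0 : C)) nF _ _) c (e - euclidean_norm w).
    rewrite subr_gt0 => /(_ we); apply: (@filterS _ (nbhs (0 : C)) nF) => h.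
    have := ler_norm (euclidean_norm (h *: v + w) - euclidean_norm w : R).
    by rewrite distrC; lra.
  have nb : nbhs (y - P w) [set z | nr (z - (y - P w)) < nr (P w - y)].
    by apply/nbhs_nr; exists (nr (P w - y)).
  have A3 := der _ nb.
  have /nbhs_nr [t t0 tP] : nbhs (0 : C) [set h | (h != 0 ->
      nr (h^-1 *: (P (h *: v + w) - P w) - (y - P w)) < nr (P w - y)) /\
      (nr (h : C) < 1 /\ euclidean_norm (h *: v + w) < e)].
    have nF := nbhs_filter (0 : C).
    exact: (@filterI _ (nbhs (0 : C)) nF _ _ A3 (@filterI _ (nbhs (0 : C)) nF _ _ A1 A2)).
  have nt : nr ((t / 2)%:C - 0 : C) < t by rewrite subr0 nr_real ger0_norm; lra.
  have [h1 [h2 h3]] := tP _ nt; exists (t / 2); split.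
  - by lra.
  - by move: h2; rewrite nr_real ger0_norm; lra.
  - exact: ltW.
  - by apply: h1; rewrite eq_complex /= eqxx andbT gt_eqF //; lra.
have tn : (t%:C : C) != 0 by rewrite eq_complex /= eqxx andbT gt_eqF.
have := wmin _ (mem_set tw); rewrite /f.
have -> : P (t%:C *: v + w) - y = (1 - t)%:C *: (P w - y)
    + t%:C *: ((t%:C)^-1 *: (P (t%:C *: v + w) - P w) - (y - P w)).
  set D := _ - (y - P w).
  have bE : P (t%:C *: v + w) - P w = t%:C *: (D + (y - P w)).
    by rewrite /D subrK scalerA mulfV // scale1r.
  rewrite -[LHS](subrKA (P w)) bE scalerDr -(opprB (P w) y) scalerN.
  move: (P w - y) => E; rewrite rmorphB rmorph1 scalerBl scale1r [RHS]addrC -!addrA; congr (_ + _).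
  exact: addrC.
move: tP; set D := _ - (y - P w) => tP.
rewrite leNgt => /negP; apply; apply: le_lt_trans (nrD _ _) _.
rewrite !nrZ !nr_real ger0_norm ?subr_ge0 // ger0_norm ?(ltW t0) //.
nra.
Qed.

End LocalSurjectivity.

(** * The identity principle for products *)

Section Identity.
Context {R : realType} {d : nat} {a : nat -> R} {r : \bar R}.
Context {H : hilbert_function_space R (maximal_domain d a r)}.
Local Notation C := R[i].
Local Notation X := (maximal_domain d a r).
Local Notation ball w := ((euclidean_norm w)%:E < r)%E.
Hypotheses (Hw : weighted_hardy_space H) (r_gt0 : (0 < r)%E).

Definition below1 (n : nat) : R := 1 - n.+2%:R^-1.

Lemma below1_bounds n : 0 < below1 n < 1.
Proof.
have h : 0 < n.+2%:R^-1 :> R by rewrite invr_gt0.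
have h' : n.+2%:R^-1 <= 2^-1 :> R by rewrite lef_pV2 ?posrE ?ltr0n // ler_nat.
by rewrite /below1; move: (n.+2%:R^-1 : R) h h' => u h h'; apply/andP; split; lra.
Qed.

Lemma below1_inj : injective below1.
Proof. by move=> m n /addrI/oppr_inj/invr_inj/eqP; rewrite eqr_nat => /eqP []. Qed.

Lemma ball_below1 y n : X y -> ball ((below1 n)%:C *: y).
Proof.
move=> /domain_closed_ball Xy; case/andP: (below1_bounds n) => t0 t1.
rewrite euclidZ nr_real ger0_norm ?(ltW t0) //.
have [->|y0] := eqVneq (euclidean_norm y) 0; first by rewrite mulr0.
have yp : 0 < euclidean_norm y by rewrite lt_neqAle eq_sym y0 euclid_ge0.
by apply: lt_le_trans Xy; rewrite lte_fin gtr_pMl.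
Qed.

(** Boundary points are reached radially, by continuity on the whole domain. *)
Lemma value_below1 (f : H) y : X y ->
  (fun n => value H f ((below1 n)%:C *: y)) @ \oo --> (value H f y : C).
Proof.
move=> Xy; have [F [FE _ Fc]] := holomorphic_extension H Hw f.
have h : F @ within X (nbhs y) --> (value H f y : C).
  by rewrite -FE //; exact: (iffLR (subspace_continuousP _ _) Fc y Xy).
apply/cvg_nrP => e e0.
have nb : nbhs (value H f y : C) [set z | nr (z - value H f y) < e].
  by apply/nbhs_nr; exists e.
have /nbhs_coord [e' e'0 eP] := h _ nb.
have K0 : 0 < euclidean_norm y + 1 :> R by rewrite ltr_wpDl // euclid_ge0.
have [N hN] := inv_succ_lt _ (divr_gt0 e'0 K0).
exists N => n Nn.
have Xt := domain_open_ball _ a _ _ (ball_below1 y n Xy).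
have := eP ((below1 n)%:C *: y); rewrite /= FE //; apply => // i.
rewrite mxE -[X in _ - X]mul1r -mulrBl nrM -(rmorph1 (real_complex R)) -rmorphB nr_real.
rewrite /below1 addrAC subrr add0r normrN ger0_norm ?invr_ge0 //.
have h1 : n.+2%:R^-1 < e' / (euclidean_norm y + 1) by apply: (hN n.+1); exact: leqW.
rewrite -(divfK (lt0r_neq0 K0) e'); apply: ltr_pM => //.
  exact: nr_ge0.
by have := nr_coord_le _ y i; lra.
Qed.

(** Identity principle for products: near [y0] the homogeneous coefficients of
    [f g - h k] vanish, because on each ray the power series has infinitely many
    zeros; these coefficients are polynomials, so they vanish identically. *)
Lemma product_identity (f g h k : H) (y0 : 'rV[C]_d) (e : R) : 0 < e -> ball y0 ->
  (forall y : 'rV[C]_d, (forall i, nr (y 0 i - y0 0 i : C) < e) ->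
     X y -> value H f y * value H g y = value H h y * value H k y) ->
  forall y, X y -> value H f y * value H g y = value H h y * value H k y.
Proof.
move=> e0 b0 id0.
have [e1 e10 e1P] := iffLR (nbhs_coord _ _) (open_ball_near _ _ b0).
pose c y n := convol (fun n => hom_part H f n y) (fun n => hom_part H g n y) n
  - convol (fun n => hom_part H h n y) (fun n => hom_part H k n y) n.
have cZ (z : C) y n : c (z *: y) n = z ^+ n * c y n.
  have aux (f1 f2 : H) : convol (fun n => hom_part H f1 n (z *: y)) (fun n => hom_part H f2 n (z *: y)) n
      = z ^+ n * convol (fun n => hom_part H f1 n y) (fun n => hom_part H f2 n y) n.
    rewrite /convol mulr_sumr; apply: eq_bigr => i _; rewrite !hom_partZ.
    have -> : z ^+ n = z ^+ i * z ^+ (n - i) by rewrite -exprD subnKC // -ltnS.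
    by rewrite mulrACA.
  by rewrite /c !aux mulrBr.
have cs y (z : C) : ball y -> nr z <= 1 ->
    sums (c y) z (value H f (z *: y) * value H g (z *: y) - value H h (z *: y) * value H k (z *: y)).
  move=> bY z1; have Xy := domain_open_ball _ a _ _ bY.
  have D q := slice_decay H Hw q _ bY; have S q := sums_slice H Hw q _ _ Xy z1.
  have S1 := sums_convol _ _ _ _ _ (D f) (D g) z1 (S f) (S g).
  have S2 := sums_convol _ _ _ _ _ (D h) (D k) z1 (S h) (S k).
  have := cvg_addC _ _ _ _ S1 (cvg_mulC _ _ _ _ (cvg_cst (-1 : C)) S2).
  rewrite mulN1r => /(_ _) T; rewrite /sums.
  have -> : psum (c y) z = (fun n => psum (convol (fun n => hom_part H f n y) (fun n => hom_part H g n y)) z n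
    + (-1) * psum (convol (fun n => hom_part H h n y) (fun n => hom_part H k n y)) z n).
    apply/funext => N; rewrite mulN1r /psum -sumrB; apply: eq_bigr => i _.
    by rewrite /c mulrBl.
  exact: T.
have cd y : ball y -> geometric_decay (c y).
  move=> bY; have D q := slice_decay H Hw q _ bY.
  by apply: geometric_decayD; apply: geometric_decay_convol.
have c_near (y : 'rV[C]_d) n : (forall i, nr (y 0 i - y0 0 i : C) < Num.min e e1 / 2) -> c y n = 0.
  move=> ynear.
  have m0 : 0 < Num.min e e1 by rewrite lt_min e0.
  have me : Num.min e e1 <= e by rewrite ge_min lexx.
  have me1 : Num.min e e1 <= e1 by rewrite ge_min lexx orbT.
  have bY : ball y by apply: e1P => i; have := ynear i; lra.
  (* The zeros on the ray through [rho *: y], [rho > 1], come from the points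
     [t *: y] with [t < 1] close to 1. *)
  move: (bY) => /open_ball_scale [rho rho1 brho].
  have rho0 : 0 < rho by apply: lt_trans rho1.
  suff q : c (rho%:C *: y) n = 0.
    have := cZ rho%:C y n; rewrite q => /esym/eqP; rewrite mulf_eq0 => /orP[|/eqP //].
    by rewrite expf_eq0 eq_complex /= eqxx andbT gt_eqF // andbF.
  have K0 : 0 < euclidean_norm y + 1 :> R by rewrite ltr_wpDl // euclid_ge0.
  have m20 : 0 < Num.min e e1 / 2 by lra.
  have [N hN] := inv_succ_lt _ (divr_gt0 m20 K0).
  have ri0 : 0 < rho^-1 by rewrite invr_gt0.
  have ri1 : rho^-1 < 1 by rewrite invf_lt1.
  apply: (coefficients_eq0 _ (fun i => below1 (i + N) / rho) rho^-1 (cd _ brho) ri1).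
  - move=> i; case/andP: (below1_bounds (i + N)) => t0 t1.
    by rewrite mulr_gt0 //= ler_piMl // ltW.
  - move=> i j /(mulIf (lt0r_neq0 ri0))/below1_inj/eqP; rewrite eqn_add2r => /eqP //.
  move=> i; case/andP: (below1_bounds (i + N)) => t0 t1; set t := below1 (i + N) in t0 t1 *.
  have z1 : nr ((t / rho)%:C : C) <= 1.
    rewrite nr_real ger0_norm; last by rewrite mulr_ge0 // ltW.
    by rewrite mulr_ile1 // ltW.
  have E : (t / rho)%:C *: (rho%:C *: y) = t%:C *: y.
    by rewrite scalerA -rmorphM /= divfK ?gt_eqF.
  have := cs _ _ brho z1; rewrite E.
  have tb i0 : nr ((t%:C *: y) 0 i0 - y0 0 i0 : C) < Num.min e e1.
    have -> : (t%:C *: y) 0 i0 - y0 0 i0 = (y 0 i0 - y0 0 i0) + (t - 1)%:C * y 0 i0.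
      rewrite mxE; move: (t) (y 0 i0) (y0 0 i0) => u b b'.
      by rewrite rmorphB rmorph1 mulrBl mul1r [RHS]addrC subrKA.
    apply: le_lt_trans (nrD _ _) _; have := ynear i0.
    suff : nr ((t - 1)%:C * y 0 i0 : C) < Num.min e e1 / 2 by lra.
    rewrite nrM nr_real /t /below1 addrAC subrr add0r normrN ger0_norm ?invr_ge0 //.
    have h1 : (i + N).+2%:R^-1 < Num.min e e1 / 2 / (euclidean_norm y + 1).
      by apply: (hN (i + N).+1); rewrite leqW // leq_addl.
    rewrite -(divfK (lt0r_neq0 K0) (Num.min e e1 / 2)); apply: ltr_pM => //.
      exact: nr_ge0.
    by have := nr_coord_le _ y i0; lra.
  rewrite id0 ?subrr //.
    by move=> i0; apply: lt_le_trans (tb i0) me.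
  by apply: domain_open_ball; apply: e1P => i0; apply: lt_le_trans (tb i0) me1.
have c0 y n : c y n = 0.
  apply: (polyfun_eq0 (fun y => c y n) y0 (Num.min e e1 / 2)).
  - by rewrite divr_gt0 // lt_min e0.
  - by apply: polyfunB; apply: polyfun_sum => i; apply: polyfunM; exact: polyfun_hom_part.
  - by move=> u hu; exact: c_near.
have inball y : ball y -> value H f y * value H g y = value H h y * value H k y.
  move=> bY; apply/eqP; rewrite -subr_eq0; apply/eqP.
  have n1 : nr (1 : C) <= 1 by rewrite (nr_nat 1).
  have := cs y 1 bY n1; rewrite scale1r => S; apply: cvg_unique_nr S _.
  have -> : psum (c y) 1 = cst (0 : C).
    by apply/funext => N; rewrite /psum big1 // => i _; rewrite c0 mul0r.
  exact: cvg_cst.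
move=> y Xy.
have V q := value_below1 q y Xy.
have A := cvg_mulC _ _ _ _ (V f) (V g); have B := cvg_mulC _ _ _ _ (V h) (V k).
apply: (cvg_uniqueC _ _ _ A).
have -> : (fun n => value H f ((below1 n)%:C *: y) * value H g ((below1 n)%:C *: y)) =
    (fun n => value H h ((below1 n)%:C *: y) * value H k ((below1 n)%:C *: y)).
  by apply/funext => n; rewrite inball //; exact: ball_below1.
exact: B.
Qed.

End Identity.

(** * Surjectivity of the symbol *)

Section Surjectivity.
Context {R : realType} {d1 d2 : nat} {a1 a2 : nat -> R} {r1 r2 : \bar R}.
Context {H1 : hilbert_function_space R (maximal_domain d1 a1 r1)}.
Context {H2 : hilbert_function_space R (maximal_domain d2 a2 r2)}.
Local Notation C := R[i].
Local Notation X1 := (maximal_domain d1 a1 r1).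
Local Notation X2 := (maximal_domain d2 a2 r2).
Context {lam : 'rV[C]_d1 -> C} {Phi : 'rV[C]_d1 -> 'rV[C]_d2} {W : {linear H2 -> H1}}.
Hypotheses (Hw1 : weighted_hardy_space H1) (Hw2 : weighted_hardy_space H2).
Hypothesis hW : intertwines lam Phi W.
Hypotheses (r1_gt0 : (0 < r1)%E) (r2_gt0 : (0 < r2)%E).
Hypotheses (d1_gt0 : (0 < d1)%N) (d2d1 : (d2 <= d1)%N).
Hypothesis ra1 : convergence_radius a1 = (r1 ^+ 2)%E.
Local Notation ip1 := (hfs_ip H1).
Local Notation ip2 := (hfs_ip H2).
Local Notation n1 := (@hfs_ip_norm _ _ H1).
Local Notation n2 := (@hfs_ip_norm _ _ H2).

Lemma mono_eq0 (v : H1) : (forall al, ip1 (mono H1 al) v = 0) -> v = 0.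
Proof.
case: (mono_spec H1 Hw1) => _ _ _ h _ hv; apply: h => al.
by rewrite ipC hv rmorph0.
Qed.

Lemma index_split (al : {ffun 'I_d1 -> nat}) : multi_abs al != 0%N ->
  exists i be, al = add_index (unit_index i) be /\ multi_abs al = (multi_abs be).+1.
Proof.
move=> al0; have [i ai] : exists i, (0 < al i)%N.
  apply: contrapT => h; move/eqP: al0; apply; rewrite /multi_abs big1 // => i _.
  by apply/eqP; rewrite -leqn0 leqNgt; apply/negP => ai; apply: h; exists i.
pose be : {ffun 'I_d1 -> nat} := [ffun j => (al j - (j == i))%N].
have E : al = add_index (unit_index i) be.
  apply/ffunP => j; rewrite !ffunE; case: eqP => [->|_]; last by rewrite subn0.
  by rewrite subnKC.
exists i, be; split => //; rewrite {1}E /multi_abs (eq_bigr (fun j => unit_index i j + be j)%N).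
  rewrite big_split /= (bigD1 i) //= ffunE eqxx big1 ?addn0 ?add1n // => j ji.
  by rewrite ffunE (negbTE ji).
by move=> j _; rewrite ffunE.
Qed.

(** Given [y], the functional [g |-> (W^-1 g) y] is, by the identity principle, a
    nonzero multiple of a functional multiplicative on monomials; boundedness
    puts the corresponding point in the maximal domain of the first space. *)
Lemma Phi_onto y : X2 y -> exists2 w, X1 w & Phi w = y.
Proof.
move=> Xy.
have [e e0 eP] := local_surjectivity Hw1 Hw2 hW r1_gt0 r2_gt0 d1_gt0 d2d1.
have b2 := Phi0_interior Hw1 Hw2 hW r1_gt0 r2_gt0 d1_gt0.
have exg al : exists g, W g = mono H1 al.
  by have [g ->] := W_onto hW (mono H1 al); exists g.
pose g al := projT1 (cid (exg al)).
have Wg al : W (g al) = mono H1 al by rewrite /g; case: cid.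
have XP w : X1 w -> X2 (Phi w) by case: hW => h _ _ _; exact: h.
have gP al w : X1 w -> lam w * value H2 (g al) (Phi w) = monomial al w.
  move=> Xw; rewrite -(value_mono H1 Hw1) // -Wg; case: hW => _ -> //.
(* [W^-1] is multiplicative up to the factor [value H2 (g zero_index)]. *)
have mult al be : forall z, X2 z -> value H2 (g al) z * value H2 (g be) z
    = value H2 (g zero_index) z * value H2 (g (add_index al be)) z.
  apply: (product_identity Hw2 r2_gt0 _ _ _ _ (Phi 0) e e0 b2) => z zP _.
  have [w Xw <-] := eP z zP; have l0 := lam_neq0 Hw1 hW w Xw.
  apply: (mulfI (mulf_neq0 l0 l0)).
  rewrite [LHS]mulrACA [RHS]mulrACA !gP // monomial_zero mul1r.
  by rewrite -monomialM.
set mu := value H2 (g zero_index) y.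
have [M WM] : exists M, forall h, nr (W h) <= M * nr h by case: hW.
have Wb : bijective W by case: hW.
have [T TE] := adjoint_exists n1 n2 W M WM.
have Tb := adjoint_bijective n1 n2 W T M WM Wb TE.
have [v Tv] : exists v, T v = kern H2 y.
  by case: Tb => T' _ T'K; exists (T' (kern H2 y)); rewrite T'K.
have valE h : value H2 h y = ip1 (W h) v by rewrite TE Tv.
have [one hone] := polyfun_value H2 Hw2 _ (polyfun_cst 1).
have mu0 : mu != 0.
  apply/eqP => mu0.
  have g0 al : value H2 (g al) y = 0.
    have := mult al al y Xy; rewrite -/mu mu0 mul0r => /eqP.
    by rewrite mulf_eq0 orbb => /eqP.
  have v0 : v = 0 by apply: mono_eq0 => al; rewrite -Wg -valE g0.
  by have := hone y Xy; rewrite valE v0 ip0r => /esym/eqP; rewrite oner_eq0.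
pose p : 'rV[C]_d1 := \row_i (value H2 (g (unit_index i)) y / mu).
have gE al : value H2 (g al) y = mu * monomial al p.
  have [n aln] := ubnP (multi_abs al); elim: n al aln => // n IH al aln.
  have [a0|/index_split [i [be [ale abs_al]]]] := eqVneq (multi_abs al) 0%N.
    have -> : al = zero_index.
      apply/ffunP => i; rewrite ffunE; apply/eqP; rewrite -leqn0 -a0.
      by rewrite /multi_abs (bigD1 i) //= leq_addr.
    by rewrite monomial_zero mulr1.
  apply: (mulfI mu0); rewrite {1}ale -mult // (IH be); last by rewrite -ltnS -abs_al.
  rewrite ale monomialM monomial_unit mxE.
  move: (value H2 _ y) (monomial be p) => u b.
  by rewrite [RHS]mulrCA [u / mu * b]mulrAC [mu * (_ / mu)]mulrC divfK // mulrCA.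
have mv al : ip1 (mono H1 al) v = mu * monomial al p by rewrite -Wg -valE gE.
(* [h N] pairs with [v] to [mu] times its own squared norm, so that norm is
   bounded. *)
pose h N : H1 := \sum_(n < N) hom_kern H1 n p.
have hv N : ip1 (h N) v = mu * (nr (h N) ^+ 2)%:C.
  rewrite (nr_sum_hom_kern H1 Hw1) rmorph_sum mulr_sumr /h ip_suml; apply: eq_bigr => n _ /=.
  have <- : ip1 (hom_kern H1 n p) (hom_kern H1 n p) = (a1 n * sqn p ^+ n)%:C.
    by rewrite (ip_hom_kern2 H1 Hw1) eqxx.
  rewrite {1 2}/hom_kern !ip_suml mulr_sumr; apply: eq_big_seq => al.
  rewrite mem_multi_indices => aln.
  by rewrite !ipZl mv (ip_hom_kern H1 Hw1) aln mulrCA.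
have mup : 0 < nr mu.
  by rewrite lt_neqAle nr_ge0 andbT eq_sym; apply/eqP => /nr_eq0/eqP; apply/negP.
have Xp : X1 p.
  apply: (domain_bounded _ _ _ (coef_gt0 H1 Hw1) ra1 r1_gt0 _ ((nr v / nr mu) ^+ 2)) => N.
  rewrite -(nr_sum_hom_kern H1 Hw1) -/(h N) lerXn2r ?nnegrE ?divr_ge0 ?nr_ge0 //.
  rewrite ler_pdivlMr //.
  have [->|hn] := eqVneq (nr (h N)) 0; first by rewrite mul0r nr_ge0.
  have hp : 0 < nr (h N) by rewrite lt_neqAle eq_sym hn nr_ge0.
  rewrite -(ler_pM2l hp); apply: le_trans (cauchy_schwarz n1 (h N) v).
  by rewrite hv nrM nr_real ger0_norm ?sqr_ge0 // mulrA -expr2 mulrC.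
exists p => //.
have vE : v = Num.conj mu *: kern H1 p.
  apply/eqP; rewrite -subr_eq0; apply/eqP/mono_eq0 => al.
  by rewrite ipBr mv ipZr conjCK -/(value H1 _ _) (value_mono H1 Hw1) // subrr.
have eqv f : value H2 f y = mu * (lam p * value H2 f (Phi p)).
  rewrite valE vE ipZr conjCK -/(value H1 _ _); case: hW => _ -> //.
have ml : mu * lam p = 1.
  by have := eqv one; rewrite (hone y Xy) (hone _ (XP p Xp)) mulr1 => <-.
apply/rowP => i; have [c hc] := polyfun_value H2 Hw2 _ (polyfun_coord i).
by have := eqv c; rewrite mulrA ml mul1r (hc y Xy) (hc _ (XP p Xp)) => ->.
Qed.

End Surjectivity.

(** * Isomorphism and comparison of the radii *)

Section Isomorphism.
Context {R : realType}.
Local Notation C := R[i].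
Context {d1 d2 : nat} {a1 a2 : nat -> R} {r1 r2 : \bar R}.
Context {H1 : hilbert_function_space R (maximal_domain d1 a1 r1)}.
Context {H2 : hilbert_function_space R (maximal_domain d2 a2 r2)}.
Local Notation X1 := (maximal_domain d1 a1 r1).
Local Notation X2 := (maximal_domain d2 a2 r2).
Hypotheses (Hw1 : weighted_hardy_space H1) (Hw2 : weighted_hardy_space H2).
Hypotheses (r1_gt0 : (0 < r1)%E) (r2_gt0 : (0 < r2)%E).
Hypotheses (d1_gt0 : (0 < d1)%N) (d2_gt0 : (0 < d2)%N).
Hypothesis ra1 : convergence_radius a1 = (r1 ^+ 2)%E.

(** The isomorphism is the adjoint of the weighted composition operator, which
    carries kernel vectors to multiples of kernel vectors. *)
Lemma isomorphic_of_dimension_le lambda phi : (d2 <= d1)%N ->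
  invertible_weighted_composition H1 H2 lambda phi -> rkhs_isomorphic H1 H2.
Proof.
move=> d21 /intertwines_exists [lam [Phi [W [hW lamE PhiE]]]].
have [WX WV [M WM] Wb] := hW.
have M0 : 0 <= `|M| by [].
have WM' g : nr (W g) <= `|M| * nr g.
  by apply: le_trans (WM g) _; rewrite ler_wpM2r ?nr_ge0 // ler_norm.
have n1 := @hfs_ip_norm _ _ H1; have n2 := @hfs_ip_norm _ _ H2.
have [T TE] := adjoint_exists n1 n2 W _ WM'.
exists T, lambda, phi; split.
- exists `|M| => f; rewrite !nrE -rmorphM lecR.
  exact: (adjoint_bounded n1 n2 W T _ M0 WM' TE).
- exact: (adjoint_bijective n1 n2 W T _ WM' Wb TE).
- by move=> x; rewrite -lamE; apply: (lam_neq0 Hw1 hW); exact: set_valP.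
- have surj y : exists x, phi x = y.
    have [w Xw Pw] := Phi_onto Hw1 Hw2 hW r1_gt0 r2_gt0 d1_gt0 d21 ra1 (val y) (set_valP y).
    by exists (pt w Xw); apply: val_inj; rewrite -PhiE.
  have inj : injective phi.
    move=> x x' e; apply: val_inj; apply: (Phi_inj Hw1 hW); try exact: set_valP.
    by rewrite !PhiE e.
  exists (fun y => projT1 (cid (surj y))) => [x|y]; last by case: cid.
  by apply: inj; case: cid.
move=> x; apply: (ip_ext n2) => g.
rewrite -TE ipZr conjCK -!kernelE !valueE WV ?lamE ?PhiE //; exact: set_valP.
Qed.

Lemma dimension_le_of_related : weakly_related H1 H2 -> (d1 <= d2)%N.
Proof.
move=> [lambda [phi /intertwines_exists [lam [Phi [W [hW _ _]]]]]].
exact: (dimension_le_of_intertwining Hw1 Hw2 hW).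
Qed.

Lemma infinite_radius_of_related : weakly_related H1 H2 -> r1 = +oo%E -> r2 = +oo%E.
Proof.
move=> [lambda [phi /intertwines_exists [lam [Phi [W [hW _ _]]]]]].
exact: (infinite_radius Hw1 Hw2 hW).
Qed.

(** A closed ball is compact, so the norm of its image attains a maximum; it
    cannot be mapped onto an open ball. *)
Lemma finite_value_of_related : (d2 <= d1)%N -> weakly_related H1 H2 ->
  (r1 < +oo)%E -> (r2 < +oo)%E ->
  (gf_value a1 (fine r1 ^+ 2) < +oo)%E -> (gf_value a2 (fine r2 ^+ 2) < +oo)%E.
Proof.
move=> d21 [lambda [phi /intertwines_exists [lam [Phi [W [hW _ _]]]]]].
move=> r1f r2f; rewrite !ltey => g1; apply/negP => /eqP g2.
have X2E w : X2 w <-> ((euclidean_norm w)%:E < r2)%E.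
  by rewrite /maximal_domain (lt_eqF r2f) g2 eqxx.
have X1E w : X1 w <-> ((euclidean_norm w)%:E <= r1)%E.
  by rewrite /maximal_domain (lt_eqF r1f) (negbTE g1).
have [P [PE _ Pc]] := Phi_extension Hw1 Hw2 hW.
have [s1 s10 r1E] : exists2 s, 0 < s & r1 = s%:E.
  by case: r1 r1_gt0 r1f => [s||] //; rewrite lte_fin => s0 _; exists s.
have [s2 s20 r2E] : exists2 s, 0 < s & r2 = s%:E.
  by case: r2 r2_gt0 r2f => [s||] //; rewrite lte_fin => s0 _; exists s.
pose B := [set w : 'rV[C]_d1 | euclidean_norm w <= s1].
have BE : B = X1.
  by apply/seteqP; split => w; rewrite /B /= X1E r1E lee_fin.
have B0 : B !=set0.
  by exists 0; rewrite /B /= euclidE /sqn big1 ?sqrtr0 ?ltW // => i _; rewrite mxE nr0 expr0n.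
have fc : {within B, continuous (fun w => euclidean_norm (P w) : R)}.
  rewrite BE; apply/subspace_continuousP => w Xw.
  have nF : Filter (within X1 (nbhs w)) := within_filter _ (nbhs_filter w).
  by apply: (@euclid_cvg R d2 _ (within X1 (nbhs w)) nF P (P w)) => i; exact: Pc.
have [w wB wmax] := compact_EVT_max B0 (compact_closed_ball s1) fc.
have {}wB : X1 w by rewrite -BE; exact: set_mem.
have Pw : euclidean_norm (P w) < s2.
  by rewrite -lte_fin -r2E -X2E PE //; case: hW => h _ _ _; exact: h.
have t0 : 0 <= (euclidean_norm (P w) + s2) / 2 by have := euclid_ge0 _ (P w); lra.
have [y yE] := vector_of_norm _ _ d2_gt0 t0.
have Xy : X2 y by rewrite X2E yE r2E lte_fin; lra.
have [u Xu uy] := Phi_onto Hw1 Hw2 hW r1_gt0 r2_gt0 d1_gt0 d21 ra1 y Xy.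
have := wmax u; rewrite PE // uy yE => h.
by have := h (mem_set _); rewrite BE => /(_ Xu); lra.
Qed.

End Isomorphism.

Theorem proposition6p4 (R : realType) (d1 d2 : nat) (a1 a2 : nat -> R)
    (r1 r2 : \bar R)
    (H1 : hilbert_function_space R (maximal_domain d1 a1 r1))
    (H2 : hilbert_function_space R (maximal_domain d2 a2 r2))
    (lambda : maximal_domain d1 a1 r1 -> R[i])
    (phi : maximal_domain d1 a1 r1 -> maximal_domain d2 a2 r2) :
  (0 < d1)%N -> (0 < d2)%N ->
  (0 < r1)%E -> (0 < r2)%E ->
  convergence_radius a1 = (r1 ^+ 2)%E ->
  convergence_radius a2 = (r2 ^+ 2)%E ->
  weighted_hardy_space H1 -> weighted_hardy_space H2 ->
  invertible_weighted_composition H1 H2 lambda phi ->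
  [/\ (d2 <= d1)%N -> rkhs_isomorphic H1 H2 /\ d1 = d2,
      strongly_related H1 H2 -> rkhs_isomorphic H1 H2 /\ d1 = d2,
      strongly_related H1 H2 -> (entire a1 <-> entire a2) &
      strongly_related H1 H2 -> (r1 < +oo)%E ->
        (r2 < +oo)%E /\
        ((gf_value a1 (fine r1 ^+ 2) < +oo)%E <->
         (gf_value a2 (fine r2 ^+ 2) < +oo)%E)].
Proof.
move=> d1_gt0 d2_gt0 r1_gt0 r2_gt0 ra1 ra2 Hw1 Hw2 hlp.
have rel12 : weakly_related H1 H2 by exists lambda, phi.
have d12 : (d1 <= d2)%N by exact: (dimension_le_of_related Hw1 Hw2).
have iso : (d2 <= d1)%N -> rkhs_isomorphic H1 H2 /\ d1 = d2.
  move=> d21; split; last by apply/eqP; rewrite eqn_leq d12.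
  exact: (isomorphic_of_dimension_le Hw1 Hw2 r1_gt0 r2_gt0 d1_gt0 ra1 lambda phi d21 hlp).
have d21 : strongly_related H1 H2 -> (d2 <= d1)%N.
  by move=> [_ rel21]; exact: (dimension_le_of_related Hw2 Hw1).
have infinity_entire (a : nat -> R) (r : \bar R) : (0 < r)%E ->
    convergence_radius a = (r ^+ 2)%E -> entire a <-> r = +oo%E.
  move=> r0 ra; rewrite /entire ra; case: r r0 {ra} => [s _|_|//].
    by rewrite -EFin_expe.
  by rewrite expe2 mulyy.
split => //.
- by move=> /d21; exact: iso.
- move=> [_ rel21]; rewrite (infinity_entire _ _ r1_gt0 ra1) (infinity_entire _ _ r2_gt0 ra2).
  split; [exact: (infinite_radius_of_related Hw1 Hw2) |].
  exact: (infinite_radius_of_related Hw2 Hw1).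
move=> st; have {d21} d21 := d21 st; case: st => _ rel21 r1f.
have r2f : (r2 < +oo)%E.
  rewrite ltey; apply/eqP => r2oo; move: r1f.
  by rewrite (infinite_radius_of_related Hw2 Hw1 r2_gt0 r1_gt0 d2_gt0 rel21 r2oo) ltxx.
split => //; split.
  exact: (finite_value_of_related Hw1 Hw2).
exact: (finite_value_of_related Hw2 Hw1).
Qed.
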